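(* There is an absolute constant $\epsilon_0>0$ such that the following holds for every constant $0<\epsilon\le\epsilon_0$. Let $p=p(n)$ satisfy $n^{-2/3+\epsilon}<p<1/\log(n)^2$, and let $k_x=k_x(n)$ be the largest integer $k$ for which $\binom{n}{k}(1-p)^{\binom{k}{2}}>n^{2\epsilon}$. Then there exists an integer $k_z=k_z(n)$ such that $\alpha(G_{n,p})\in\{k_z,k_z+1\}$ with high probability. Furthermore, for this $k_z$ we have (as $n\to\infty$): (i) if $p=\omega\left(\log(n)n^{-1/2}\right)$ then $k_x-k_z=0$ (for $n$ sufficiently large); (ii) if $p=C\log(n)n^{-1/2}$ for a constant $C>0$, then $k_x-k_z=\xi_n$ (for $n$ sufficiently large), where $\xi_n\in\left(\frac{1}{e^2C^2}-\frac52,\ \frac{1}{e^2C^2}+\frac32\right)$; (iii) if $p=o\left(\log(n)n^{-1/2}\right)$ then $$k_x-k_z\sim\frac{k_x^2}{e^2n}\sim\frac{4\log(np)^2}{e^2p^2n}.$$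
   Context: $G_{n,p}$ is the binomial random graph on $n$ vertices with edge probability $p=p(n)$; $\alpha(G)$ is the independence number. ''With high probability'' means with probability tending to $1$ as $n\to\infty$. $\log$ is the natural logarithm, and $\log(x)^2$ means $(\log x)^2$. We write $f(n)\sim g(n)$ if $\lim_{n\to\infty}f(n)/g(n)=1$. Note that $\binom{n}{k}(1-p)^{\binom{k}{2}}$ is the expected number of independent sets of size $k$ in $G_{n,p}$. *)

(* Defs.v *)
(* MathComp + MathComp-Analysis. *)
From mathcomp Require Import all_boot all_order all_algebra.
From mathcomp Require Import all_classical all_reals all_analysis.

Set Implicit Arguments.
Unset Strict Implicit.
Unset Printing Implicit Defensive.

Import Order.TTheory GRing.Theory Num.Theory.
Import numFieldNormedType.Exports.

Local Open Scope classical_set_scope.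
Local Open Scope ring_scope.

(* Simple graphs on the vertex set 'I_n, given by their sets of edges. *)
Definition edge (n : nat) := {e : {set 'I_n} | #|e| == 2%N}.
Definition graph (n : nat) := {set edge n}.

Definition independent (n : nat) (G : graph n) (S : {set 'I_n}) : bool :=
  [forall e : edge n, (e \in G) ==> ~~ (val e \subset S)].

Definition alpha (n : nat) (G : graph n) : nat :=
  \max_(S : {set 'I_n} | independent G S) #|S|.

(* Probability of the event A for G_{n,p}. The formula makes sense for every
   real p, and is a probability when 0 <= p <= 1. *)
Definition gnp_pr (R : realType) (n : nat) (p : R) (A : pred (graph n)) : R :=
  \sum_(G : graph n | A G) \prod_(e : edge n) (if e \in G then p else 1 - p).

Definition whp (R : realType) (p : nat -> R)
    (A : forall n : nat, pred (graph n)) : Prop :=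
  gnp_pr (p n) (A n) @[n --> \oo] --> (1 : R).

Definition expected_indep (R : realType) (n : nat) (p : R) (k : nat) : R :=
  'C(n, k)%:R * (1 - p) ^+ 'C(k, 2).

(* Negative integers k are not considered: 'C(n, k) is 0 for them, so they never
   satisfy expected_indep n p k > n ^ (2 eps). *)
Definition is_largest (P : nat -> Prop) (k : nat) : Prop :=
  P k /\ forall j : nat, P j -> (j <= k)%N.

Definition asymp_equiv (R : realType) (f g : nat -> R) : Prop :=
  f n / g n @[n --> \oo] --> (1 : R).

Definition little_omega (R : realType) (f g : nat -> R) : Prop :=
  g =o_\oo f.

Definition log_over_sqrt (R : realType) (n : nat) : R :=
  ln n%:R * n%:R `^ (- 2^-1).

(* Main.v *)
(* Among the maximum independent sets, one of least label sum is [good]: every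
   vertex outside it has a neighbour in it, and none has as unique neighbour in it
   a vertex of larger label, as the two could be swapped. So P(alpha = k) is at
   most the expected number of good k-sets, which is about E_k times
   exp (- n (y + c k / 2)), where E_k is the expected number of independent
   k-sets, y = (1 - p)^k and c = p (1 - p)^(k - 1); the swaps, which spoil the
   second moment of the number of independent sets, are paid for by the
   exponential. Conversely the second moment method applies to the [rigid] sets,
   for which moreover no two outside vertices have the same unique neighbour:
   pairs of rigid sets with a small intersection are almost independent, a crude
   count suffices for the medium ones, and if |I \ J| = |J \ I| = l is small then
   rigidity forces 3 l / 2 edges between I \ J and J \ I.
   The integer k_z is the largest k <= k_x for which the estimate above is at
   least n^eps. For k close to k_x it decreases by a factor (np)^(1 + o(1)) at each
   step while the exponential is about (np)^(- Q) with Q = k_x^2 / (e^2 n), so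
   k_x - k_z is within a bounded distance of (1 + o(1)) Q. *)

Require Import Defs.
From mathcomp Require Import all_boot all_order all_algebra.
From mathcomp Require Import ring lra zify.

Set Implicit Arguments.
Unset Strict Implicit.
Unset Printing Implicit Defensive.

Import Order.TTheory GRing.Theory Num.Theory.

Local Open Scope ring_scope.

(* [lra] fails once section hypotheses are cleared, hence the local variants below. *)
Tactic Notation "lra" "from" hyp_list(hs) := clear -hs; lra.

(** * Expectations over a random set *)

(** The exponent -2/3 comes from rigid pairs with |I \ J| = l. Near k_x one has (1-p)^k ~ (k/(e
    n))^2 and k ~ 2 log(np)/p, so exchanging l vertices contributes about (k n (1-p)^k p^(3/2))^l,
    that is (k^3 p^(3/2)/n)^l up to constants: small once n p^(3/2) beats the logarithms. Goodness
    alone forces only l edges and would stop at p ~ n^(-1/2). The same range makes k^3/n^2 small,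
    which controls both the share of good sets that are not rigid and the correction to the expected
    number of good sets. The value k_z + 1 stays undecided: there the estimate is only known to be
    below n^eps. One further step costs a factor of at least n^(1/4), which excludes k_z + 2. The
    thresholds n^(2 eps) for k_x and n^eps for k_z differ on purpose: the exponential may lose a
    factor n^eps before k_z moves away from k_x, which settles dense p. The estimates are proved for
    one fixed n, with a single bound u on the relative errors; limits are taken only at the end. *)

Section RandomSubset.
Variables (R : realFieldType) (E : finType) (p : R).
Implicit Types (G H X Y : {set E}) (f g : {set E} -> R).

Definition bern G : R := \prod_e (if e \in G then p else 1 - p).
Definition Ex f : R := \sum_G bern G * f G.
Definition depends_on X f := forall G, f G = f (G :&: X).

Lemma Ex_prod (a b : E -> R) :
  Ex (fun G => \prod_e (if e \in G then a e else b e)) =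
  \prod_e (p * a e + (1 - p) * b e).
Proof.
rewrite bigA_distr; apply: eq_bigr => G _; rewrite /bern -big_split /=.
by apply: eq_bigr => e _; case: ifP.
Qed.

Lemma Ex1 : Ex (fun=> 1) = 1.
Proof.
have := Ex_prod (fun=> 1) (fun=> 1).
rewrite [X in _ = X]big1 => [h|e _]; last by ring.
rewrite -{}[RHS]h; apply: eq_bigr => G _.
by rewrite [X in _ = _ * X]big1 // => e _; rewrite if_same.
Qed.

Lemma eq_Ex f g : f =1 g -> Ex f = Ex g.
Proof. by move=> fg; apply: eq_bigr => G _; rewrite fg. Qed.

Lemma ExD f g : Ex (fun G => f G + g G) = Ex f + Ex g.
Proof. by rewrite /Ex -big_split; apply: eq_bigr => G _; rewrite mulrDr. Qed.

Lemma ExZ c f : Ex (fun G => c * f G) = c * Ex f.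
Proof. by rewrite /Ex mulr_sumr; apply: eq_bigr => G _; rewrite mulrCA. Qed.

Lemma ExN f : Ex (fun G => - f G) = - Ex f.
Proof. by rewrite /Ex -sumrN; apply: eq_bigr => G _; rewrite mulrN. Qed.

Lemma ExB f g : Ex (fun G => f G - g G) = Ex f - Ex g.
Proof. by rewrite ExD ExN. Qed.

Lemma Ex_sum (I : finType) (P : pred I) (F : I -> {set E} -> R) :
  Ex (fun G => \sum_(i | P i) F i G) = \sum_(i | P i) Ex (F i).
Proof.
rewrite /Ex exchange_big /=; apply: eq_bigr => G _.
by rewrite mulr_sumr.
Qed.

(** Two independent copies [G], [H] exchange their parts outside [X]: this preserves the product
    weight, leaves [f G] unchanged, and turns [g H] into [g G] because [Y] lies outside [X]. *)
Lemma Ex_indep X Y f g : [disjoint X & Y] -> depends_on X f -> depends_on Y g ->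
  Ex (fun G => f G * g G) = Ex f * Ex g.
Proof.
move=> dXY fX gY.
have -> : Ex f * Ex g =
    \sum_(GH : {set E} * {set E}) bern GH.1 * bern GH.2 * (f GH.1 * g GH.2).
  rewrite /Ex big_distrlr /= pair_bigA /=; apply: eq_bigr => GH _; ring.
pose sw (GH : {set E} * {set E}) :=
  ((GH.1 :&: X) :|: (GH.2 :\: X), (GH.2 :&: X) :|: (GH.1 :\: X)).
have swK : involutive sw.
  move=> [G H]; rewrite /sw /=; congr pair; apply/setP => e; rewrite !inE;
    by case: (e \in X); rewrite ?andbT ?andbF ?orbF ?orbT.
rewrite (reindex_inj (inv_inj swK)) /=.
have -> : Ex (fun G => f G * g G) =
    \sum_(GH : {set E} * {set E}) bern GH.1 * bern GH.2 * (f GH.1 * g GH.1).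
  transitivity (Ex (fun G => f G * g G) * Ex (fun=> 1)).
    by rewrite Ex1 mulr1.
  rewrite /Ex big_distrlr /= pair_bigA /=; apply: eq_bigr => GH _; ring.
apply: eq_bigr => -[G H] _ /=; congr (_ * _).
  rewrite /bern -!big_split /=; apply: eq_bigr => e _; rewrite !inE.
  by case: (e \in X); rewrite ?andbT ?andbF ?orbF ?orbT //= mulrC.
rewrite fX [in RHS]fX [in LHS]gY [in RHS]gY; congr (f _ * g _);
  apply/setP => e; rewrite !inE.
  by case: (e \in X); rewrite ?andbT ?andbF ?orbF ?orbT.
case eY: (e \in Y); rewrite ?andbF // !andbT.
have /negbTE-> : e \notin X by rewrite (disjointFl dXY).
by rewrite andbF.
Qed.

Lemma Ex_indep_seq (I : eqType) (s : seq I) (X : I -> {set E})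
    (F : I -> {set E} -> R) (X0 : {set E}) f0 :
  uniq s -> depends_on X0 f0 ->
  {in s, forall i, [disjoint X0 & X i]} ->
  {in s &, forall i j, i != j -> [disjoint X i & X j]} ->
  {in s, forall i, depends_on (X i) (F i)} ->
  Ex (fun G => f0 G * \prod_(i <- s) F i G) = Ex f0 * \prod_(i <- s) Ex (F i).
Proof.
elim: s X0 f0 => [|i s IH] X0 f0 /=.
  by move=> *; rewrite big_nil mulr1; apply: eq_Ex => G; rewrite big_nil mulr1.
case/andP=> nis us f0X d0 dd dF.
transitivity (Ex (fun G => (f0 G * F i G) * \prod_(j <- s) F j G)).
  by apply: eq_Ex => G; rewrite big_cons mulrA.
rewrite big_cons mulrA -(Ex_indep (d0 i _) f0X (dF i _)) ?mem_head //.
apply: (IH (X0 :|: X i)) => //.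
- by move=> G; rewrite f0X dF ?mem_head // [in RHS]f0X [X in _ = _ * X]dF ?mem_head //;
    congr (f0 _ * F i _); apply/setP => e; rewrite !inE; do ![case: (e \in _)].
- move=> j js; rewrite -setI_eq0 setIUl setU_eq0 !setI_eq0 d0 ?inE ?js ?orbT //=.
  by rewrite dd ?inE ?js ?eqxx ?orbT //; apply: contraNneq nis => ->.
- by move=> j k js ks; apply: dd; rewrite inE ?js ?ks orbT.
- by move=> j js; apply: dF; rewrite inE js orbT.
Qed.

Lemma Ex_indep_big (I : finType) (P : pred I) (X : I -> {set E})
    (F : I -> {set E} -> R) (X0 : {set E}) f0 :
  depends_on X0 f0 ->
  (forall i, P i -> [disjoint X0 & X i]) ->
  (forall i j, P i -> P j -> i != j -> [disjoint X i & X j]) ->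
  (forall i, P i -> depends_on (X i) (F i)) ->
  Ex (fun G => f0 G * \prod_(i | P i) F i G) = Ex f0 * \prod_(i | P i) Ex (F i).
Proof.
move=> f0X d0 dd dF; rewrite -big_filter.
have mP i : i \in [seq i <- index_enum I | P i] -> P i by rewrite mem_filter => /andP[].
rewrite -(Ex_indep_seq (X := X) (X0 := X0)) //.
- by apply: eq_Ex => G; rewrite big_filter.
- by rewrite filter_uniq // index_enum_uniq.
- by move=> i /mP; apply: d0.
- by move=> i j /mP Pi /mP Pj; apply: dd.
- by move=> i /mP; apply: dF.
Qed.

Lemma Ex_pattern X Y : Y \subset X ->
  Ex (fun G => (G :&: X == Y)%:R) = p ^+ #|Y| * (1 - p) ^+ #|X :\: Y|.
Proof.
move=> YX.
(* The edgewise factors multiply to the indicator of [G :&: X == Y]: a present edge must avoid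
   [X :\: Y], an absent one must avoid [Y]. *)
have := Ex_prod (fun e => ((e \in X) ==> (e \in Y))%:R)
                (fun e => (~~ (e \in Y))%:R).
rewrite (bigID (mem X)) /= [X in _ * X]big1; last first.
  move=> e eX; have /negbTE-> : e \notin Y by apply: contra eX => /(subsetP YX).
  by rewrite (negbTE eX) /=; ring.
rewrite mulr1 (bigID (mem Y)) /=.
have -> : \prod_(i in X | i \in Y) (p * ((i \in X) ==> (i \in Y))%:R +
   (1 - p) * (i \notin Y)%:R) = p ^+ #|Y|.
  rewrite -prodr_const; apply: eq_big => [e|e /andP[eX eY]].
    by rewrite andbC; case eY: (e \in Y) => //=; rewrite (subsetP YX).
  by rewrite eX eY /=; ring.
have -> : \prod_(i in X | i \notin Y) (p * ((i \in X) ==> (i \in Y))%:R +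
   (1 - p) * (i \notin Y)%:R) = (1 - p) ^+ #|X :\: Y|.
  rewrite -prodr_const; apply: eq_big => [e|e /andP[eX eY]].
    by rewrite inE andbC.
  by rewrite eX (negbTE eY) /=; ring.
move=> <-; apply: eq_Ex => G.
have [GX|GX] := boolP (G :&: X == Y).
  rewrite big1 // => e _; have := (eqP GX) => /setP/(_ e); rewrite inE => <-.
  by case: (e \in G) => //=; case: (e \in X).
have : [exists e, (e \in G :&: X) != (e \in Y)].
  apply: contraR GX; rewrite negb_exists => /forallP h.
  by apply/eqP/setP => e; have := h e; rewrite negbK => /eqP.
case/existsP=> e; rewrite inE => he.
apply/esym/eqP/prodf_eq0; exists e => //.
case eG: (e \in G) he => /=; case eX: (e \in X) => //=; case eY: (e \in Y) => //=.
by rewrite (subsetP YX) in eX.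
Qed.

Hypotheses (p0 : 0 <= p) (p1 : p <= 1).

Lemma bern_ge0 G : 0 <= bern G.
Proof. by apply: prodr_ge0 => e _; case: ifP; rewrite // subr_ge0. Qed.

Lemma ler_Ex f g : (forall G, f G <= g G) -> Ex f <= Ex g.
Proof. by move=> fg; apply: ler_sum => G _; rewrite ler_wpM2l ?bern_ge0. Qed.

Lemma Ex_ge0 f : (forall G, 0 <= f G) -> 0 <= Ex f.
Proof. by move=> f0; apply: sumr_ge0 => G _; rewrite mulr_ge0 ?bern_ge0. Qed.

(** The generating function of a binomial variable; the Markov bounds on numbers of edges below go
    through it. *)
Lemma Ex_powcard X (x : R) :
  Ex (fun G => x ^+ #|G :&: X|) = (p * x + (1 - p)) ^+ #|X|.
Proof.
have := Ex_prod (fun e => if e \in X then x else 1) (fun=> 1).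
rewrite (bigID (mem X)) /= [X in _ * X]big1; last first.
  by move=> e /negbTE->; ring.
rewrite mulr1 => h; rewrite -prodr_const.
transitivity (Ex (fun G => \prod_e (if e \in G then if e \in X then x else 1 else 1))).
  apply: eq_Ex => G; rewrite -prodr_const big_mkcond; apply: eq_bigr => e _.
  by rewrite inE; case: (e \in G).
by rewrite h; apply: eq_bigr => e ->; rewrite mulr1.
Qed.

(** Chebyshev's inequality in second moment form: [(f G - m) ^+ 2 / m ^+ 2] equals 1 wherever [f]
    vanishes. *)
Lemma Ex_eq0_le f : 0 < Ex f ->
  Ex (fun G => (f G == 0)%:R) <= Ex (fun G => f G ^+ 2) / Ex f ^+ 2 - 1.
Proof.
move=> m0; set m := Ex f.
have -> : Ex (fun G => f G ^+ 2) / m ^+ 2 - 1 = Ex (fun G => (f G - m) ^+ 2 / m ^+ 2).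
  transitivity (Ex (fun G => (f G ^+ 2 / m ^+2 - 2 / m * f G) + 1)).
    rewrite ExD ExB ExZ Ex1 -/m.
    have -> : Ex (fun G => f G ^+ 2 / m ^+ 2) = Ex (fun G => f G ^+ 2) / m ^+ 2.
      by rewrite mulrC -ExZ; apply: eq_Ex => G; rewrite mulrC.
    by field; rewrite gt_eqF.
  by apply: eq_Ex => G; field; rewrite gt_eqF.
apply: ler_Ex => G; case: eqP => [->|_] /=.
  by rewrite sub0r sqrrN divff // expf_neq0 // gt_eqF.
by rewrite divr_ge0 ?sqr_ge0.
Qed.

End RandomSubset.

(** * Good and rigid independent sets *)

Section Neighbours.
Variable n : nat.
Implicit Types (G : graph n) (A B I J U Y S : {set 'I_n}) (u v w : 'I_n) (X : {set edge n}).

Definition adj G u v := [exists e in G, val e == [set u; v]].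
Definition nb G I v := [set u in I | adj G v u].
Definition einI I : {set edge n} := [set e : edge n | val e \subset I].
Definition star v Y : {set edge n} := [set e : edge n | [exists u in Y, val e == [set v; u]]].

Lemma adjC G u v : adj G u v = adj G v u.
Proof. by rewrite /adj setUC. Qed.

Lemma adj_neq G u v : adj G u v -> u != v.
Proof.
case/exists_inP => e _ /eqP ve; apply/eqP => uv.
by have := valP e; rewrite ve uv setUid cards1.
Qed.

Lemma edge_exists u v : u != v -> exists e : edge n, val e = [set u; v].
Proof.
by move=> uv; have h : #|[set u; v]| == 2 by [rewrite cards2 uv];
  exists (@exist {set 'I_n} (fun e => #|e| == 2) [set u; v] h).
Qed.

Lemma adjP G (e : edge n) u v : val e = [set u; v] -> adj G u v = (e \in G).
Proof.
move=> ve; apply/exists_inP/idP => [[e' e'G /eqP ve']|eG]; last first.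
  by exists e => //; apply/eqP.
by have -> : e = e' by apply: val_inj; rewrite ve'.
Qed.

Lemma edgeP (e : edge n) : exists u v, u != v /\ val e = [set u; v].
Proof. by have /cards2P [u [v uv]] := valP e; exists u, v. Qed.

Lemma independentE G S : independent G S = (G :&: einI S == set0).
Proof.
apply/forallP/eqP => [h|h e].
  apply/setP => e; rewrite !inE; apply/negP => /andP[eG eS].
  by have := h e; rewrite eG eS.
apply/implyP => eG; apply/negP => eS.
by have /setP/(_ e) := h; rewrite !inE eG eS.
Qed.

Lemma independent_nadj G S u v : independent G S -> u \in S -> v \in S -> ~~ adj G u v.
Proof.
move=> /forallP h uS vS; apply/negP => /exists_inP[e eG /eqP ve].
by have := h e; rewrite eG /= ve subUset !sub1set uS vS.
Qed.

Lemma nadj_independent G S :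
  (forall u v, u \in S -> v \in S -> ~~ adj G u v) -> independent G S.
Proof.
move=> h; apply/forallP => e; apply/implyP => eG; apply/negP => eS.
have [u [v [uv ve]]] := edgeP e.
have uS : u \in S by apply: (subsetP eS); rewrite ve !inE eqxx.
have vS : v \in S by apply: (subsetP eS); rewrite ve !inE eqxx orbT.
by have := h u v uS vS; rewrite (adjP _ ve) eG.
Qed.

Lemma card_einI I : #|einI I| = 'C(#|I|, 2).
Proof.
rewrite -cards_draws -(card_imset _ val_inj).
apply: eq_card => A; rewrite inE; apply/imsetP/andP => [[e]|[AI A2]].
  by rewrite inE => eI ->; split => //; exact: (valP e).
by exists (@exist {set 'I_n} (fun e => #|e| == 2) A A2) => //; rewrite inE.
Qed.

Lemma set2_inj v u w : v != u -> [set v; u] = [set v; w] -> u = w.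
Proof.
move=> vu /setP/(_ u); rewrite !inE eqxx orbT => /esym/orP[/eqP h|/eqP//].
by rewrite h eqxx in vu.
Qed.

Lemma mem_star v Y u (e : edge n) : val e = [set v; u] -> (e \in star v Y) = (u \in Y).
Proof.
move=> ve; rewrite inE; apply/exists_inP/idP => [[w wY /eqP]|uY]; last first.
  by exists u => //; apply/eqP.
rewrite ve => /set2_inj -> //; apply/eqP => vu.
by have := valP e; rewrite ve vu setUid cards1.
Qed.

(** Turns a statement about neighbourhoods into one about edge patterns on [star v I], the form to
    which [Ex_pattern] applies. *)
Lemma nb_star G I v Y : v \notin I -> Y \subset I ->
  (nb G I v == Y) = (G :&: star v I == star v Y).
Proof.
move=> vI YI; apply/eqP/eqP => h.
  apply/setP => e; rewrite inE; have [/exists_inP[u uI /eqP ve]|eI] := boolP [exists u in I,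
    val e == [set v; u]].
    rewrite !(mem_star _ ve) uI andbT -(adjP _ ve).
    by have /setP/(_ u) := h; rewrite inE uI.
  rewrite [e \in star v I]inE (negbTE eI) andbF; apply/esym/negbTE.
  apply: contra eI; rewrite inE => /exists_inP[u uY ve]; apply/exists_inP; exists u => //.
  exact: (subsetP YI).
apply/setP => u; rewrite inE.
case uI: (u \in I) => /=; last by apply/esym/negP => /(subsetP YI); rewrite uI.
have [e ve] : exists e : edge n, val e = [set v; u].
  by apply: edge_exists; apply: contraNneq vI => ->.
rewrite (adjP _ ve); have /setP/(_ e) := h.
by rewrite inE !(mem_star _ ve) uI andbT.
Qed.

Lemma starS v I U : I \subset U -> star v I \subset star v U.
Proof.
move=> IU; apply/subsetP => e; rewrite !inE => /exists_inP[u uI h].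
by apply/exists_inP; exists u => //; apply: (subsetP IU).
Qed.

Lemma card_star v Y : v \notin Y -> #|star v Y| = #|Y|.
Proof.
move=> vY; have vY' u : u \in Y -> v != u by move=> uY; apply: contraNneq vY => ->.
rewrite -(card_imset _ val_inj) /=.
rewrite -(card_in_imset (f := fun u => [set v; u]) (D := Y)); last first.
  by move=> u w /vY' vu _ /set2_inj; apply.
apply: eq_card => A; apply/imsetP/imsetP => [[e]|[u uY ->]].
  by rewrite inE => /exists_inP[u uY /eqP ve] ->; exists u.
have [e ve] := edge_exists (vY' u uY); exists e => //.
by rewrite (mem_star _ ve).
Qed.

Lemma card_nb G I v : v \notin I -> #|G :&: star v I| = #|nb G I v|.
Proof.
move=> vI; have nI : nb G I v \subset I by apply/subsetP => u; rewrite inE => /andP[].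
have /eqP -> : G :&: star v I == star v (nb G I v) by rewrite -nb_star.
by rewrite card_star //; apply: contra vI; apply: (subsetP nI).
Qed.

Lemma nb_setI G X I v : star v I \subset X -> nb (G :&: X) I v = nb G I v.
Proof.
move=> sX; apply/setP => u; rewrite !inE; case uI: (u \in I) => //=.
have [<-|vu] := eqVneq v u.
  by apply/idP/idP => /adj_neq; rewrite eqxx.
have [e ve] := edge_exists vu; rewrite !(adjP _ ve) inE.
by rewrite (subsetP sX) ?andbT // (mem_star _ ve).
Qed.

Lemma disjoint_ein_star U v : v \notin U -> [disjoint einI U & star v U].
Proof.
move=> vU; rewrite disjoint_subset; apply/subsetP => e; rewrite !inE => eU.
apply/negP => /exists_inP[u _ /eqP ve]; case/negP: vU.
by apply: (subsetP eU); rewrite ve !inE eqxx.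
Qed.

Lemma disjoint_star_star U v w : v \notin U -> w \notin U -> v != w ->
  [disjoint star v U & star w U].
Proof.
move=> vU wU vw; rewrite disjoint_subset; apply/subsetP => e; rewrite !inE.
case/exists_inP=> u uU /eqP ve; apply/negP => /exists_inP[u' u'U /eqP ve'].
have : v \in [set w; u'] by rewrite -ve' ve !inE eqxx.
by rewrite !inE (negbTE vw) /= => /eqP vu'; rewrite vu' u'U in vU.
Qed.

Definition bad I v G :=
  (nb G I v == set0) || [exists u in I, (nb G I v == [set u]) && (v < u)%N].

Definition good I G :=
  independent G I && [forall v, (v \notin I) ==> ~~ bad I v G].

Definition unshared I G :=
  [forall u, forall v, forall w, [&& v \notin I, w \notin I, v != w,
     nb G I v == [set u] & nb G I w == [set u]] ==> false].

Definition larger I v := #|[set u in I | (v < u)%N]|.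

Definition btw A B : {set edge n} := \bigcup_(v in B) star v A.

End Neighbours.

(** * Exact probabilities for a single set *)

Section Probabilities.
Variables (R : realFieldType) (n : nat) (p : R).
Implicit Types (G : graph n) (A B I J U Y S : {set 'I_n}) (u v w : 'I_n).
Local Notation q := (1 - p).
Local Notation Ex := (Ex p).

(** The edges inside [U] and the stars of the vertices outside [U] form pairwise disjoint sets of
    edges, hence independent ones. All product formulas for good sets rest on this. *)
Lemma Ex_stars U (f0 : graph n -> R) (F : 'I_n -> graph n -> R) :
  depends_on (einI U) f0 -> (forall v, v \notin U -> depends_on (star v U) (F v)) ->
  Ex (fun G => f0 G * \prod_(v | v \notin U) F v G) =
  Ex f0 * \prod_(v | v \notin U) Ex (F v).
Proof.
move=> d0 dF; apply: (Ex_indep_big _ d0 _ _ dF).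
  by move=> v; apply: disjoint_ein_star.
by move=> v w; apply: disjoint_star_star.
Qed.

Lemma Ex_nb I v Y : v \notin I -> Y \subset I ->
  Ex (fun G => (nb G I v == Y)%:R) = p ^+ #|Y| * q ^+ (#|I| - #|Y|).
Proof.
move=> vI YI; have vY : v \notin Y by apply: contra vI; apply: (subsetP YI).
rewrite -{1}(card_star vY) -(card_star vI) -[in RHS](card_star vY) -cardsDS ?starS //.
rewrite -Ex_pattern ?starS //.
by apply: eq_Ex => G; rewrite nb_star.
Qed.

Lemma depends_nb I U v (F : {set 'I_n} -> R) : I \subset U ->
  depends_on (star v U) (fun G => F (nb G I v)).
Proof. by move=> IU G; rewrite nb_setI // starS. Qed.

Definition sbad I v : R := q ^+ #|I| + (larger I v)%:R * (p * q ^+ #|I|.-1).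

(** Different values of [nb G I v] exclude one another, so the disjunction in [bad] becomes a sum,
    and its probability is exact rather than a union bound. *)
Lemma badE I v G : (bad I v G)%:R =
  (nb G I v == set0)%:R + \sum_(u in [set u in I | (v < u)%N]) (nb G I v == [set u])%:R :> R.
Proof.
rewrite /bad; have [/eqP ->|n0] := boolP (nb G I v == set0).
  rewrite big1 ?addr0 // => u _; rewrite eqEcard cards0 cards1 ltnn andbF.
  by [].
rewrite /= add0r; case: exists_inP => [[u uI /andP[/eqP nu vu]]|h].
  rewrite (bigD1 u) ?inE ?uI //= nu eqxx big1 ?addr0 // => w /andP[_ wu].
  by rewrite (inj_eq set1_inj) eq_sym (negbTE wu).
rewrite big1 // => u; rewrite inE => /andP[uI vu].
case: eqP => // nu; case: h; exists u => //; by rewrite nu eqxx.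
Qed.

Lemma Ex_bad I v : v \notin I -> Ex (fun G => (bad I v G)%:R) = sbad I v.
Proof.
move=> vI; under eq_Ex => G do rewrite badE.
rewrite ExD Ex_nb ?sub0set // cards0 expr0 mul1r subn0; congr (_ + _).
rewrite Ex_sum /larger -sumr_const mulr_suml; apply: eq_bigr => u.
rewrite inE => /andP[uI _]; rewrite Ex_nb ?sub1set // cards1 expr1 mul1r.
by rewrite subn1.
Qed.

Lemma Ex_nbad I v : v \notin I -> Ex (fun G => (~~ bad I v G)%:R) = 1 - sbad I v.
Proof.
move=> vI; rewrite -(Ex_bad vI) -[X in X - _](Ex1 (edge n) p) -ExB.
by apply: eq_Ex => G; case: bad; rewrite ?subrr ?subr0.
Qed.

Lemma depends_bad I U v : I \subset U ->
  depends_on (star v U) (fun G => (~~ bad I v G)%:R : R).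
Proof.
move=> IU; exact: (depends_nb v (fun N => (~~ ((N == set0) ||
  [exists u in I, (N == [set u]) && (v < u)%N]))%:R) IU).
Qed.

Lemma Ex_independent I :
  Ex (fun G => (independent G I)%:R) = q ^+ 'C(#|I|, 2).
Proof.
under eq_Ex => G do rewrite independentE.
by rewrite Ex_pattern ?sub0set // cards0 expr0 mul1r setD0 card_einI.
Qed.

Lemma depends_independent I U : I \subset U ->
  depends_on (einI U) (fun G => (independent G I)%:R : R).
Proof.
move=> IU G; rewrite !independentE -setIA; congr ((_ :&: _ == _)%:R).
apply/esym/setIidPr/subsetP => e; rewrite !inE => eI.
exact: (subset_trans eI IU).
Qed.

Lemma prod_bool (T : finType) (P : pred T) (b : T -> bool) :
  \prod_(i | P i) (b i)%:R = [forall i, P i ==> b i]%:R :> R.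
Proof.
have [/forall_inP h|h] := boolP [forall i, P i ==> b i].
  by rewrite big1 // => i /h ->.
move: h; rewrite negb_forall => /existsP[i]; rewrite negb_imply => /andP[Pi /negbTE bi].
by rewrite (bigD1 i) //= bi mul0r.
Qed.

Lemma goodE I G : (good I G)%:R =
  (independent G I)%:R * \prod_(v | v \notin I) (~~ bad I v G)%:R :> R.
Proof. by rewrite prod_bool /good; case: independent; rewrite ?mul1r ?mul0r. Qed.

Definition Pgood I : R := q ^+ 'C(#|I|, 2) * \prod_(v | v \notin I) (1 - sbad I v).

Lemma Ex_good I : Ex (fun G => (good I G)%:R) = Pgood I.
Proof.
under eq_Ex => G do rewrite goodE.
rewrite Ex_stars; first last.
- by move=> v _; apply: depends_bad.
- exact: depends_independent.
rewrite Ex_independent /Pgood; congr (_ * _).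
by apply: eq_bigr => v vI; rewrite Ex_nbad.
Qed.

End Probabilities.

(** * Structure of maximum independent sets and of pairs of rigid sets *)

Section Deterministic.
Variable n : nat.
Implicit Types (G : graph n) (A B I J U Y S : {set 'I_n}) (u v w : 'I_n).

Lemma leq_alpha G S : independent G S -> (#|S| <= alpha G)%N.
Proof. by move=> h; apply: (leq_bigmax_cond (F := fun S : {set 'I_n} => #|S|)). Qed.

Lemma independent0 G : independent G set0.
Proof. by apply: nadj_independent => u v; rewrite inE. Qed.

Lemma nbP G I v u : (u \in nb G I v) = (u \in I) && adj G v u.
Proof. by rewrite inE. Qed.

(* A maximum independent set of least label sum admits neither an addition nor
   a swap towards a smaller label. *)
Lemma good_exists G : exists2 I : {set 'I_n}, #|I| = alpha G & good I G.
Proof.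
have [S0 S0i S0a] : exists2 S0 : {set 'I_n}, independent G S0 & #|S0| = alpha G.
  have [|S h e] := @eq_bigmax_cond {set 'I_n} [pred S | independent G S] (fun S => #|S|).
    by apply/card_gt0P; exists set0; rewrite inE; apply: independent0.
  by exists S => //; rewrite /alpha e.
pose P (S : {set 'I_n}) := independent G S && (#|S| == alpha G).
have PS0 : P S0 by rewrite /P S0i S0a eqxx.
case: (arg_minnP (fun S : {set 'I_n} => \sum_(u in S) (u : nat))%N PS0) => I /andP[Ii /eqP Ia] Imin.
exists I => //; rewrite /good Ii; apply/forallP => v; apply/implyP => vI.
apply/negP => /orP[/eqP n0|/exists_inP[u uI /andP[/eqP nu vu]]].
  suff : independent G (v |: I) by move/leq_alpha; rewrite cardsU1 vI Ia add1n ltnn.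
  have nv x : x \in I -> ~~ adj G v x.
    by move=> xI; apply/negP => h; have := nbP G I v x; rewrite n0 inE xI h.
  apply: nadj_independent => x y; rewrite !inE.
  move=> /orP[/eqP->|xI] /orP[/eqP->|yI].
  - by apply/negP => /adj_neq; rewrite eqxx.
  - exact: nv.
  - by rewrite adjC nv.
  - exact: (independent_nadj Ii).
have nv x : x \in I :\ u -> ~~ adj G v x.
  rewrite !inE => /andP[xu xI]; apply/negP => h; have := nbP G I v x.
  by rewrite nu inE xI h (negbTE xu).
have vIu : v \notin I :\ u by rewrite !inE negb_and vI orbT.
have PI : P (v |: (I :\ u)).
  rewrite /P cardsU1 vIu -Ia (cardsD1 u I) uI eqxx andbT.
  apply: nadj_independent => x y; rewrite 2!in_setU1.
  move=> /orP[/eqP->|xI] /orP[/eqP->|yI].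
  - by apply/negP => /adj_neq; rewrite eqxx.
  - exact: nv.
  - by rewrite adjC nv.
  - by apply: (independent_nadj Ii); [case/setD1P: xI|case/setD1P: yI].
have := Imin _ PI; rewrite (big_setD1 u uI) /= big_setU1 //= leq_add2r leqNgt vu.
by [].
Qed.

Lemma nbU G I J v : nb G (I :|: J) v = nb G I v :|: nb G J v.
Proof. by apply/setP => u; rewrite !inE andb_orl. Qed.

Lemma sum_card_nb_sym G A B :
  (\sum_(v in B) #|nb G A v| = \sum_(u in A) #|nb G B u|)%N.
Proof.
have h C v : (#|nb G C v| = \sum_(u in C) adj G v u)%N.
  rewrite -sum1_card big_mkcond [in RHS]big_mkcond /=; apply: eq_bigr => u _.
  by rewrite nbP; case: (u \in C) => //=; case: adj.
under eq_bigr => v _ do rewrite h.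
rewrite exchange_big /=; apply: eq_bigr => u _; rewrite h.
by apply: eq_bigr => v _; rewrite adjC.
Qed.

Lemma card_setI_btw G A B : [disjoint A & B] ->
  #|G :&: btw A B| = (\sum_(v in B) #|nb G A v|)%N.
Proof.
move=> dAB; have nA v : v \in B -> v \notin A by move=> vB; rewrite (disjointFl dAB).
rewrite -sum1_card big_mkcond /=.
transitivity (\sum_e \sum_(v in B) ((e \in G :&: star v A) : nat))%N.
  apply: eq_bigr => e _; rewrite inE; case eG: (e \in G) => /=; last first.
    by rewrite big1 // => v _; rewrite inE eG.
  case: bigcupP => [[v vB ev]|h].
    rewrite (bigD1 v) //= inE eG ev big1 // => w /andP[wB wv].
    rewrite inE eG; case ew: (e \in star w A) => //.
    by have := disjoint_star_star (nA _ wB) (nA _ vB) wv; move/disjointFl => /(_ _ ev); rewrite ew.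
  rewrite big1 // => v vB; rewrite inE eG /=; case ev: (e \in star v A) => //.
  by case: h; exists v.
rewrite exchange_big /=; apply: eq_bigr => v vB; rewrite -card_nb ?nA //.
by rewrite -sum1_card [RHS]big_mkcond /=; apply: eq_bigr => e _; case: (e \in _).
Qed.

Lemma card_btw A B : [disjoint A & B] -> #|btw A B| = (#|A| * #|B|)%N.
Proof.
move=> dAB; have nA v : v \in B -> v \notin A by move=> vB; rewrite (disjointFl dAB).
have := card_setI_btw setT dAB; rewrite setTI => ->.
transitivity (\sum_(v in B) #|A|)%N; last by rewrite sum_nat_const mulnC.
by apply: eq_bigr => v vB; rewrite -card_nb ?nA // setTI card_star ?nA.
Qed.

Definition rigid I G := good I G && unshared I G.

Lemma good_indep I G : good I G -> independent G I.
Proof. by case/andP. Qed.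

Lemma good_nbad I G v : good I G -> v \notin I -> ~~ bad I v G.
Proof. by case/andP=> _ /forallP /(_ v) /implyP. Qed.

Lemma nb_setD I J G v : independent G J -> v \in J -> nb G I v = nb G (I :\: J) v.
Proof.
move=> Ji vJ; apply/setP => u; rewrite !nbP !inE.
case uJ: (u \in J) => //=; rewrite (negbTE (independent_nadj Ji vJ uJ)).
by rewrite andbF.
Qed.

(* Between two rigid sets, a vertex of degree one on one side has its own private
   neighbour of degree at least two on the other side; hence the average degree
   is at least 3/2. *)
Lemma rigid_deg1 I J G : rigid I G -> rigid J G ->
  (#|[set v in J :\: I | #|nb G (I :\: J) v| == 1]| +
   #|[set u in I :\: J | #|nb G (J :\: I) u| == 1]| <= #|I :\: J|)%N.
Proof.
move=> /andP[gI cI] /andP[gJ cJ].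
set A := I :\: J; set B := J :\: I.
set B1 := [set v in B | _]; set A1 := [set u in A | _].
have nI v : v \in B -> nb G I v = nb G A v.
  by rewrite inE => /andP[_ vJ]; apply: nb_setD => //; apply: good_indep.
have nJ u : u \in A -> nb G J u = nb G B u.
  by rewrite inE => /andP[_ uI]; apply: nb_setD => //; apply: good_indep.
pose f v := odflt v [pick u in nb G A v].
have fP v : v \in B1 -> nb G A v = [set f v].
  rewrite inE => /andP[_ /cards1P[u nu]]; rewrite /f.
  case: pickP => [w|/(_ u)]; last by rewrite nu inE eqxx.
  by rewrite nu inE => /eqP ->.
have B1B v : v \in B1 -> v \in B by rewrite inE => /andP[].
have BI v : v \in B -> v \notin I by rewrite inE => /andP[].
have AJ v : v \in A -> v \notin J by rewrite inE => /andP[].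
have f_inj : {in B1 &, injective f}.
  move=> v w vB wB fvw; apply/eqP/negPn/negP => vw.
  have /forallP/(_ (f v))/forallP/(_ v)/forallP/(_ w)/negP := cI; apply.
  by rewrite !BI ?B1B // vw !nI ?B1B // fP // fP // fvw eqxx.
have fA v : v \in B1 -> f v \in A.
  by move=> vB; have := nbP G A v (f v); rewrite fP // inE eqxx => /esym/andP[].
(* If [v] and [f v] were each other's only neighbour, goodness of [I] would exclude [v < f v] and
   goodness of [J] would exclude [f v < v]; then [v = f v], although they lie on opposite sides. *)
have fA1 v : v \in B1 -> f v \notin A1.
  move=> vB; apply/negP; rewrite inE => /andP[_ /cards1P[w nw]].
  have vB' := B1B v vB; have uA := fA v vB.
  have : v \in nb G B (f v).
    by rewrite nbP vB' adjC; have := nbP G A v (f v); rewrite fP // inE eqxx => /esym/andP[].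
  rewrite nw inE => /eqP vw; rewrite -vw in nw.
  have := good_nbad gI (BI v vB'); rewrite /bad negb_or => /andP[_].
  rewrite negb_exists => /forallP/(_ (f v)).
  rewrite nI // fP // eqxx; have -> : f v \in I by move: uA; rewrite inE => /andP[].
  rewrite /= -leqNgt => le1.
  have := good_nbad gJ (AJ _ uA); rewrite /bad negb_or => /andP[_].
  rewrite negb_exists => /forallP/(_ v).
  rewrite nJ // nw eqxx; have -> : v \in J by move: vB'; rewrite inE => /andP[].
  rewrite /= -leqNgt => le2.
  have e : v = f v by apply/val_inj/eqP; rewrite eqn_leq le1 le2.
  by move: uA; rewrite -e inE (negbTE (BI v vB')) andbF.
rewrite -(card_in_imset f_inj).
have sA1 : A1 \subset A by apply/subsetP => u; rewrite inE => /andP[].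
have := cardsDS sA1 => h.
have -> : #|A| = (#|A :\: A1| + #|A1|)%N by rewrite h subnK // subset_leq_card.
rewrite leq_add2r; apply/subset_leq_card/subsetP => u /imsetP[v vB ->].
by rewrite inE fA1 // fA.
Qed.

(** Goodness of [I] gives each vertex of [J :\: I] a neighbour in [I], and independence of [J] puts
    it in [I :\: J]. A positive degree plus the indicator of degree one is at least 2. *)
Lemma rigid_degree I J G : good I G -> independent G J ->
  (2 * #|J :\: I| <=
   \sum_(v in J :\: I) #|nb G (I :\: J) v| +
   #|[set v in J :\: I | #|nb G (I :\: J) v| == 1]|)%N.
Proof.
move=> gI iJ; set B := J :\: I.
have -> : #|[set v in B | #|nb G (I :\: J) v| == 1]| =
    (\sum_(v in B) (#|nb G (I :\: J) v| == 1))%N.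
  by rewrite -sum1dep_card big_mkcondr; apply: eq_bigr => v _; case: eqP.
rewrite -big_split /= mulnC -sum_nat_const; apply: leq_sum => v vB.
have [vI vJ] : v \notin I /\ v \in J by move: vB; rewrite inE => /andP[].
have : nb G (I :\: J) v != set0.
  rewrite -nb_setD //; have := good_nbad gI vI.
  by rewrite /bad negb_or => /andP[].
rewrite -card_gt0; case: (#|nb G (I :\: J) v|) => // -[|m] //=.
Qed.

(** Adding [rigid_degree] for both sides gives 4 l <= 2 e + d, where e counts the edges in between
    and d the vertices of degree one on both sides; [rigid_deg1] bounds d by l. *)
Lemma rigid_edges I J G : #|I| = #|J| -> rigid I G -> rigid J G ->
  (3 * #|J :\: I| <= 2 * #|G :&: btw (I :\: J) (J :\: I)|)%N.
Proof.
move=> eIJ rI rJ.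
have cIJ : #|I :\: J| = #|J :\: I|.
  by have := cardsID J I; have := cardsID I J; rewrite setIC; lia.
have [gI gJ] : good I G /\ good J G by case/andP: rI; case/andP: rJ.
have d : [disjoint I :\: J & J :\: I].
  by rewrite -setI_eq0; apply/eqP/setP => x; rewrite !inE; case: (x \in I); rewrite ?andbF.
rewrite card_setI_btw //.
have := rigid_deg1 rI rJ.
have := rigid_degree gI (good_indep gJ).
have := rigid_degree gJ (good_indep gI).
rewrite -sum_card_nb_sym; lia.
Qed.

End Deterministic.

(** * Pairs of good sets *)

Section Pairs.
Variables (R : realFieldType) (n : nat) (p : R).
Implicit Types (G : graph n) (A B I J U Y S : {set 'I_n}) (u v w : 'I_n).
Local Notation q := (1 - p).
Local Notation Ex := (Ex p).
Hypotheses (p0 : 0 <= p) (p1 : p <= 1).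

Lemma q_ge0 : 0 <= q. Proof. by rewrite subr_ge0. Qed.

Lemma card_einIU I J :
  #|einI I :|: einI J| = ('C(#|I|, 2) + 'C(#|J|, 2) - 'C(#|I :&: J|, 2))%N.
Proof.
rewrite cardsU !card_einI -[in RHS](card_einI (I :&: J)); congr (_ - _)%N; apply: eq_card => e.
by rewrite !inE subsetI.
Qed.

Lemma independent_pairE I J G :
  (independent G I)%:R * (independent G J)%:R =
  (G :&: (einI I :|: einI J) == set0)%:R :> R.
Proof. by rewrite !independentE setIUr setU_eq0; do 2!case: eqP; rewrite ?mulr1 ?mulr0. Qed.

Lemma Ex_independent_pair I J :
  Ex (fun G => (independent G I)%:R * (independent G J)%:R) =
  q ^+ ('C(#|I|, 2) + 'C(#|J|, 2) - 'C(#|I :&: J|, 2)).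
Proof.
under eq_Ex => G do rewrite independent_pairE.
by rewrite Ex_pattern ?sub0set // cards0 expr0 mul1r setD0 card_einIU.
Qed.

Lemma good_le I J G :
  (good I G)%:R * (good J G)%:R <= (independent G I)%:R * (independent G J)%:R :> R.
Proof. by rewrite -!natrM ler_nat /good; case: independent; case: independent;
  rewrite ?muln0 //=; do 2!case: [forall _, _]. Qed.

Lemma rigid_le_good I G : (rigid I G)%:R <= (good I G)%:R :> R.
Proof. by rewrite ler_nat /rigid; case: good; rewrite //= leq_b1. Qed.

Lemma Ex_good_pair_le I J :
  Ex (fun G => (good I G)%:R * (good J G)%:R) <=
  q ^+ ('C(#|I|, 2) + 'C(#|J|, 2) - 'C(#|I :&: J|, 2)).
Proof. by rewrite -Ex_independent_pair; apply: ler_Ex => // G; apply: good_le. Qed.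

Lemma sbad_ge0 I v : 0 <= sbad p I v.
Proof. by rewrite /sbad addr_ge0 ?mulr_ge0 ?exprn_ge0 ?q_ge0. Qed.

Lemma Pgood_ge0 I : (forall v, sbad p I v <= 1) -> 0 <= Pgood p I.
Proof.
move=> h; rewrite /Pgood mulr_ge0 ?exprn_ge0 ?q_ge0 // prodr_ge0 // => v _.
by rewrite subr_ge0.
Qed.

Lemma bad_nb_le1 I v G : bad I v G -> (#|nb G I v| <= 1)%N.
Proof.
case/orP=> [/eqP->|/exists_inP[u _ /andP[/eqP-> _]]]; first by rewrite cards0.
by rewrite cards1.
Qed.

(* Markov's inequality for [z ^ X], where X is the number of neighbours of v. *)
Lemma Ex_bad_pair I J v (z : R) : 0 < z -> z <= 1 -> v \notin I :|: J ->
  Ex (fun G => (bad I v G)%:R * (bad J v G)%:R) <=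
  (p * z + q) ^+ #|I :|: J| / z ^+ 2.
Proof.
move=> z0 z1 vU; rewrite -(card_star vU) -Ex_powcard mulrC -ExZ; apply: ler_Ex => // G.
rewrite -natrM mulnb card_nb // nbU.
have [/andP[bI bJ]|_] := boolP (bad I v G && bad J v G); last first.
  by rewrite mulr_ge0 ?invr_ge0 ?exprn_ge0 // ltW.
have c2 : (#|nb G I v :|: nb G J v| <= 2)%N.
  by rewrite (leq_trans (leq_card_setU _ _)) // (leq_add (bad_nb_le1 bI) (bad_nb_le1 bJ)).
rewrite mulrC ler_pdivlMr ?exprn_gt0 // mul1r.
by apply: ler_wiXn2l => //; exact: ltW.
Qed.

Lemma prod_notin_le I U (F : 'I_n -> R) (s : R) : I \subset U ->
  (forall v, 0 <= F v) -> (forall v, F v <= s) -> s <= 1 ->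
  (\prod_(v | v \notin U) (1 - F v)) * (1 - s) ^+ (#|U| - #|I|) <=
  \prod_(v | v \notin I) (1 - F v).
Proof.
move=> IU F0 Fs s1; have h v : 0 <= 1 - F v by rewrite subr_ge0 (le_trans (Fs v)).
rewrite [leRHS](bigID (fun v => v \in U)) /= mulrC.
apply: ler_pM; rewrite ?exprn_ge0 ?prodr_ge0 ?subr_ge0 //.
  rewrite -cardsDS // -prodr_const.
  have -> : \prod_(i | (i \notin I) && (i \in U)) (1 - F i) = \prod_(i in U :\: I) (1 - F i).
    by apply: eq_bigl => i; rewrite inE.
  by apply: ler_prod => v _; rewrite subr_ge0 s1 lerB.
rewrite le_eqVlt; apply/orP; left; apply/eqP/eq_bigl => v.
case vU: (v \in U); rewrite ?andbF //= andbT; apply/esym.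
by apply: (contraFN _ vU); apply: (subsetP IU).
Qed.

(** Outside [I :|: J], the probability of being bad for neither set is compared with the product of
    the separate probabilities; being bad for both is the only correlation. The constraints on the
    symmetric difference are dropped, and [(1 - s) ^+ (2 * k)] pays for restoring their factors in
    [Pgood]. *)
Lemma Ex_good_pair I J (k : nat) (s z : R) :
  #|I| = k -> #|J| = k ->
  0 <= s -> (forall v, sbad p I v <= s) -> (forall v, sbad p J v <= s) -> s <= 2^-1 ->
  0 < z -> z <= 1 ->
  Ex (fun G => (good I G)%:R * (good J G)%:R) * q ^+ 'C(#|I :&: J|, 2)
    * (1 - s) ^+ (2 * k) <=
  Pgood p I * Pgood p J * (1 + 4 * ((p * z + q) ^+ #|I :|: J| / z ^+ 2)) ^+ n.
Proof.
move=> Ik Jk s0 sI sJ s2 z0 z1; set b := _ / z ^+ 2; set U := I :|: J.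
have z0' := ltW z0.
have b0 : 0 <= b.
  by apply: divr_ge0; apply: exprn_ge0 => //; apply: addr_ge0; [apply: mulr_ge0|apply: q_ge0].
have s0I v := sbad_ge0 I v. have s0J v := sbad_ge0 J v.
have s1 : 0 <= 1 - s by lra.
have Ule : (#|U| <= 2 * k)%N.
  by rewrite /U (leq_trans (leq_card_setU _ _)) // Ik Jk mul2n addnn.
have kU : (k <= #|U|)%N by rewrite -Ik subset_leq_card // subsetUl.
have key : Ex (fun G => (good I G)%:R * (good J G)%:R) <=
    q ^+ ('C(k, 2) + 'C(k, 2) - 'C(#|I :&: J|, 2)) *
    \prod_(v | v \notin U) ((1 - sbad p I v) * (1 - sbad p J v) * (1 + 4 * b)).
  pose F v G : R := (~~ bad I v G)%:R * (~~ bad J v G)%:R.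
  apply: (@le_trans _ _ (Ex (fun G =>
     ((independent G I)%:R * (independent G J)%:R) * \prod_(v | v \notin U) F v G))).
    apply: ler_Ex => // G; rewrite !goodE big_split /= mulrACA.
    apply: ler_wpM2l; first by rewrite mulr_ge0.
    apply: ler_pM; rewrite ?prodr_ge0 //.
      rewrite [leLHS](bigID (fun v => v \in U)) /=.
      apply: (@le_trans _ _ (1 * \prod_(i | (i \notin I) && (i \notin U)) (~~ bad I i G)%:R)).
        apply: ler_wpM2r; first by rewrite prodr_ge0.
        by apply: prodr_ile1 => v _; case: bad; rewrite /= ?lexx ?ler01.
      rewrite mul1r le_eqVlt; apply/orP; left; apply/eqP/eq_bigl => v.
      by rewrite /U inE negb_or; case: (v \in I).
    rewrite [leLHS](bigID (fun v => v \in U)) /=.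
    apply: (@le_trans _ _ (1 * \prod_(i | (i \notin J) && (i \notin U)) (~~ bad J i G)%:R)).
      apply: ler_wpM2r; first by rewrite prodr_ge0.
      by apply: prodr_ile1 => v _; case: bad; rewrite /= ?lexx ?ler01.
    rewrite mul1r le_eqVlt; apply/orP; left; apply/eqP/eq_bigl => v.
    by rewrite /U inE negb_or; case: (v \in J); rewrite ?andbF ?andbT.
  rewrite Ex_stars; first last.
  - move=> v _ G; rewrite /F /=.
    rewrite (depends_bad R (U := U) v _ G) ?subsetUl // (depends_bad R (U := U) v _ G) ?subsetUr //.
  - move=> G; rewrite (depends_independent R (U := U) _ G) ?subsetUl //.
    by rewrite (depends_independent R (U := U) _ G) ?subsetUr.
  rewrite Ex_independent_pair Ik Jk; apply: ler_wpM2l; first by rewrite exprn_ge0 ?q_ge0.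
  apply: ler_prod => v vU; rewrite Ex_ge0 //=; last first.
    by move=> G; rewrite mulr_ge0.
  have [vI vJ] : v \notin I /\ v \notin J by move: vU; rewrite inE negb_or => /andP.
  have -> : Ex (F v) = 1 - sbad p I v - sbad p J v +
      Ex (fun G => (bad I v G)%:R * (bad J v G)%:R).
    rewrite -(Ex_bad p vI) -(Ex_bad p vJ) -[X in X - _ - _](Ex1 (edge n) p).
    rewrite -!ExB -ExD; apply: eq_Ex => G; rewrite /F.
    by case: (bad I v G); case: (bad J v G) => /=; ring.
  have := Ex_bad_pair z0 z1 vU; rewrite -/U -/b => hb.
  have hI := sI v; have hJ := sJ v; have hI0 := s0I v; have hJ0 := s0J v.
  apply: (@le_trans _ _ (1 - sbad p I v - sbad p J v + b)); first by rewrite lerD2l.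
  set x := sbad p I v in hI hI0 *; set y := sbad p J v in hJ hJ0 *.
  (* As (1-x)(1-y) >= 1/4, the additive term b is at most 4 b (1-x)(1-y); this is the origin of the
     factor 1 + 4 b. *)
  have h1 : 2^-1 * 2^-1 <= (1 - x) * (1 - y) by apply: ler_pM; lra.
  have h2 : 2^-1 * 2^-1 * b <= (1 - x) * (1 - y) * b by apply: ler_wpM2r.
  have h3 : 0 <= x * y by apply: mulr_ge0.
  nra.
rewrite !big_split /= in key.
have half (K : {set 'I_n}) : K \subset U -> #|K| = k -> (forall v, sbad p K v <= s) ->
    (\prod_(v | v \notin U) (1 - sbad p K v)) * (1 - s) ^+ k <=
    \prod_(v | v \notin K) (1 - sbad p K v).
  move=> KU Kk sK; apply: le_trans (prod_notin_le KU (sbad_ge0 K) sK _); last by lra.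
  apply: ler_wpM2l; first by apply: prodr_ge0 => v _; have := sK v; lra.
  apply: ler_wiXn2l; [exact: s1|lra|].
  by rewrite Kk leq_subLR addnn -mul2n.
have hI := half I (subsetUl I J) Ik sI.
have hJ := half J (subsetUr I J) Jk sJ.
have pr0 (K : {set 'I_n}) : (forall v, sbad p K v <= s) -> 0 <=
  \prod_(v | v \notin U) (1 - sbad p K v).
  by move=> sK; apply: prodr_ge0 => v _; have := sK v; lra.
have hc : \prod_(v | v \notin U) (1 + 4 * b) <= (1 + 4 * b) ^+ n.
  rewrite prodr_const; apply: ler_weXn2l; first by lra.
  by rewrite (leq_trans (max_card _)) // card_ord.
set PI := \prod_(v | v \notin U) (1 - sbad p I v) in key hI.
set PJ := \prod_(v | v \notin U) (1 - sbad p J v) in key hJ.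
have PI0 : 0 <= PI by apply: pr0.
have PJ0 : 0 <= PJ by apply: pr0.
set PC := \prod_(v | v \notin U) (1 + 4 * b) in key hc.
have PC0 : 0 <= PC by apply: prodr_ge0 => v _; lra.
have iK : ('C(#|I :&: J|, 2) <= 'C(k, 2))%N.
  by apply: leq_bin2l; rewrite -Ik subset_leq_card // subsetIl.
apply: (@le_trans _ _ (q ^+ ('C(k, 2) + 'C(k, 2) - 'C(#|I :&: J|, 2)) * (PI * PJ * PC)
    * q ^+ 'C(#|I :&: J|, 2) * (1 - s) ^+ (2 * k))).
  by do 2!(apply: ler_wpM2r; first by rewrite exprn_ge0 ?q_ge0).
have -> : q ^+ ('C(k, 2) + 'C(k, 2) - 'C(#|I :&: J|, 2)) * (PI * PJ * PC)
    * q ^+ 'C(#|I :&: J|, 2) * (1 - s) ^+ (2 * k) =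
    q ^+ 'C(k, 2) * q ^+ 'C(k, 2) * ((PI * (1 - s) ^+ k) * (PJ * (1 - s) ^+ k) * PC).
  have -> : q ^+ 'C(k, 2) * q ^+ 'C(k, 2) =
      q ^+ ('C(k, 2) + 'C(k, 2) - 'C(#|I :&: J|, 2)) * q ^+ 'C(#|I :&: J|, 2).
    by rewrite -!exprD subnK // (leq_trans iK) // leq_addr.
  by rewrite mul2n -addnn exprD; ring.
rewrite /Pgood Ik Jk.
set XI := \prod_(v | v \notin I) _ in hI *. set XJ := \prod_(v | v \notin J) _ in hJ *.
have -> : q ^+ 'C(k, 2) * XI * (q ^+ 'C(k, 2) * XJ) * (1 + 4 * b) ^+ n =
  q ^+ 'C(k, 2) * q ^+ 'C(k, 2) * (XI * XJ * (1 + 4 * b) ^+ n) by ring.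
apply: ler_wpM2l; first by rewrite mulr_ge0 ?exprn_ge0 ?q_ge0.
by do ?apply: ler_pM => //; rewrite ?mulr_ge0 ?exprn_ge0.
Qed.

Lemma star_einI A v : star v A \subset einI (v |: A).
Proof.
apply/subsetP => e; rewrite !inE => /exists_inP[u uA /eqP ->].
by rewrite subUset !sub1set !inE eqxx uA orbT.
Qed.

Lemma einIS I J : I \subset J -> einI I \subset einI J.
Proof.
by move=> IJ; apply/subsetP => e; rewrite !inE => eI; apply: (subset_trans eI IJ).
Qed.

Lemma btw_einI A B U : A \subset U -> B \subset U -> btw A B \subset einI U.
Proof.
move=> AU BU; apply/bigcupsP => v vB; apply: (subset_trans (star_einI A v)).
by rewrite einIS // subUset sub1set AU (subsetP BU).
Qed.

Lemma disjoint_btw I J : [disjoint einI I :|: einI J & btw (I :\: J) (J :\: I)].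
Proof.
rewrite disjoint_subset; apply/subsetP => e; rewrite !inE => h.
apply/negP => /bigcupP[v]; rewrite !inE => /andP[vI vJ] /exists_inP[u].
rewrite inE => /andP[uJ uI] /eqP ve; move: h; rewrite ve !subUset !sub1set.
by rewrite (negbTE vI) (negbTE uJ) andbF.
Qed.

(* Markov's inequality for [z ^ (2 e)], where e is the number of edges between
   [I :\: J] and [J :\: I]. *)
Lemma Ex_rigid_pair I J (k l : nat) (s z : R) :
  #|I| = k -> #|J| = k -> #|J :\: I| = l ->
  (forall v, sbad p I v <= s) -> s <= 2^-1 -> 1 <= z ->
  Ex (fun G => (rigid I G)%:R * (rigid J G)%:R) * z ^+ (3 * l) * (1 - s) ^+ l <=
  Pgood p I * q ^+ ('C(k, 2) - 'C(#|I :&: J|, 2)) * (p * z ^+ 2 + q) ^+ (l ^ 2).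
Proof.
move=> Ik Jk Bl sI s2 z1; set U := I :|: J; set X := btw (I :\: J) (J :\: I).
have Al : #|I :\: J| = l.
  by rewrite -Bl; have := cardsID J I; have := cardsID I J; rewrite setIC; lia.
have s1 : 0 <= 1 - s by lra.
have z0 : 0 < z by apply: lt_le_trans z1.
have dAB : [disjoint I :\: J & J :\: I].
  by rewrite -setI_eq0; apply/eqP/setP => x; rewrite !inE; case: (x \in I); rewrite ?andbF.
have UI : (#|U| - #|I| = l)%N.
  by rewrite -cardsDS ?subsetUl // -Bl; congr #|pred_of_set _|; apply/setP => x;
     rewrite !inE; case: (x \in I).
(* Once rigidity of both sets has been spent on the edge count, only the goodness of [I] outside [U]
   and the independence of [J] are retained. The edges inside [I] or [J], those in between, and the
   outer stars are then independent. *)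
have key : Ex (fun G => (rigid I G)%:R * (rigid J G)%:R) * z ^+ (3 * l) <=
    q ^+ ('C(k, 2) + 'C(k, 2) - 'C(#|I :&: J|, 2)) * (p * z ^+ 2 + q) ^+ (l ^ 2) *
    \prod_(v | v \notin U) (1 - sbad p I v).
  rewrite mulrC -ExZ.
  pose f1 G : R := (independent G I)%:R * (independent G J)%:R.
  pose f2 G : R := (z ^+ 2) ^+ #|G :&: X|.
  apply: (@le_trans _ _ (Ex (fun G =>
     (f1 G * f2 G) * \prod_(v | v \notin U) (~~ bad I v G)%:R))).
    apply: ler_Ex => // G.
    have [/andP[rI rJ]|] := boolP (rigid I G && rigid J G); last first.
      rewrite -natrM mulnb => /negbTE->; rewrite mulr0 !mulr_ge0 ?prodr_ge0 //.
      by rewrite !exprn_ge0 // ltW.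
    rewrite rI rJ !mulr1 /f1 /f2.
    have [gI gJ] : good I G /\ good J G by case/andP: rI; case/andP: rJ.
    rewrite (good_indep gI) (good_indep gJ) !mul1r big1 ?mulr1; last first.
      move=> v; rewrite inE negb_or => /andP[vI _]; by rewrite (good_nbad gI vI).
    rewrite -exprM ler_weXn2l // -Bl; apply: rigid_edges => //.
    by rewrite Ik Jk.
  rewrite Ex_stars; first last.
  - by move=> v _; apply: depends_bad; apply: subsetUl.
  - move=> G; rewrite /f1 /f2 (depends_independent R (U := U) _ G) ?subsetUl //.
    rewrite (depends_independent R (U := U) _ G) ?subsetUr // -setIA.
    by rewrite (setIidPr (btw_einI _ _)) // ?(subset_trans (subsetDl _ _)) ?subsetUl ?subsetUr.
  rewrite (@Ex_indep _ _ _ (einI I :|: einI J) X); first last.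
  - by move=> G; rewrite /f2 -setIA setIid.
  - by move=> G; rewrite /f1 !independent_pairE -setIA setIid.
  - exact: disjoint_btw.
  rewrite Ex_independent_pair Ex_powcard Ik Jk card_btw // Al Bl mulnn.
  apply: ler_wpM2l; last first.
    apply: ler_prod => v; rewrite inE negb_or => /andP[vI _].
    by rewrite Ex_nbad // lexx andbT; have := sI v; lra.
  apply: mulr_ge0; first by rewrite exprn_ge0 ?q_ge0.
  by apply: exprn_ge0; apply: addr_ge0; [apply: mulr_ge0 => //; apply: exprn_ge0;
    exact: ltW|apply: q_ge0].
apply: le_trans (ler_wpM2r (exprn_ge0 l s1) key) _.
have := prod_notin_le (subsetUl I J) (sbad_ge0 I) sI; rewrite -/U UI => /(_ ltac:(lra)) h.
rewrite /Pgood Ik -addnBA ?leq_bin2l -?Ik ?subset_leq_card ?subsetIl // exprD.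
rewrite Ik; set PU := \prod_(v | v \notin U) _ in h *; set PI := \prod_(v | v \notin I) _ in h *.
set a := q ^+ _; set b := q ^+ _; set c := _ ^+ (l ^ 2).
have -> : a * b * c * PU * (1 - s) ^+ l = (a * b * c) * (PU * (1 - s) ^+ l) by ring.
have -> : a * PI * b * c = (a * b * c) * PI by ring.
apply: ler_wpM2l => //.
apply: mulr_ge0; first by rewrite mulr_ge0 ?exprn_ge0 ?q_ge0.
by apply: exprn_ge0; apply: addr_ge0; [apply: mulr_ge0 => //; apply: exprn_ge0;
  exact: ltW|apply: q_ge0].
Qed.

(** Union bound over v, w outside [I] sharing their only neighbour u. In the product formula for a
    good set the factors of v and w, each at least 1/2, are replaced by [p * q ^+ k.-1]; hence the 4
    and the square. *)
Lemma Ex_rigid_ge I (k : nat) (s : R) : #|I| = k ->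
  (forall v, sbad p I v <= s) -> s <= 2^-1 ->
  Pgood p I * (1 - 4 * (n%:R ^+ 2 * k%:R * (p * q ^+ k.-1) ^+ 2)) <= Ex (fun G => (rigid I G)%:R).
Proof.
move=> Ik sI s2; set c := p * q ^+ k.-1.
have c0 : 0 <= c by rewrite mulr_ge0 ?exprn_ge0 ?q_ge0.
have P0 : 0 <= Pgood p I by apply: Pgood_ge0 => v; have := sI v; lra.
pose D v w u G : R := (good I G)%:R * (nb G I v == [set u])%:R * (nb G I w == [set u])%:R.
have le1 : Ex (fun G => (good I G)%:R) -
  \sum_(v | v \notin I) \sum_(w | (w \notin I) && (w != v)) \sum_(u in I) Ex (D v w u)
   <= Ex (fun G => (rigid I G)%:R).
  under [X in _ - X]eq_bigr => v _.
    under eq_bigr => w _ do rewrite -Ex_sum.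
    rewrite -Ex_sum; over.
  rewrite -Ex_sum -ExB; apply: ler_Ex => // G; rewrite /rigid.
  have D0 v w u : 0 <= D v w u G by rewrite !mulr_ge0.
  have S0 : 0 <= \sum_(v | v \notin I) \sum_(w | (w \notin I) && (w != v)) \sum_(u in I) D v w u G.
    by do 3!(apply: sumr_ge0 => ? _).
  have [gI|ngI] /= := boolP (good I G); last by rewrite sub0r oppr_le0.
  have [_|] := boolP (unshared I G); first by rewrite lerBlDr lerDl.
  rewrite negb_forall => /existsP[u]; rewrite negb_forall => /existsP[v].
  rewrite negb_forall => /existsP[w]; rewrite implybF negbK => /and5P[vI wI vw /eqP nv /eqP nw].
  have uI : u \in I by have := nbP G I v u; rewrite nv inE eqxx => /esym/andP[].
  rewrite subr_le0 (bigD1 v) //= (bigD1 w) /= ?wI ?(eq_sym w) // (bigD1 u) //=.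
  rewrite {1}/D gI nv nw !eqxx !mulr1 -!addrA lerDl !addr_ge0 //.
  - by apply: sumr_ge0.
  - by do 2!(apply: sumr_ge0 => ? _).
  - by do 3!(apply: sumr_ge0 => ? _).
apply: le_trans le1; rewrite Ex_good mulrBr mulr1 lerD2l lerN2.
have le2 (v w u : 'I_n) : v \notin I -> w \notin I -> w != v -> u \in I ->
    Ex (D v w u) <= Pgood p I * (4 * c ^+ 2).
  move=> vI wI wv uI.
  pose F x G : R := if (x == v) || (x == w) then (nb G I x == [set u])%:R else (~~ bad I x G)%:R.
  apply: (@le_trans _ _ (Ex (fun G => (independent G I)%:R * \prod_(x | x \notin I) F x G))).
    apply: ler_Ex => // G; rewrite /D goodE -!mulrA; apply: ler_wpM2l => //.
    rewrite (bigD1 v) //= (bigD1 w) /= ?wI //.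
    rewrite [leRHS](bigD1 v) //= [in leRHS](bigD1 w) /= ?wI // /F !eqxx orbT /=.
    have -> : \prod_(i | (i \notin I) && (i != v) && (i != w))
       (if (i == v) || (i == w) then (nb G I i == [set u])%:R else (~~ bad I i G)%:R) =
       \prod_(i | (i \notin I) && (i != v) && (i != w)) (~~ bad I i G)%:R :> R.
      by apply: eq_bigr => i /andP[/andP[_ /negbTE-> /negbTE->]].
    set Q := \prod_(i | _) _; have Q0 : 0 <= Q by apply: prodr_ge0.
    by case: bad; case: bad; case: eqP => _; case: eqP => _ /=; rewrite ?mul0r ?mulr0 ?mul1r ?mulr1.
  rewrite Ex_stars; first last.
  - move=> x _ G; rewrite /F; case: ifP => _; last by rewrite (depends_bad R x (subxx I)).
    exact: (depends_nb x (fun N => (N == [set u])%:R) (subxx I)).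
  - exact: depends_independent.
  rewrite Ex_independent /Pgood -mulrA; apply: ler_wpM2l; first by rewrite exprn_ge0 ?q_ge0.
  rewrite (bigD1 v) //= (bigD1 w) /= ?wI //.
  rewrite [in leRHS](bigD1 v) //= [in leRHS](bigD1 w) /= ?wI //.
  have Fc x : x \notin I -> (x == v) || (x == w) -> Ex (F x) = c.
    move=> xI xvw; rewrite /F xvw Ex_nb ?sub1set // cards1 expr1 /c Ik subn1 //.
  rewrite !Fc ?eqxx ?orbT //.
  have -> : \prod_(i | (i \notin I) && (i != v) && (i != w)) Ex (F i) =
     \prod_(i | (i \notin I) && (i != v) && (i != w)) (1 - sbad p I i).
    apply: eq_bigr => i /andP[/andP[iI /negbTE iv /negbTE iw]]; rewrite -Ex_nbad //.
    by apply: eq_Ex => G; rewrite /F iv iw.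
  set Q := \prod_(i | _) _; have Q0 : 0 <= Q.
    by apply: prodr_ge0 => x _; have := sI x; lra.
  have h1 : 2^-1 * 2^-1 <= (1 - sbad p I v) * (1 - sbad p I w).
    have hv := sI v; have hw := sI w.
    by apply: ler_pM; rewrite ?invr_ge0 //; lra.
  have h2 : 0 <= Q * c ^+ 2 by apply: mulr_ge0 => //; apply: exprn_ge0.
  have h3 := ler_wpM2r h2 h1; lra.
apply: (@le_trans _ _ (\sum_(v : 'I_n) \sum_(w : 'I_n) \sum_(u in I) Pgood p I * (4 * c ^+ 2))).
  have K0 : 0 <= Pgood p I * (4 * c ^+ 2) by apply: mulr_ge0 => //; apply: mulr_ge0 => //;
    apply: exprn_ge0.
  rewrite [leLHS]big_mkcond /=; apply: ler_sum => v _; case: ifP => [vI|_]; last first.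
    by do 2!(apply: sumr_ge0 => ? _).
  rewrite [leLHS]big_mkcond /=; apply: ler_sum => w _; case: ifP => [/andP[wI wv]|_]; last first.
    by apply: sumr_ge0.
  by apply: ler_sum => u uI; apply: le2.
set K := Pgood p I * _.
have -> : \sum_(v : 'I_n) \sum_(w : 'I_n) \sum_(u in I) K = K * k%:R * n%:R * n%:R.
  rewrite [X in X = _]sumr_const card_ord [X in X *+ _]sumr_const card_ord.
  by rewrite [X in X *+ _ *+ _]sumr_const Ik !mulr_natr.
rewrite le_eqVlt /K; apply/orP; left; apply/eqP; ring.
Qed.

End Pairs.

(** [J] is determined by the pair [(I :&: J, J :\: I)], and both parts can be chosen freely. *)
Lemma card_meet (T : finType) (I : {set T}) (k i : nat) : #|I| = k -> (i <= k)%N ->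
  #|[set J : {set T} | (#|J| == k) && (#|I :&: J| == i)]| =
  ('C(k, i) * 'C(#|T| - k, k - i))%N.
Proof.
move=> Ik ik.
have cC : #|~: I| = (#|T| - k)%N by rewrite cardsCs setCK Ik.
rewrite -cC -[in RHS]Ik -(cards_draws I) -(cards_draws (~: I)) -cardsX Ik.
pose f (J : {set T}) := (I :&: J, J :\: I).
have f_inj : injective f.
  move=> J K [/setP e1 /setP e2]; apply/setP => x; have := e1 x; have := e2 x.
  by rewrite !inE; case: (x \in I).
rewrite -(card_imset _ f_inj); apply: eq_card => -[A B].
rewrite inE /=; apply/imsetP/andP => [[J]|[]].
  rewrite inE => /andP[/eqP Jk /eqP Ji] [-> ->]; rewrite !inE subsetIl Ji eqxx.
  split=> //; apply/andP; split; first by apply/subsetP => x; rewrite !inE => /andP[].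
  by rewrite cardsD Jk setIC Ji.
rewrite !inE => /andP[AI /eqP Ai] /andP[BI /eqP Bi].
have hA : I :&: (A :|: B) = A.
  rewrite setIUr (setIidPr AI); have /eqP -> : I :&: B == set0.
    by rewrite setI_eq0 disjoint_sym disjoints_subset.
  by rewrite setU0.
have hB : (A :|: B) :\: I = B.
  rewrite setDUl [B :\: I]setDE (setIidPl BI).
  by move: AI; rewrite -setD_eq0 => /eqP ->; rewrite set0U.
exists (A :|: B); last by rewrite /f hA hB.
rewrite inE hA Ai eqxx andbT.
by rewrite -(cardsID I (A :|: B)) hB setIC hA Ai Bi subnKC.
Qed.

(** * Moments of the number of rigid sets *)

Section Moments.
Variables (R : realFieldType) (n : nat) (p : R).
Implicit Types (G : graph n) (I J : {set 'I_n}) (k l i : nat).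
Local Notation q := (1 - p).
Local Notation Ex := (Ex p).
Hypotheses (p0 : 0 <= p) (p1 : p < 1).

Let p1' : p <= 1 := ltW p1.
Let q0 : 0 < q. Proof. by rewrite subr_gt0. Qed.

Definition mass k : R := \sum_(I : {set 'I_n} | #|I| == k) Pgood p I.

(** Union bound over good sets, [good_exists] supplying one of size exactly [alpha G]. A subset of a
    good set need not be good, so only equality is treated, and larger values are summed
    separately. *)
Lemma Ex_alpha_eq k : Ex (fun G => (alpha G == k)%:R) <= mass k.
Proof.
rewrite /mass; under eq_bigr => I _ do rewrite -Ex_good.
rewrite -Ex_sum; apply: ler_Ex => // G; case: eqP => [<-|_]; last by apply: sumr_ge0.
have [I Ia gI] := good_exists G; rewrite (bigD1 I) ?Ia //= gI lerDl.
by apply: sumr_ge0.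
Qed.

(** The plain first moment: subsets of independent sets are independent, so here the whole tail is
    covered at once. *)
Lemma Ex_alpha_ge k : Ex (fun G => (k <= alpha G)%:R) <= 'C(n, k)%:R * q ^+ 'C(k, 2).
Proof.
apply: (@le_trans _ _ (Ex (fun G => \sum_(I : {set 'I_n} | #|I| == k) (independent G I)%:R))).
  apply: ler_Ex => // G; case: leqP => [ka|_]; last by apply: sumr_ge0.
  have [I Ia gI] := good_exists G.
  have /card_geqP : (k <= #|I|)%N by rewrite Ia.
  case=> s [us ss sI].
  have cs : #|[set x in s]| = k by rewrite cardsE (card_uniqP us).
  rewrite (bigD1 [set x in s]) ?cs //=.
  have -> : independent G [set x in s].
    apply: nadj_independent => u v; rewrite !inE => /sI uI /sI vI.
    exact: independent_nadj (good_indep gI) uI vI.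
  by rewrite lerDl sumr_ge0.
rewrite Ex_sum; under eq_bigr => I /eqP Ik do rewrite Ex_independent Ik.
rewrite sumr_const; have -> : #|[pred I : {set 'I_n} | #|I| == k]| = 'C(n, k).
  by rewrite -[X in 'C(X, _)](card_ord n) -card_draws; apply: eq_card => I; rewrite !inE.
by rewrite mulr_natl.
Qed.

Lemma sum_by_meet I k (g : nat -> R) : #|I| = k ->
  \sum_(J : {set 'I_n} | #|J| == k) g #|I :&: J| =
  \sum_(0 <= i < k.+1) ('C(k, i) * 'C(n - k, k - i))%:R * g i.
Proof.
move=> Ik; rewrite big_mkord.
rewrite (partition_big (fun J : {set 'I_n} => inord #|I :&: J| : 'I_k.+1) predT) //=.
apply: eq_bigr => i _; have ik : (i <= k)%N by rewrite -ltnS.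
rewrite -[X in 'C(X - _, _)](card_ord n) -(card_meet Ik ik).
rewrite mulr_natl -sumr_const; apply: eq_big => [J|J].
  rewrite inE; case: eqP => //= Jk; rewrite -val_eqE /= inordK //.
  by rewrite ltnS -Ik subset_leq_card // subsetIl.
move=> /andP[/eqP Jk /eqP <-]; rewrite inordK //.
by rewrite ltnS -Ik subset_leq_card // subsetIl.
Qed.

Definition rigid_count k G : R := \sum_(I : {set 'I_n} | #|I| == k) (rigid I G)%:R.

Lemma rigid_count_alpha k G : (alpha G < k)%N -> rigid_count k G = 0.
Proof.
move=> ak; rewrite /rigid_count big1 // => I /eqP Ik; case rI: (rigid I G) => //.
have := leq_alpha (good_indep (proj1 (andP rI))); rewrite Ik leqNgt ak.
by [].
Qed.

Variables (k : nat) (s : R).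
Hypotheses (s0 : 0 <= s) (s2 : s <= 2^-1).
Let s_lt1 : s < 1. Proof. by apply: le_lt_trans s2 _; rewrite invf_lt1 ?ltr1n. Qed.
Hypothesis sbad_le : forall I v, #|I| = k -> sbad p I v <= s.

Lemma Ex_rigid_count_ge :
  mass k * (1 - 4 * (n%:R ^+ 2 * k%:R * (p * q ^+ k.-1) ^+ 2)) <= Ex (rigid_count k).
Proof.
rewrite /mass mulr_suml /rigid_count Ex_sum; apply: ler_sum => I /eqP Ik.
by apply: (Ex_rigid_ge p0 p1' Ik _ s2) => v; apply: sbad_le.
Qed.

(* The pairs of sets meeting in i points are estimated by [Ex_good_pair] for
   i < i0, by [Ex_good_pair_le] for i0 <= i < i1 and by [Ex_rigid_pair] for
   i1 <= i < k. *)
Lemma Ex_rigid_count_sq (i0 i1 : nat) (z : R) (x : nat -> R) :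
  (i0 <= i1)%N -> (i1 <= k)%N -> 0 < z -> z <= 1 -> (forall l, 1 <= x l) ->
  Ex (fun G => rigid_count k G ^+ 2) <=
  mass k ^+ 2 * ((1 + 4 * ((p * z + q) ^+ (2 * k - i0) / z ^+ 2)) ^+ n /
                 (q ^+ 'C(i0, 2) * (1 - s) ^+ (2 * k))) +
  'C(n, k)%:R * (\sum_(i0 <= i < i1) ('C(k, i) * 'C(n - k, k - i))%:R *
                 q ^+ ('C(k, 2) + 'C(k, 2) - 'C(i, 2))) +
  mass k * (\sum_(i1 <= i < k) ('C(k, i) * 'C(n - k, k - i))%:R *
     (q ^+ ('C(k, 2) - 'C(i, 2)) * (p * x (k - i)%N ^+ 2 + q) ^+ ((k - i) ^ 2) /
     (x (k - i)%N ^+ (3 * (k - i)) * (1 - s) ^+ (k - i)))) +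
  mass k.
Proof.
move=> i01 i1k z0 z1 x1; set b := _ / z ^+ 2; set Cs := _ / (_ * _).
pose med i := q ^+ ('C(k, 2) + 'C(k, 2) - 'C(i, 2)).
pose lar i := q ^+ ('C(k, 2) - 'C(i, 2)) * (p * x (k - i)%N ^+ 2 + q) ^+ ((k - i) ^ 2) /
     (x (k - i)%N ^+ (3 * (k - i)) * (1 - s) ^+ (k - i)).
have s1 : 0 < 1 - s by rewrite subr_gt0.
have z0' := ltW z0.
have pz0 : 0 <= p * z + q by apply: addr_ge0; [apply: mulr_ge0|apply: ltW].
have pz1 : p * z + q <= 1.
  by have : p * z <= p * 1 by [apply: ler_wpM2l]; lra.
have b0 : 0 <= b by apply: divr_ge0; apply: exprn_ge0.
have Cs0 : 0 <= Cs.
  apply: divr_ge0; first by apply: exprn_ge0; lra.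
  by apply: mulr_ge0; apply: exprn_ge0; apply: ltW.
have med0 i : 0 <= med i by rewrite /med exprn_ge0 // ltW.
have lar0 i : 0 <= lar i.
  have X0 : 0 <= x (k - i)%N by apply: le_trans (x1 _).
  rewrite /lar; apply: divr_ge0; apply: mulr_ge0; apply: exprn_ge0 => //; try exact: ltW.
  by apply: addr_ge0; [apply: mulr_ge0 => //; apply: exprn_ge0|apply: ltW].
have P0 I : #|I| = k -> 0 <= Pgood p I.
  by move=> Ik; apply: Pgood_ge0 => // v; exact: le_trans (sbad_le v Ik) (ltW s_lt1).
(* The product term is granted to every pair, so that it sums to [mass k ^+ 2 * Cs]; [g] holds what
   the pairs with a larger intersection require in addition. *)
pose g I i := if (i < i0)%N then 0 else if (i < i1)%N then med i else
  if (i < k)%N then Pgood p I * lar i else Pgood p I.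
have key I J : #|I| = k -> #|J| = k ->
   Ex (fun G => (rigid I G)%:R * (rigid J G)%:R) <=
   Pgood p I * Pgood p J * Cs + g I #|I :&: J|.
  move=> Ik Jk.
  have PP : 0 <= Pgood p I * Pgood p J * Cs by apply: mulr_ge0 => //; apply: mulr_ge0; apply: P0.
  have legood : Ex (fun G => (rigid I G)%:R * (rigid J G)%:R) <=
      Ex (fun G => (good I G)%:R * (good J G)%:R).
    by apply: ler_Ex => // G; apply: ler_pM => //; apply: rigid_le_good.
  have ck : (#|I :&: J| <= k)%N by rewrite -Ik subset_leq_card // subsetIl.
  rewrite /g; case: ltnP => [ii0|i0i].
    rewrite addr0; apply: le_trans legood _.
    rewrite /Cs mulrA ler_pdivlMr ?mulr_gt0 ?exprn_gt0 //.
    have sI v := sbad_le v Ik. have sJ v := sbad_le v Jk.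
    have h := Ex_good_pair p0 p1' Ik Jk s0 sI sJ s2 z0 z1.
    apply: le_trans (le_trans _ h) _.
      rewrite mulrA; apply: ler_wpM2r; first by rewrite exprn_ge0 // ltW.
      apply: ler_wpM2l; first by apply: Ex_ge0 => // G; rewrite mulr_ge0.
      by apply: ler_wiXn2l; [apply: ltW|by rewrite gerBl|apply: leq_bin2l; apply: ltnW].
    apply: ler_wpM2l; first by rewrite mulr_ge0 ?P0.
    have cU : #|I :|: J| = (2 * k - #|I :&: J|)%N by rewrite cardsU Ik Jk mul2n addnn.
    have hb : (p * z + q) ^+ #|I :|: J| / z ^+ 2 <= b.
      apply: ler_wpM2r; first by rewrite invr_ge0 exprn_ge0.
      by apply: ler_wiXn2l => //; rewrite cU leq_sub2l // ltnW.
    apply: lerXn2r; rewrite ?nnegrE; last by lra.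
      by apply: addr_ge0 => //; apply: mulr_ge0 => //; apply: divr_ge0; apply: exprn_ge0.
    lra.
  apply: le_trans (_ : _ <= 0 + _) _; last by apply: lerD.
  rewrite add0r; case: ltnP => [ii1|i1i].
    by apply: le_trans legood _; rewrite /med -{1}Ik -Jk; apply: Ex_good_pair_le.
  have X1 := x1 (k - #|I :&: J|)%N.
  case: ltnP => [ik|ki].
    have Bl : #|J :\: I| = (k - #|I :&: J|)%N by rewrite cardsD Jk setIC.
    have h := Ex_rigid_pair p0 p1' Ik Jk Bl (fun v => sbad_le v Ik) s2 X1.
    rewrite /lar mulrA ler_pdivlMr; last by rewrite mulr_gt0 ?exprn_gt0 //; lra.
    by rewrite mulrA mulrA.
  rewrite -Ex_good; apply: ler_Ex => // G; rewrite -[leRHS]mulr1.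
  by apply: ler_pM => //; [apply: rigid_le_good|case: rigid].
have g0 I i : #|I| = k -> 0 <= g I i.
  move=> Ik; rewrite /g; case: ifP => // _; case: ifP => // _.
  by case: ifP => _; [apply: mulr_ge0 => //|]; apply: P0.
have key2 I : #|I| = k ->
   \sum_(J : {set 'I_n} | #|J| == k) Ex (fun G => (rigid I G)%:R * (rigid J G)%:R) <=
   Pgood p I * mass k * Cs +
   (\sum_(i0 <= i < i1) ('C(k, i) * 'C(n - k, k - i))%:R * med i +
    Pgood p I * (\sum_(i1 <= i < k) ('C(k, i) * 'C(n - k, k - i))%:R * lar i) + Pgood p I).
  move=> Ik.
  apply: (@le_trans _ _ (\sum_(J : {set 'I_n} | #|J| == k)
     (Pgood p I * Pgood p J * Cs + g I #|I :&: J|))).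
    by apply: ler_sum => J /eqP Jk; apply: key.
  rewrite big_split /=; apply: lerD.
    by rewrite -mulr_suml -mulr_sumr.
  rewrite (sum_by_meet _ Ik) (big_cat_nat (n := i0)) //=; last exact: leqW (leq_trans i01 i1k).
  rewrite (big_cat_nat (n := i1) (m := i0)) //=; last exact: leqW.
  rewrite (big_cat_nat (n := k) (m := i1)) //=.
  rewrite [X in X + _ <= _]big_nat big1 ?add0r; last first.
    by move=> i /andP[_ ii0]; rewrite /g ii0 mulr0.
  rewrite big_nat1 -addrA; apply: lerD; [|apply: lerD].
  - rewrite !big_nat; apply: ler_sum => i /andP[h1 h2].
    by rewrite /g ltnNge h1 /= h2.
  - rewrite mulr_sumr !big_nat; apply: ler_sum => i /andP[h1 h2].
    by rewrite /g !ltnNge h1 (leq_trans i01 h1) /= -ltnNge h2 mulrCA.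
  - by rewrite /g binn subnn bin0 mul1r !ltnNge i1k (leq_trans i01 i1k) leqnn.
have -> : Ex (fun G => rigid_count k G ^+ 2) =
   \sum_(I : {set 'I_n} | #|I| == k) \sum_(J : {set 'I_n} | #|J| == k)
     Ex (fun G => (rigid I G)%:R * (rigid J G)%:R).
  under [RHS]eq_bigr => I _ do rewrite -Ex_sum.
  rewrite -Ex_sum; apply: eq_Ex => G; rewrite expr2 /rigid_count mulr_suml.
  by apply: eq_bigr => I _; rewrite mulr_sumr.
apply: (@le_trans _ _ (\sum_(I : {set 'I_n} | #|I| == k) (Pgood p I * mass k * Cs +
   (\sum_(i0 <= i < i1) ('C(k, i) * 'C(n - k, k - i))%:R * med i +
    Pgood p I * (\sum_(i1 <= i < k) ('C(k, i) * 'C(n - k, k - i))%:R * lar i) + Pgood p I)))).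
  by apply: ler_sum => I /eqP; apply: key2.
rewrite !big_split /= -!addrA; apply: lerD; [|apply: lerD; [|apply: lerD]].
- by rewrite -!mulr_suml -/(mass k) -expr2.
- rewrite sumr_const; have -> : #|[pred I : {set 'I_n} | #|I| == k]| = 'C(n, k).
    by rewrite -[X in 'C(X, _)](card_ord n) -card_draws; apply: eq_card => I; rewrite !inE.
  by rewrite mulr_natl.
- by rewrite -mulr_suml.
- by [].
Qed.

End Moments.

(* Imported only here, as [classical_sets] shadows the lemmas of [finset]. *)
From mathcomp Require Import all_classical all_reals all_analysis.

Import numFieldNormedType.Exports.

Local Open Scope ring_scope.

(** * The expected number of good sets *)

Section RealBounds.
Variable R : realType.
Implicit Types (x y : R).

Lemma expR_ge_sub x : 0 <= x -> x <= 2^-1 -> expR (- (x + 2 * x ^+ 2)) <= 1 - x.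
Proof.
move=> x0 x2; have h := expR_ge1Dx (x + 2 * x ^+ 2).
have x3 : 0 <= x ^+ 2 * (1 - 2 * x) by apply: mulr_ge0; [apply: sqr_ge0|lra].
rewrite expRN -[leRHS]mulr1 -[leLHS]mul1r ler_pdivrMr ?expR_gt0 // mulr1.
apply: (@le_trans _ _ ((1 - x) * (1 + (x + 2 * x ^+ 2)))); first by nra.
by apply: ler_wpM2l => //; lra.
Qed.

Lemma expR_le1DxD2 x : x <= 2^-1 -> expR x <= 1 + x + 2 * x ^+ 2.
Proof.
move=> x2; have h := expR_ge1Dx (- x); rewrite expRN in h.
have e0 := expR_gt0 x.
have h1 : (1 - x) * expR x <= 1.
  by rewrite -[leRHS](mulVf (lt0r_neq0 e0)); apply: ler_wpM2r => //; apply: ltW.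
have x3 : 0 <= x ^+ 2 * (1 - 2 * x) by apply: mulr_ge0; [apply: sqr_ge0|lra].
have x1 : 0 < 1 - x by lra.
rewrite -(ler_pM2l x1); apply: le_trans h1 _; nra.
Qed.

End RealBounds.

(** * The distribution of the number of swaps, a Gaussian binomial coefficient *)

Section SwapSum.
Variables (R : realType) (c : R).
Hypothesis c0 : 0 <= c.

Definition swaps n (I : {set 'I_n}) : nat := (\sum_(v | v \notin I) larger I v)%N.
(** The Gaussian binomial coefficient with parameter [expR (- c)]: [swaps I] is the number of
    inversions of the 0-1 word of [I]. *)
Definition swap_sum n k : R := \sum_(I : {set 'I_n} | #|I| == k) expR (- (c * (swaps I)%:R)).

Lemma swapsE n (I : {set 'I_n}) :
  swaps I = (\sum_(v : 'I_n) \sum_(u : 'I_n) [&& v \notin I, u \in I & (v < u)%N])%N.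
Proof.
rewrite /swaps big_mkcond /=; apply: eq_bigr => v _; case: ifP => vI; last by rewrite big1.
by rewrite /larger -sum1dep_card big_mkcond /=; apply: eq_bigr => u _; case: (u \in I); case: ltnP.
Qed.

Let emb n (i : 'I_n) : 'I_n.+1 := widen_ord (leqnSn n) i.

Lemma emb_inj n : injective (@emb n).
Proof. by move=> i j /(congr1 val) /= h; apply: val_inj. Qed.

Lemma emb_neq n (i : 'I_n) : emb i != ord_max.
Proof. by rewrite -val_eqE /= ltn_eqF. Qed.

Lemma ord_max_emb n (A : {set 'I_n}) : ord_max \notin [set emb i | i in A].
Proof. by apply/imsetP => -[i _ /esym/eqP]; rewrite (negbTE (emb_neq i)). Qed.

Lemma ord_emb n (v : 'I_n.+1) : v != ord_max -> exists i : 'I_n, v = emb i.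
Proof.
move=> vm; have h : (v < n)%N by have := ltn_ord v;
  rewrite ltnS leq_eqVlt -[_ == n]/(v == ord_max) (negbTE vm).
by exists (Ordinal h); apply: val_inj.
Qed.

Lemma swaps_emb n (A : {set 'I_n}) : swaps [set emb i | i in A] = swaps A.
Proof.
rewrite !swapsE big_ord_recr /= [X in (_ + X)%N]big1 ?addn0; last first.
  by move=> u _; rewrite [(n < u)%N]ltnNge -ltnS ltn_ord /= !andbF.
apply: eq_bigr => v _; rewrite big_ord_recr /= (negbTE (ord_max_emb A)) andbF addn0.
by apply: eq_bigr => u _; rewrite !(mem_imset _ _ (@emb_inj n)).
Qed.

Lemma swaps_emb_max n (A : {set 'I_n}) :
  swaps (ord_max |: [set emb i | i in A]) = (swaps A + (n - #|A|))%N.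
Proof.
rewrite !swapsE big_ord_recr /= [X in (_ + X)%N]big1 ?addn0; last first.
  by move=> u _; rewrite !inE eqxx.
have -> : (n - #|A| = \sum_(v : 'I_n) (v \notin A))%N.
  have -> : (n - #|A|)%N = #|~: A| by rewrite [RHS]cardsCs finset.setCK card_ord.
  rewrite -sum1_card big_mkcond /=.
  by apply: eq_bigr => v _; rewrite inE; case: (v \in A).
rewrite -big_split /=; apply: eq_bigr => v _; rewrite big_ord_recr /=.
rewrite !inE eqxx /= (negbTE (emb_neq v)) /= (mem_imset _ _ (@emb_inj n)) ltn_ord !andbT.
congr addn; apply: eq_bigr => u _.
by rewrite !inE (negbTE (emb_neq u)) /= (mem_imset _ _ (@emb_inj n)).
Qed.

Lemma swap_sum0 n : swap_sum n 0 = 1.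
Proof.
rewrite /swap_sum (bigD1 (finset.set0 : {set _})) ?cards0 //= big1; last first.
  by move=> I /andP[/eqP/cards0_eq ->]; rewrite eqxx.
rewrite /swaps big1 ?mulr0 ?oppr0 ?expR0 ?addr0 // => v _.
by rewrite /larger; apply/eqP; rewrite cards_eq0; apply/eqP/setP => u; rewrite !inE.
Qed.

(** Pascal's rule for Gaussian binomial coefficients, by membership of the last vertex: when it
    belongs to the set, each of the n - k vertices left out can be swapped with it. *)
Lemma swap_sumS n k :
  swap_sum n.+1 k.+1 = swap_sum n k.+1 + expR (- (c * (n%:R - k%:R))) * swap_sum n k.
Proof.
rewrite /swap_sum (bigID (fun I : {set 'I_n.+1} => ord_max \in I)) /= addrC.
have preK (A : {set 'I_n}) : @emb n @^-1: [set emb i | i in A] = A.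
  by apply/setP => i; rewrite inE (mem_imset _ _ (@emb_inj n)).
have preK' (A : {set 'I_n}) : @emb n @^-1: (ord_max |: [set emb i | i in A]) = A.
  by apply/setP => i; rewrite !inE (negbTE (emb_neq i)) (mem_imset _ _ (@emb_inj n)).
have Kpre (I : {set 'I_n.+1}) : [set emb i | i in @emb n @^-1: I] = I :\ ord_max.
  apply/setP => v; rewrite !inE; have [->|vm] := eqVneq v ord_max.
    exact/negbTE/ord_max_emb.
  by have [i ->] := ord_emb vm; rewrite (mem_imset _ _ (@emb_inj n)) inE.
congr (_ + _).
  rewrite (reindex_onto (fun A : {set 'I_n} => [set emb i | i in A])
     (fun I => @emb n @^-1: I)) /=; last first.
    move=> I /andP[_ mI]; rewrite Kpre; apply/setP => v; rewrite !inE.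
    by case: eqP => //= ->; rewrite (negbTE mI).
  apply: eq_big => [A|A _]; last by rewrite swaps_emb.
  by rewrite preK eqxx andbT ord_max_emb andbT (card_imset _ (@emb_inj n)).
rewrite (reindex_onto (fun A : {set 'I_n} => ord_max |: [set emb i | i in A])
     (fun I => @emb n @^-1: I)) /=; last first.
  by move=> I /andP[_ mI]; rewrite Kpre finset.setD1K.
rewrite mulr_sumr; apply: eq_big => [A|A].
  rewrite preK' eqxx andbT !inE eqxx andbT cardsU1 ord_max_emb.
  by rewrite (card_imset _ (@emb_inj n)) add1n eqSS.
rewrite preK' eqxx andbT !inE eqxx andbT cardsU1 ord_max_emb.
rewrite (card_imset _ (@emb_inj n)) add1n eqSS => /eqP Ak.
rewrite swaps_emb_max -expRD Ak natrD natrB; last first.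
  by rewrite -Ak -[X in (_ <= X)%N](card_ord n) max_card.
by congr expR; ring.
Qed.

Lemma swap_sum_small n k : (n < k)%N -> swap_sum n k = 0.
Proof.
move=> nk; rewrite /swap_sum big_pred0 // => I; apply/negbTE.
by rewrite neq_ltn (leq_ltn_trans _ nk) // -[X in (_ <= X)%N](card_ord n) max_card.
Qed.

(* Removing the last vertex splits the binomial coefficient with weights 1 - t and
   t = k / n, and the correction factors e^a, e^-b satisfy (1 - t) a = t b. *)
Lemma swap_sum_step n k (a b t : R) : (k <= n)%N ->
  t = k.+1%:R / n.+1%:R -> a = c * k.+1%:R / 2 -> b = c * (n%:R - k%:R) / 2 ->
  [/\ 'C(n, k.+1)%:R * expR (- (c * k.+1%:R * (n%:R - k.+1%:R) / 2)) +
     expR (- (c * (n%:R - k%:R))) * ('C(n, k)%:R * expR (- (c * k%:R * (n%:R - k%:R) / 2))) =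
     'C(n.+1, k.+1)%:R * expR (- (c * k.+1%:R * (n.+1%:R - k.+1%:R) / 2)) *
     ((1 - t) * expR a + t * expR (- b)),
     (1 - t) * a = t * b, 0 <= t & t <= 1].
Proof.
move=> kn -> -> ->.
have n1 : (n.+1%:R : R) != 0 by rewrite pnatr_eq0.
have e1 : ('C(n, k)%:R : R) = k.+1%:R / n.+1%:R * 'C(n.+1, k.+1)%:R.
  have /(congr1 (fun x : nat => x%:R : R)) := mul_bin_diag n.+1 k.
  by rewrite /= !natrM => h; apply: (mulfI n1); rewrite h; field.
have e2 : ('C(n, k.+1)%:R : R) = (1 - k.+1%:R / n.+1%:R) * 'C(n.+1, k.+1)%:R.
  by rewrite mulrBl mul1r -e1 binS natrD addrK.
split.
- rewrite e1 e2.
  have -> : expR (- (c * k.+1%:R * (n%:R - k.+1%:R) / 2)) =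
    expR (- (c * k.+1%:R * (n.+1%:R - k.+1%:R) / 2)) * expR (c * k.+1%:R / 2).
    by rewrite -expRD; congr expR; rewrite -!natr1; field.
  have -> : expR (- (c * (n%:R - k%:R))) *
    (k.+1%:R / n.+1%:R * 'C(n.+1, k.+1)%:R * expR (- (c * k%:R * (n%:R - k%:R) / 2))) =
    (k.+1%:R / n.+1%:R * 'C(n.+1, k.+1)%:R) *
     (expR (- (c * (n%:R - k%:R))) * expR (- (c * k%:R * (n%:R - k%:R) / 2))) by ring.
  have -> : expR (- (c * (n%:R - k%:R))) * expR (- (c * k%:R * (n%:R - k%:R) / 2)) =
    expR (- (c * k.+1%:R * (n.+1%:R - k.+1%:R) / 2)) * expR (- (c * (n%:R - k%:R) / 2)).
    by rewrite -!expRD; congr expR; rewrite -!natr1; field.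
  ring.
- by rewrite -!natr1; field; rewrite natr1.
- by rewrite divr_ge0.
- by rewrite ler_pdivrMr ?ltr0n // mul1r ler_nat.
Qed.

(** The mean number of swaps is k (n - k) / 2, so this is Jensen's inequality. It is proved by
    induction with [expR x >= 1 + x]: the first order terms of the two exponentials cancel by the
    balance relation of [swap_sum_step]. *)
Lemma swap_sum_ge n k :
  'C(n, k)%:R * expR (- (c * k%:R * (n%:R - k%:R) / 2)) <= swap_sum n k.
Proof.
elim: n k => [|n IH] [|k].
- by rewrite swap_sum0 bin0 mul1r !(mulr0, mul0r) oppr0 expR0.
- by rewrite swap_sum_small // bin0n mul0r.
- by rewrite swap_sum0 bin0 mul1r !(mulr0, mul0r) oppr0 expR0.
have [nk|kn] := ltnP n k.
  by rewrite swap_sum_small // bin_small // mul0r.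
have [e ab t0 t1] := swap_sum_step kn erefl erefl erefl.
rewrite swap_sumS; apply: le_trans (lerD (IH k.+1) (ler_wpM2l (expR_ge0 _) (IH k))).
rewrite e -[leLHS]mulr1; apply: ler_wpM2l; first by rewrite mulr_ge0 ?expR_ge0.
set t := _ / n.+1%:R in ab t0 t1 *; set a := _ / 2 in ab *; set b := _ / 2 in ab *.
have h1 : (1 - t) * (1 + a) <= (1 - t) * expR a.
  by apply: ler_wpM2l; [lra|apply: expR_ge1Dx].
have h2 : t * (1 - b) <= t * expR (- b).
  by apply: ler_wpM2l => //; apply: expR_ge1Dx.
lra.
Qed.

(** The induction of [swap_sum_ge] with a second order bound: the two squares contribute at most c^2
    (k+1) N for each vertex added, which the error term accumulates. [N] is fixed during the
    induction, and c N <= 1 keeps the positive exponent below 1/2, as [expR_le1DxD2] requires. *)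
Lemma swap_sum_le_aux N n k : c * N%:R <= 1 -> (n <= N)%N ->
  swap_sum n k <=
  'C(n, k)%:R * expR (- (c * k%:R * (n%:R - k%:R) / 2) + c ^+ 2 * k%:R * N%:R * n%:R).
Proof.
move=> cN; elim: n k => [|n IH] [|k] nN.
- by rewrite swap_sum0 bin0 mul1r !(mulr0, mul0r) addr0 oppr0 expR0.
- by rewrite swap_sum_small // bin0n mul0r.
- by rewrite swap_sum0 bin0 mul1r !(mulr0, mul0r) addr0 oppr0 expR0.
have [nk|kn] := ltnP n k.
  by rewrite swap_sum_small // bin_small // mul0r.
have [e ab t0 t1] := swap_sum_step kn erefl erefl erefl.
have nN' := ltnW nN.
rewrite swap_sumS; apply: le_trans (lerD (IH k.+1 nN') (ler_wpM2l (expR_ge0 _) (IH k nN'))) _.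
have err : expR (c ^+ 2 * k%:R * N%:R * n%:R) <= expR (c ^+ 2 * k.+1%:R * N%:R * n%:R).
  rewrite ler_expR; do 2!(apply: ler_wpM2r => //).
  by apply: ler_wpM2l; rewrite ?sqr_ge0 // ler_nat.
rewrite !expRD.
set E1 := expR (c ^+ 2 * k.+1%:R * N%:R * n%:R) in err *.
set E2 := expR (c ^+ 2 * k.+1%:R * N%:R * n.+1%:R).
apply: (@le_trans _ _ (('C(n, k.+1)%:R * expR (- (c * k.+1%:R * (n%:R - k.+1%:R) / 2)) +
  expR (- (c * (n%:R - k%:R))) * ('C(n, k)%:R * expR (- (c * k%:R * (n%:R - k%:R) / 2)))) * E1)).
  rewrite mulrDl !mulrA; apply: lerD => //.
  by apply: ler_wpM2l => //; rewrite !mulr_ge0 ?expR_ge0.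
rewrite e.
set t := _ / n.+1%:R in ab t0 t1 *; set a := c * k.+1%:R / 2 in ab *.
set b := c * (n%:R - k%:R) / 2 in ab *.
set X := (1 - t) * _ + _.
rewrite -!mulrA; apply: ler_wpM2l => //; apply: ler_wpM2l; first exact: expR_ge0.
have -> : E2 = expR (c ^+ 2 * k.+1%:R * N%:R) * E1.
  by rewrite /E2 /E1 -expRD; congr expR; rewrite -[n.+1%:R]natr1; ring.
apply: ler_wpM2r; first exact: expR_ge0.
have kn' : k.+1%:R <= n.+1%:R :> R by rewrite ler_nat.
have nN1 : n.+1%:R <= N%:R :> R by rewrite ler_nat.
have k0 : 0 <= k%:R :> R by [].
have ckN : c * k.+1%:R <= c * N%:R by apply: ler_wpM2l => //; apply: le_trans nN1.
have h1 : (1 - t) * expR a <= (1 - t) * (1 + a + 2 * a ^+ 2).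
  by apply: ler_wpM2l; [lra|apply: expR_le1DxD2; rewrite /a; lra].
have b0 : 0 <= b by rewrite /b mulr_ge0 // mulr_ge0 // subr_ge0 ler_nat.
have h2 : t * expR (- b) <= t * (1 - b + 2 * (- b) ^+ 2).
  by apply: ler_wpM2l => //; apply: expR_le1DxD2; lra.
rewrite sqrrN in h2.
apply: le_trans (expR_ge1Dx _); rewrite /X.
have h3 : (1 - t) * a ^+ 2 <= a ^+ 2.
  by rewrite -[leRHS]mul1r; apply: ler_wpM2r; rewrite ?sqr_ge0 //; lra.
have h4 : a ^+ 2 <= c ^+ 2 * k.+1%:R * N%:R / 4.
  rewrite /a !expr2 -!mulrA; have : c * (c * (k.+1%:R * k.+1%:R)) <= c * (c * (k.+1%:R * N%:R)).
    by do 3!apply: ler_wpM2l => //; apply: le_trans nN1.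
  lra.
have h5 : t * b ^+ 2 <= c ^+ 2 * k.+1%:R * N%:R / 4.
  have bn : b <= c * n.+1%:R / 2.
    rewrite /b; do 1!apply: ler_wpM2r => //; apply: ler_wpM2l => //.
    by rewrite -natr1; lra.
  have b2 : b ^+ 2 <= (c * n.+1%:R / 2) ^+ 2 by rewrite lerXn2r // nnegrE // (le_trans b0).
  apply: le_trans (ler_wpM2l t0 b2) _.
  have n1 : (n.+1%:R : R) != 0 by rewrite pnatr_eq0.
  have -> : t * (c * n.+1%:R / 2) ^+ 2 = c ^+ 2 * k.+1%:R * n.+1%:R / 4 by rewrite /t; field.
  apply: ler_wpM2r => //; apply: ler_wpM2l => //; by rewrite mulr_ge0 ?sqr_ge0.
lra.
Qed.

Lemma swap_sum_le n k : c * n%:R <= 1 ->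
  swap_sum n k <=
  'C(n, k)%:R * expR (- (c * k%:R * (n%:R - k%:R) / 2) + c ^+ 2 * k%:R * n%:R ^+ 2).
Proof.
by move=> cn; have := swap_sum_le_aux k cn (leqnn n); rewrite expr2 !mulrA.
Qed.

End SwapSum.

(** * Upper and lower bounds for the expected number of good sets *)

Section MassBounds.
Variables (R : realType) (n : nat) (p : R).
Local Notation q := (1 - p).

(** In the expected number of bad vertices only the number of swaps depends on which k-set [I] is;
    this reduces [mass] to [swap_sum]. *)
Lemma sum_sbad (I : {set 'I_n}) k : #|I| = k ->
  \sum_(v | v \notin I) sbad p I v = (n%:R - k%:R) * q ^+ k + p * q ^+ k.-1 * (swaps I)%:R.
Proof.
move=> Ik; rewrite /sbad Ik big_split /= sumr_const -mulr_suml -natr_sum -/(swaps I).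
have -> : #|[pred v | v \notin I]| = (n - k)%N.
  have -> : (n - k)%N = #|~: I| by rewrite [RHS]cardsCs finset.setCK card_ord Ik.
  by apply: eq_card => v; rewrite !inE.
congr (_ + _); last by rewrite mulrC.
rewrite -natrB ?mulr_natl // -Ik -[X in (_ <= X)%N](card_ord n); exact: max_card.
Qed.

Lemma mass_le k : 0 <= p -> p < 1 -> p * q ^+ k.-1 * n%:R <= 1 ->
  (forall (I : {set 'I_n}) v, #|I| = k -> sbad p I v <= 1) ->
  mass n p k <= 'C(n, k)%:R * q ^+ 'C(k, 2) *
    expR (- ((n%:R - k%:R) * (q ^+ k + p * q ^+ k.-1 * k%:R / 2)) +
             (p * q ^+ k.-1) ^+ 2 * k%:R * n%:R ^+ 2).
Proof.
move=> p0 p1 cn s1; set c := p * q ^+ k.-1.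
have q0 : 0 <= q by rewrite subr_ge0 ltW.
have c0 : 0 <= c by rewrite mulr_ge0 ?exprn_ge0.
apply: (@le_trans _ _ (\sum_(I : {set 'I_n} | #|I| == k)
   q ^+ 'C(k, 2) * expR (- ((n%:R - k%:R) * q ^+ k)) * expR (- (c * (swaps I)%:R)))).
  apply: ler_sum => I /eqP Ik; rewrite /Pgood Ik -mulrA; apply: ler_wpM2l;
    first by rewrite exprn_ge0.
  rewrite -expRD -opprD -(sum_sbad Ik) -sumrN expR_sum.
  apply: ler_prod => v _; rewrite subr_ge0 s1 //=.
  by rewrite (le_trans (expR_ge1Dx _)) // addrC.
rewrite -mulr_sumr -/(swap_sum c n k).
have h := swap_sum_le c0 k cn.
have Y0 : 0 <= q ^+ 'C(k, 2) * expR (- ((n%:R - k%:R) * q ^+ k)).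
  by rewrite mulr_ge0 ?expR_ge0 ?exprn_ge0.
apply: le_trans (ler_wpM2l Y0 h) _.
rewrite le_eqVlt; apply/orP; left; apply/eqP.
set e1 := - ((n%:R - k%:R) * q ^+ k).
set e2 := - (c * k%:R * (n%:R - k%:R) / 2) + c ^+ 2 * k%:R * n%:R ^+ 2.
have -> : q ^+ 'C(k, 2) * expR e1 * ('C(n, k)%:R * expR e2) =
  'C(n, k)%:R * q ^+ 'C(k, 2) * expR (e1 + e2) by rewrite [expR (e1 + e2)]expRD; ring.
by congr (_ * expR _); rewrite /e1 /e2; field.
Qed.

(** [expR_ge_sub] costs at most [2 * s ^+ 2] per factor, and [swap_sum_ge] does the rest; writing n
    for n - k in the exponent only lowers the bound. *)
Lemma mass_ge k (s : R) : 0 <= p -> p < 1 -> (k <= n)%N -> s <= 2^-1 ->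
  (forall (I : {set 'I_n}) v, #|I| = k -> sbad p I v <= s) ->
  'C(n, k)%:R * q ^+ 'C(k, 2) *
    expR (- (n%:R * (q ^+ k + p * q ^+ k.-1 * k%:R / 2)) - 2 * n%:R * s ^+ 2)
  <= mass n p k.
Proof.
move=> p0 p1 kn s2 ss; set c := p * q ^+ k.-1.
have q0 : 0 <= q by rewrite subr_ge0 ltW.
have c0 : 0 <= c by rewrite mulr_ge0 ?exprn_ge0.
apply: (@le_trans _ _ (\sum_(I : {set 'I_n} | #|I| == k)
   q ^+ 'C(k, 2) * expR (- ((n%:R - k%:R) * q ^+ k) - 2 * n%:R * s ^+ 2) *
   expR (- (c * (swaps I)%:R)))); last first.
  apply: ler_sum => I /eqP Ik; rewrite /Pgood Ik -mulrA; apply: ler_wpM2l;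
    first by rewrite exprn_ge0.
  rewrite -expRD addrAC -opprD -(sum_sbad Ik).
  apply: (@le_trans _ _ (\prod_(v | v \notin I) expR (- (sbad p I v + 2 * sbad p I v ^+ 2)))).
    rewrite -expR_sum ler_expR sumrN [X in _ <= - X]big_split /=.
    suff : \sum_(v | v \notin I) 2 * sbad p I v ^+ 2 <= 2 * n%:R * s ^+ 2 by lra.
    apply: (@le_trans _ _ (\sum_(v : 'I_n) 2 * s ^+ 2)).
      rewrite big_mkcond /=; apply: ler_sum => v _; case: ifP => _;
        last by rewrite mulr_ge0 ?sqr_ge0.
      by apply: ler_wpM2l => //; rewrite lerXn2r ?nnegrE ?sbad_ge0 ?(le_trans (sbad_ge0 _ _ _
        _) (ss I v Ik)) ?ss // ltW.
    by rewrite sumr_const card_ord -[leLHS]mulr_natl mulrCA mulrA.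
  apply: ler_prod => v _; rewrite expR_ge0 /=; apply: expR_ge_sub.
    by apply: sbad_ge0 => //; apply: ltW.
  exact: le_trans (ss I v Ik) s2.
rewrite -mulr_sumr -/(swap_sum c n k).
have h := swap_sum_ge c n k.
have Y0 : 0 <= q ^+ 'C(k, 2) * expR (- ((n%:R - k%:R) * q ^+ k) - 2 * n%:R * s ^+ 2).
  by rewrite mulr_ge0 ?expR_ge0 ?exprn_ge0.
apply: le_trans (ler_wpM2l Y0 h).
set e1 := - ((n%:R - k%:R) * q ^+ k) - 2 * n%:R * s ^+ 2.
set e2 := - (c * k%:R * (n%:R - k%:R) / 2).
have -> : q ^+ 'C(k, 2) * expR e1 * ('C(n, k)%:R * expR e2) =
  'C(n, k)%:R * q ^+ 'C(k, 2) * expR (e1 + e2) by rewrite [expR (e1 + e2)]expRD; ring.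
rewrite /e1 /e2; apply: ler_wpM2l; first by rewrite mulr_ge0 ?exprn_ge0.
rewrite ler_expR.
have k0 : 0 <= k%:R :> R by [].
have h1 : 0 <= k%:R * q ^+ k by rewrite mulr_ge0 ?exprn_ge0.
have h2 : 0 <= c * k%:R * k%:R by apply: mulr_ge0 => //; apply: mulr_ge0.
lra.
Qed.

End MassBounds.

(** * Factorials, binomial coefficients and geometric sums *)

Section Elementary.
Variable R : realType.
Implicit Types (x y : R).

Lemma fact_ge k : (k%:R / expR 1) ^+ k <= k`!%:R :> R.
Proof.
case: k => [|k]; first by rewrite expr0.
have := @expR_ge1Dxn R k.+1%:R k (ler0n _ _).
rewrite expr_div_n -expRM_natl mulr1 => h.
rewrite ler_pdivrMr ?expR_gt0 //.
rewrite mulrC -ler_pdivrMr ?ltr0n ?fact_gt0 //.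
by apply: le_trans h; rewrite lerDr.
Qed.

Lemma fact_le k : (0 < k)%N -> k`!%:R <= expR 1 * k%:R * (k%:R / expR 1) ^+ k :> R.
Proof.
elim: k => [//|[|k] IH] _.
  by rewrite factS fact0 muln1 expr1 mulr1 mul1r divff // gt_eqF ?expR_gt0.
rewrite factS natrM -mulrA [_ * (k.+2%:R * _)]mulrCA; apply: ler_wpM2l => //.
apply: le_trans (IH _) _ => //; rewrite -mulrA; apply: ler_wpM2l; first exact: expR_ge0.
set a : R := k.+1%:R; have a0 : 0 < a by rewrite ltr0n.
have -> : k.+2%:R = a + 1 :> R by rewrite natr1.
have e0 := @expR_gt0 R 1.
have -> : a * (a / expR 1) ^+ k.+1 = (a / expR 1) ^+ k.+2 * expR 1.
  by rewrite [in RHS]exprS; field; rewrite gt_eqF.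
have -> : (a + 1) / expR 1 = a / expR 1 * ((a + 1) / a) by field; rewrite !gt_eqF.
rewrite [leRHS]exprMn; apply: ler_wpM2l; first by rewrite exprn_ge0 // divr_ge0 // ltW.
(* The inductive step amounts to (1 + 1/a)^(a+1) >= e, taken here to the power 1/(a+1). *)
have h : expR (a + 1)^-1 <= (a + 1) / a.
  have := expR_ge1Dx (- (a + 1)^-1); rewrite expRN.
  have -> : 1 - (a + 1)^-1 = a / (a + 1) by field; lra.
  have E0 := expR_gt0 (a + 1)^-1; have a1 : 0 < a + 1 by lra.
  by rewrite ler_pdivrMr // ler_pdivlMl // => h; rewrite ler_pdivlMr.
have -> : expR 1 = expR (a + 1)^-1 ^+ k.+2 :> R.
  by rewrite -expRM_natl -[k.+2%:R]natr1 -/a divff // gt_eqF // addr_gt0.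
by apply: lerXn2r => //; rewrite nnegrE ?expR_ge0 // divr_ge0 // ?addr_ge0 // ltW.
Qed.

Lemma ffact_le_exp k i : (k ^_ i <= k ^ i)%N.
Proof.
elim: i => [|i IH]; first by rewrite ffactn0.
by rewrite ffactnSr expnSr leq_mul // leq_subr.
Qed.

Lemma bin_le_exp k i : (0 < i)%N -> 'C(k, i)%:R <= (expR 1 * k%:R / i%:R) ^+ i :> R.
Proof.
move=> i0; have f0 : (0 : R) < i`!%:R by rewrite ltr0n fact_gt0.
have h : 'C(k, i)%:R * i`!%:R <= k%:R ^+ i :> R.
  by rewrite -natrM -natrX ler_nat bin_ffact ffact_le_exp.
have h2 := fact_ge i.
have a0 : (0 : R) < (i%:R / expR 1) ^+ i by rewrite exprn_gt0 // divr_gt0 ?expR_gt0 ?ltr0n.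
rewrite -(ler_pM2r a0) -exprMn.
have -> : expR 1 * k%:R / i%:R * (i%:R / expR 1) = k%:R :> R.
  by field; rewrite gt_eqF ?expR_gt0 // pnatr_eq0 -lt0n i0.
by apply: le_trans h; apply: ler_wpM2l.
Qed.

(** In probabilistic terms: a uniform k-set contains i prescribed points with probability at most
    (k/n)^i. *)
Lemma bin_sub_le n k i : (i <= k)%N -> (k <= n)%N ->
  n%:R ^+ i * 'C(n - i, k - i)%:R <= k%:R ^+ i * 'C(n, k)%:R :> R.
Proof.
elim: i => [|i IH] ik kn; first by rewrite !expr0 !subn0.
have ik' := ltnW ik; have {}IH := IH ik' kn.
have e : (n - i)%:R * 'C(n - i.+1, k - i.+1)%:R = (k - i)%:R * 'C(n - i, k - i)%:R :> R.
  have h : (0 < k - i)%N by rewrite subn_gt0.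
  by rewrite -!natrM !subnS; case: (k - i)%N h => // m _; rewrite /= mul_bin_diag.
have ni : (i < n)%N by apply: leq_trans kn.
have d0 : (0 : R) < (n - i)%:R by rewrite ltr0n subn_gt0.
rewrite -(ler_pM2l d0).
have -> : (n - i)%:R * (n%:R ^+ i.+1 * 'C(n - i.+1, k - i.+1)%:R) =
   (n%:R * (k - i)%:R) * (n%:R ^+ i * 'C(n - i, k - i)%:R) :> R.
  by rewrite exprS mulrCA e; ring.
have -> : (n - i)%:R * (k%:R ^+ i.+1 * 'C(n, k)%:R) =
   (k%:R * (n - i)%:R) * (k%:R ^+ i * 'C(n, k)%:R) :> R by rewrite exprS; ring.
apply: ler_pM IH; [by rewrite mulr_ge0|by rewrite mulr_ge0 ?exprn_ge0|].
rewrite -!natrM ler_nat !mulnBr [(k * n)%N]mulnC leq_sub2l // leq_mul //.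
Qed.

Lemma bin_diff_le n k i : (i <= k)%N -> (k <= n)%N -> (0 < n)%N ->
  'C(n - k, k - i)%:R <= (k%:R / n%:R) ^+ i * 'C(n, k)%:R :> R.
Proof.
move=> ik kn n0; have h := bin_sub_le ik kn.
rewrite expr_div_n mulrAC ler_pdivlMr ?exprn_gt0 ?ltr0n // mulrC.
apply: le_trans h; apply: ler_wpM2l; first by rewrite exprn_ge0.
by rewrite ler_nat leq_bin2l // leq_sub2l.
Qed.

Lemma expR_le1D2x x : 0 <= x -> x <= 2^-1 -> expR x <= 1 + 2 * x.
Proof.
move=> x0 x2; apply: le_trans (expR_le1DxD2 x2) _.
have : 0 <= x * (1 - 2 * x) by apply: mulr_ge0; lra.
lra.
Qed.

Lemma inv1B_le x : 0 <= x -> x <= 2^-1 -> (1 - x)^-1 <= expR (2 * x).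
Proof.
move=> x0 x2; rewrite -[leRHS]invrK -expRN lef_pV2 ?posrE ?expR_gt0 //; last by lra.
apply: le_trans (expR_ge_sub x0 x2); rewrite ler_expR.
have : 0 <= x * (1 - 2 * x) by apply: mulr_ge0; lra.
lra.
Qed.

Lemma sum_geo_le (r : R) (i0 i1 : nat) : 0 <= r -> r <= 2^-1 ->
  \sum_(i0 <= i < i1) r ^+ i <= 2 * r ^+ i0.
Proof.
move=> r0 r2; have [i10|i01] := leqP i1 i0.
  by rewrite big_geq // mulr_ge0 ?exprn_ge0.
suff : \sum_(i0 <= i < i1) r ^+ i <= 2 * (r ^+ i0 - r ^+ i1).
  by have := exprn_ge0 i1 r0; lra.
elim: i1 i01 => // i1 IH; rewrite ltnS leq_eqVlt => /orP[/eqP<-|h].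
  rewrite big_nat1 exprS; have := exprn_ge0 i0 r0 => a0.
  have := ler_wpM2r a0 r2; lra.
rewrite big_nat_recr //=; last exact: ltnW.
have := IH h; rewrite exprS; have := exprn_ge0 i1 r0 => a0.
have := ler_wpM2r a0 r2; lra.
Qed.

End Elementary.

(** * The second moment method *)

Section LowerBound.
Variables (R : realType).
Implicit Types (n k : nat) (p s z eta : R).

Lemma Ex_alpha_lt_le n p k (A B : R) : 0 <= p -> p < 1 -> 0 < A -> A <= Ex p (@rigid_count R n k) ->
  Ex p (fun G => @rigid_count R n k G ^+ 2) <= B ->
  Ex p (fun G : graph n => (alpha G < k)%:R) <= B / A ^+ 2 - 1.
Proof.
move=> p0 p1 A0 AE EB; have p1' := ltW p1.
apply: (@le_trans _ _ (Ex p (fun G : graph n => (rigid_count R k G == 0)%:R))).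
  apply: ler_Ex => // G; case: ltnP => [h|_] //.
  by rewrite rigid_count_alpha // eqxx.
have E0 : 0 < Ex p (@rigid_count R n k) by apply: lt_le_trans AE.
apply: le_trans (Ex_eq0_le p0 p1' E0) _; rewrite lerD2r.
apply: ler_pM => //; first by apply: Ex_ge0 => // G; rewrite sqr_ge0.
  by rewrite invr_ge0 sqr_ge0.
rewrite lef_pV2 ?posrE ?exprn_gt0 //.
by apply: lerXn2r => //; rewrite nnegrE ltW.
Qed.

(** Each of the four terms of [Ex_rigid_count_sq] contributes at most eta mass^2 beyond the main
    mass^2, and the first moment loses at most a factor 1 - eta. The bound is thus (1 + 4 eta)/(1 -
    eta)^2 - 1, which is below 24 eta for eta <= 1/4. *)
Lemma second_moment_combine n p k s eta (i0 i1 : nat) z (x : nat -> R) :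
  0 <= p -> p < 1 -> 0 <= s -> s <= 2^-1 ->
  (forall (I : {set 'I_n}) v, #|I| = k -> sbad p I v <= s) ->
  (i0 <= i1)%N -> (i1 <= k)%N -> 0 < z -> z <= 1 -> (forall l, 1 <= x l) ->
  0 < eta -> eta <= 4^-1 ->
  4 * (n%:R ^+ 2 * k%:R * (p * (1 - p) ^+ k.-1) ^+ 2) <= eta ->
  (1 + 4 * ((p * z + (1 - p)) ^+ (2 * k - i0) / z ^+ 2)) ^+ n /
                 ((1 - p) ^+ 'C(i0, 2) * (1 - s) ^+ (2 * k)) <= 1 + eta ->
  'C(n, k)%:R * (\sum_(i0 <= i < i1) ('C(k, i) * 'C(n - k, k - i))%:R *
                 (1 - p) ^+ ('C(k, 2) + 'C(k, 2) - 'C(i, 2))) <= eta * mass n p k ^+ 2 ->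
  \sum_(i1 <= i < k) ('C(k, i) * 'C(n - k, k - i))%:R *
     ((1 - p) ^+ ('C(k, 2) - 'C(i, 2)) * (p * x (k - i)%N ^+ 2 + (1 - p)) ^+ ((k - i) ^ 2) /
     (x (k - i)%N ^+ (3 * (k - i)) * (1 - s) ^+ (k - i))) <= eta * mass n p k ->
  1 <= eta * mass n p k ->
  Ex p (fun G : graph n => (alpha G < k)%:R) <= 24 * eta.
Proof.
move=> p0 p1 s0 s2 ss i01 i1k z0 z1 x1 e0 e4 h1 h2 h3 h4 h5.
set M := mass n p k in h3 h4 h5.
have M0 : 0 < M by have := lt_le_trans ltr01 h5; rewrite pmulr_rgt0.
have lo := Ex_rigid_count_ge p0 p1 s2 ss; rewrite -/M in lo.
have up := Ex_rigid_count_sq p0 p1 s0 s2 ss i01 i1k z0 z1 x1; rewrite -/M in up.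
set Cs := _ ^+ n / _ in h2 up. set Med := 'C(n, k)%:R * _ in h3 up.
set La := \sum_(i1 <= i < k) _ in h4 up.
have A0 : 0 < M * (1 - eta) by apply: mulr_gt0 => //; lra from e4.
have A1 : M * (1 - eta) <= Ex p (@rigid_count R n k).
  by apply: le_trans lo; apply: ler_wpM2l; [exact: ltW|lra from h1].
have B1 : Ex p (fun G => @rigid_count R n k G ^+ 2) <= M ^+ 2 * (1 + 4 * eta).
  apply: le_trans up _.
  have a1 : M ^+ 2 * Cs <= M ^+ 2 * (1 + eta) by apply: ler_wpM2l; rewrite ?sqr_ge0.
  have a2 : M * La <= M * (eta * M) by apply: ler_wpM2l => //; exact: ltW.
  have a3 : M * 1 <= M * (eta * M) by apply: ler_wpM2l => //; exact: ltW.
  lra from a1 a2 a3 h3.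
apply: le_trans (Ex_alpha_lt_le p0 p1 A0 A1 B1) _.
have -> : M ^+ 2 * (1 + 4 * eta) / (M * (1 - eta)) ^+ 2 = (1 + 4 * eta) / (1 - eta) ^+ 2.
  by field; lra from M0 e4.
rewrite lerBlDr ler_pdivrMr; last by apply: exprn_gt0; lra from e4.
nra.
Qed.

(** The tilt [z] is about the inverse of 2 k p, the mean number of neighbours in a union of two
    disjoint k-sets: (p z + q)^(2k) stays within a factor e^2 of q^(2k), while 1/z^2 costs only (1 +
    2 k p)^2. The last three hypotheses bound three factors by [expR (eta / 8)] each. *)
Lemma small_overlap n p k s eta (i0 : nat) z :
  (0 < n)%N -> 0 < p -> p <= 2^-1 -> 0 <= s -> s <= 2^-1 -> 0 < eta -> eta <= 4^-1 ->
  z = (1 + 2 * k%:R * p)^-1 -> (i0 <= k)%N ->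
  4 * n%:R * (expR 2 * ((1 - p) ^+ k) ^+ 2 * expR (2 * p * i0%:R) * (1 + 2 * k%:R * p) ^+ 2) <=
    eta / 8 ->
  p * i0%:R ^+ 2 <= eta / 8 -> 4 * s * k%:R <= eta / 8 ->
  (1 + 4 * ((p * z + (1 - p)) ^+ (2 * k - i0) / z ^+ 2)) ^+ n /
                 ((1 - p) ^+ 'C(i0, 2) * (1 - s) ^+ (2 * k)) <= 1 + eta.
Proof.
move=> n0 p0 p2 s0 s2 e0 e4 zE ik h1 h2 h3.
set q := 1 - p; set D := 1 + 2 * k%:R * p in zE h1.
have q0 : 0 < q by rewrite /q; lra.
have k0 : (0 : R) <= k%:R by [].
have kp0 : 0 <= k%:R * p by apply: mulr_ge0 => //; exact: ltW.
have D1 : 1 <= D by rewrite /D; lra.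
have D0 : 0 < D by lra.
have qV : q^-1 <= expR (2 * p) by apply: inv1B_le => //; exact: ltW.
have z0 : 0 < z by rewrite zE invr_gt0.
set b := _ / z ^+ 2.
have hb : b <= expR 2 * (q ^+ k) ^+ 2 * expR (2 * p * i0%:R) * D ^+ 2.
  have a1 : p * z + q = q * (1 + p * z * q^-1) by field; rewrite gt_eqF.
  have a2 : 1 + p * z * q^-1 <= expR (p * z * 2).
    apply: le_trans (expR_ge1Dx _) _; rewrite ler_expR; apply: ler_wpM2l.
      by apply: mulr_ge0; apply: ltW.
    by rewrite -[leRHS]invrK lef_pV2 ?posrE // /q; lra from p2.
  have a0 : 0 <= 1 + p * z * q^-1.
    by apply: addr_ge0 => //; rewrite !mulr_ge0 ?invr_ge0 // ltW.
  have a3 : (1 + p * z * q^-1) ^+ (2 * k - i0) <= expR 2.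
    apply: (@le_trans _ _ (expR (p * z * 2) ^+ (2 * k - i0))).
      by apply: lerXn2r; rewrite ?nnegrE ?expR_ge0.
    rewrite -expRM_natr ler_expR.
    apply: (@le_trans _ _ (p * z * 2 * (2 * k%:R))).
      apply: ler_wpM2l; first by rewrite !mulr_ge0 // ltW.
      by rewrite -natrM ler_nat leq_subr.
    rewrite zE -[leRHS](mulfK (lt0r_neq0 D0)).
    have -> : p * D^-1 * 2 * (2 * k%:R) = (2 * (2 * k%:R * p)) * D^-1 by ring.
    by apply: ler_wpM2r; rewrite ?invr_ge0; [exact: ltW|rewrite /D; clear; lra].
  have a4 : q ^+ (2 * k - i0) <= (q ^+ k) ^+ 2 * expR (2 * p * i0%:R).
    have -> : (q ^+ k) ^+ 2 = q ^+ (2 * k - i0) * q ^+ i0.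
      rewrite -exprD -exprM subnK ?[(k * 2)%N]mulnC // (leq_trans ik) //.
      by rewrite mul2n -addnn leq_addr.
    rewrite -[leLHS]mulr1 -mulrA; apply: ler_wpM2l; first by rewrite exprn_ge0 // ltW.
    rewrite [2 * p * _]mulrC expRM_natl -exprMn; apply: exprn_ege1.
    by rewrite -[leLHS](mulfV (lt0r_neq0 q0)); apply: ler_wpM2l => //; exact: ltW.
  have zi : (z ^+ 2)^-1 = D ^+ 2 by rewrite zE exprVn invrK.
  rewrite /b a1 exprMn zi; apply: ler_wpM2r; first by rewrite sqr_ge0.
  apply: le_trans (_ : _ <= ((q ^+ k) ^+ 2 * expR (2 * p * i0%:R)) * expR 2) _; last first.
    by rewrite le_eqVlt; apply/orP; left; apply/eqP; ring.
  have q0' := ltW q0; apply: ler_pM => //; apply: exprn_ge0 => //.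
have b0 : 0 <= b.
  apply: divr_ge0; apply: exprn_ge0; last exact: ltW.
  by apply: addr_ge0; [apply: mulr_ge0|]; apply: ltW.
have N1 : (1 + 4 * b) ^+ n <= expR (eta / 8).
  apply: (@le_trans _ _ (expR (4 * b) ^+ n)).
    by apply: lerXn2r; rewrite ?nnegrE ?expR_ge0 ?expR_ge1Dx //; lra from b0.
  rewrite -expRM_natl ler_expR; apply: le_trans h1.
  rewrite mulrCA mulrA; apply: ler_wpM2l => //; by rewrite mulr_ge0.
have N2 : (q ^+ 'C(i0, 2))^-1 <= expR (eta / 8).
  rewrite -exprVn.
  apply: (@le_trans _ _ (expR (2 * p) ^+ 'C(i0, 2))).
    by apply: lerXn2r; rewrite ?nnegrE ?expR_ge0 ?invr_ge0 // ltW.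
  rewrite -expRM_natl ler_expR; apply: le_trans h2.
  have : 2 * ('C(i0, 2))%:R <= i0%:R ^+ 2 :> R.
    rewrite -natrM -natrX ler_nat bin2 mul2n -mulnn.
    apply: (@leq_trans (i0 * i0.-1)%N); last by rewrite leq_mul // leq_pred.
    by rewrite -[leqRHS]odd_double_half leq_addl.
  move=> h; have := ler_wpM2l (ltW p0) h; clear; lra.
have N3 : ((1 - s) ^+ (2 * k))^-1 <= expR (eta / 8).
  rewrite -exprVn.
  apply: (@le_trans _ _ (expR (2 * s) ^+ (2 * k))).
    apply: lerXn2r; rewrite ?nnegrE ?expR_ge0 ?invr_ge0 //; first by lra from s2.
    exact: inv1B_le.
  by rewrite -expRM_natl ler_expR natrM; apply: le_trans h3; clear; lra.
rewrite invfM.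
apply: (@le_trans _ _ (expR (eta / 8) * (expR (eta / 8) * expR (eta / 8)))).
  apply: ler_pM => //; first by rewrite exprn_ge0 //; lra from b0.
    by rewrite mulr_ge0 // invr_ge0 exprn_ge0 //; [exact: ltW|lra from s2].
  apply: ler_pM => //; rewrite invr_ge0 exprn_ge0 //; [exact: ltW|lra from s2].
rewrite -!expRD; apply: le_trans (expR_le1D2x _ _) _; lra from e0 e4.
Qed.

End LowerBound.

(** * Medium and large overlaps *)

Section Overlaps.
Variables (R : realType).
Implicit Types (n k i l : nat) (p s z eta : R).

Lemma bin2_natr i : 'C(i, 2)%:R = i%:R * (i%:R - 1) / 2 :> R.
Proof.
elim: i => [|i IH]; first by rewrite bin0n !mul0r.
by rewrite binS natrD IH bin1 -natr1; field.
Qed.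

(* The logarithm of [e^2 n / k], up to which [- ln (1 - p) (k - 1) / 2] may grow. *)
Definition lnek n k : R := 1 + ln (n%:R : R) - ln (k%:R : R).

(** Two ranges of i. If i L <= k, the last term is at most 2 and the lower bound on i wins through
    ln i. Otherwise ln i is within ln L of ln k, and staying delta k away from k saves delta (L - ln
    k) >= delta L / 4. *)
Lemma medium_exponent n k i (delta : R) :
  (0 < n)%N -> (0 < k)%N -> (k <= n)%N -> (0 < i)%N -> 0 < delta -> delta <= 1 ->
  2 <= ln (n%:R : R) :> R -> ln (k%:R : R) <= 3 / 4 * ln (n%:R : R) :> R ->
  4 + ln (ln (n%:R : R)) <= delta * ln (n%:R : R) / 4 ->
  i%:R <= (1 - delta) * k%:R ->
  expR 6 * ln (n%:R : R) * k%:R ^+ 2 / n%:R <= i%:R ->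
  1 + 2 * ln (k%:R : R) - ln i%:R - ln (n%:R : R) + lnek n k * i%:R / k%:R <= -2.
Proof.
move=> n0 k0 kn i0 d0 d1; set L := ln (n%:R : R) => L2 kL hd ik i6.
have kR : (0 : R) < k%:R by rewrite ltr0n.
have nR : (0 : R) < n%:R by rewrite ltr0n.
have iR : (0 : R) < i%:R by rewrite ltr0n.
have L0 : 0 < L by lra.
have lk0 : 0 <= ln (k%:R : R) :> R by rewrite ln_ge0 // ler1n.
have Lam0 : 0 <= lnek n k by rewrite /lnek -/L; lra.
have LamL : lnek n k <= 1 + L by rewrite /lnek -/L; lra.
have [ik1|ik1] := lerP (i%:R * L) k%:R.
  have h : 6 + ln L + 2 * ln (k%:R : R) - L <= ln i%:R.
    have -> : 6 + ln L + 2 * ln (k%:R : R) - L = ln (expR 6 * L * k%:R ^+ 2 / n%:R).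
      rewrite ln_div ?posrE ?mulr_gt0 ?expR_gt0 ?exprn_gt0 //.
      rewrite [ln (_ * _ ^+ 2)]lnM ?posrE ?mulr_gt0 ?expR_gt0 ?exprn_gt0 //.
      rewrite [ln (expR 6 * L)]lnM ?posrE ?expR_gt0 //.
      by rewrite expRK lnXn // mulr_natl.
    by rewrite ler_ln // posrE // divr_gt0 // !mulr_gt0 ?expR_gt0 ?exprn_gt0.
  have lnL : 0 <= ln L by rewrite ln_ge0; lra from L2 d0.
  have : lnek n k * i%:R / k%:R <= 2.
    rewrite ler_pdivrMr //; apply: (@le_trans _ _ ((1 + L) * i%:R)).
      by apply: ler_wpM2r => //; exact: ltW.
    have : 1 * i%:R <= L * i%:R by apply: ler_wpM2r; lra from L2 iR.
    lra.
  lra.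
have h : ln (k%:R : R) - ln L <= ln i%:R.
  rewrite lerBlDr -lnM ?posrE // ler_ln ?posrE ?mulr_gt0 //; exact: ltW.
have h2 : lnek n k * i%:R / k%:R <= lnek n k * (1 - delta).
  by rewrite -mulrA; apply: ler_wpM2l => //; rewrite ler_pdivrMr.
have h3 : 0 <= delta * (L / 4 - (L - ln (k%:R : R))) + delta * (L - L / 4 - ln (k%:R : R)) by lra.
have h4 : delta * (L / 4) <= delta * (L - ln (k%:R : R)) by apply: ler_wpM2l; lra from d0 kL.
have h5 : lnek n k * (1 - delta) = 1 + L - ln (k%:R : R) - delta - delta * (L - ln (k%:R : R)).
  by rewrite /lnek -/L; ring.
lra from d0 h h2 h4 h5 hd.
Qed.

Section Theta.
Variables (p : R).
Hypotheses (p0 : 0 < p) (p1 : p < 1).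
Let q := 1 - p.
Let th := - ln (1 - p).

Lemma qE : 1 - p = expR (- th).
Proof. by rewrite /th opprK lnK // posrE subr_gt0. Qed.

Lemma th_ge0 : 0 <= th.
Proof. by rewrite /th oppr_ge0 ln_le0 // gerBl ltW. Qed.

Lemma qX i : (1 - p) ^+ i = expR (- (th * i%:R)).
Proof. by rewrite qE -expRM_natr mulNr. Qed.

Lemma th_le n k : expR (- 2 * lnek n k) <= (1 - p) ^+ k.-1 -> th * k.-1%:R <= 2 * lnek n k.
Proof. by rewrite qX ler_expR; lra. Qed.

End Theta.

(** By [medium_exponent] the i-th term is at most [expR (-2) ^+ i] times E^2, where E is the
    expected number of independent k-sets. As E may exceed [mass] by a factor e^(2 n s), the
    geometric sum must start beyond 2 n s, and [r] measures by how much. *)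
Lemma medium_overlap n k p s eta delta r (i0 i1 : nat) :
  (0 < n)%N -> (0 < k)%N -> (k <= n)%N -> (0 < i0)%N -> (i1 <= k)%N -> 0 < p -> p < 1 ->
  0 < delta -> delta <= 1 ->
  2 <= ln (n%:R : R) :> R -> ln (k%:R : R) <= 3 / 4 * ln (n%:R : R) :> R ->
  4 + ln (ln (n%:R : R)) <= delta * ln (n%:R : R) / 4 ->
  expR (- 2 * lnek n k) <= (1 - p) ^+ k.-1 ->
  (forall i, (i < i1)%N -> i%:R <= (1 - delta) * k%:R) ->
  expR 6 * ln (n%:R : R) * k%:R ^+ 2 / n%:R <= i0%:R ->
  4 * n%:R * s + r <= 2 * i0%:R -> 2 * expR (- r) <= eta ->
  'C(n, k)%:R * (1 - p) ^+ 'C(k, 2) * expR (- (2 * n%:R * s)) <= mass n p k ->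
  'C(n, k)%:R * (\sum_(i0 <= i < i1) ('C(k, i) * 'C(n - k, k - i))%:R *
                 (1 - p) ^+ ('C(k, 2) + 'C(k, 2) - 'C(i, 2))) <= eta * mass n p k ^+ 2.
Proof.
move=> n0 k0 kn i00 i1k p0 p1 d0 d1 L2 kL hd hq hi1 hi0 hr he hM.
have th0 := th_ge0 p0. have hth := th_le p1 hq.
set th := - ln (1 - p) in th0 hth.
have kR : (0 : R) < k%:R by rewrite ltr0n.
have nR : (0 : R) < n%:R by rewrite ltr0n.
set E := 'C(n, k)%:R * (1 - p) ^+ 'C(k, 2) in hM.
have q0 : 0 <= 1 - p by lra from p1.
have E0 : 0 <= E by rewrite mulr_ge0 ?exprn_ge0.
have key i : (i0 <= i)%N -> (i < i1)%N ->
   'C(n, k)%:R * (('C(k, i) * 'C(n - k, k - i))%:R *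
                 (1 - p) ^+ ('C(k, 2) + 'C(k, 2) - 'C(i, 2))) <= E ^+ 2 * expR (-2) ^+ i.
  move=> i0i ii1.
  have ipos : (0 < i)%N by apply: leq_trans i0i.
  have iR : (0 : R) < i%:R by rewrite ltr0n.
  have ik : (i <= k)%N by apply: leq_trans (ltnW ii1) i1k.
  have C2 : ('C(i, 2) <= 'C(k, 2))%N by apply: leq_bin2l.
  have hphi := medium_exponent n0 k0 kn ipos d0 d1 L2 kL hd (hi1 i ii1) _.
  have {}hphi : 1 + 2 * ln (k%:R : R) - ln i%:R - ln (n%:R : R) + lnek n k * i%:R / k%:R <= -2.
    by apply: hphi; apply: le_trans hi0 _; rewrite ler_nat.
  have hthi : th * (i%:R - 1) / 2 <= lnek n k * i%:R / k%:R.
    rewrite ler_pdivlMr //.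
    have h1 : (i%:R - 1) * k%:R <= i%:R * k.-1%:R :> R.
      have -> : k.-1%:R = k%:R - 1 :> R by rewrite -[in RHS](prednK k0) -natr1 addrK.
      have : i%:R <= k%:R :> R by rewrite ler_nat.
      clear; lra.
    have h2 := ler_wpM2l th0 h1.
    have h3 : i%:R * (th * k.-1%:R) <= i%:R * (2 * lnek n k) by apply: ler_wpM2l => //; exact: ltW.
    lra from h2 h3.
  have b1 : ('C(k, i) * 'C(n - k, k - i))%:R <=
     (expR 1 * k%:R / i%:R * (k%:R / n%:R)) ^+ i * 'C(n, k)%:R :> R.
    rewrite natrM exprMn -[leRHS]mulrA; apply: ler_pM => //; first exact: bin_le_exp.
    exact: bin_diff_le.
  have b2 : (1 - p) ^+ ('C(k, 2) + 'C(k, 2) - 'C(i, 2)) =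
     ((1 - p) ^+ 'C(k, 2)) ^+ 2 * expR (th * (i%:R - 1) / 2) ^+ i.
    have h : (1 - p) ^+ ('C(k, 2) + 'C(k, 2) - 'C(i, 2)) * (1 - p) ^+ 'C(i, 2) =
       ((1 - p) ^+ 'C(k, 2)) ^+ 2.
      by rewrite -exprD subnK ?exprD // (leq_trans C2) // leq_addr.
    rewrite -h -mulrA (qX p1 'C(i, 2)) -/th -expRM_natl -expRD bin2_natr.
    by rewrite [X in expR X](_ : _ = 0) ?expR0 ?mulr1 //; field.
  rewrite b2.
  have b3 : (expR 1 * k%:R / i%:R * (k%:R / n%:R)) * expR (th * (i%:R - 1) / 2) <= expR (-2).
    have -> : expR 1 * k%:R / i%:R * (k%:R / n%:R) =
      expR (1 + 2 * ln (k%:R : R) - ln i%:R - ln (n%:R : R)).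
      rewrite expRD expRN expRD expRN expRD expRM_natl !lnK ?posrE //.
      by field; rewrite !gt_eqF.
    by rewrite -expRD ler_expR; apply: le_trans hphi; rewrite lerD2l.
  apply: (@le_trans _ _ ('C(n, k)%:R * ((expR 1 * k%:R / i%:R * (k%:R / n%:R)) ^+ i * 'C(n, k)%:R *
    (((1 - p) ^+ 'C(k, 2)) ^+ 2 * expR (th * (i%:R - 1) / 2) ^+ i)))).
    apply: ler_wpM2l => //; apply: ler_wpM2r => //.
    by rewrite mulr_ge0 ?exprn_ge0 ?expR_ge0.
  set u := (expR 1 * _ / _ * _) in b1 b3 *; set w := expR (th * _ / 2) in b3 *.
  have -> : 'C(n, k)%:R * (u ^+ i * 'C(n, k)%:R * (((1 - p) ^+ 'C(k, 2)) ^+ 2 * w ^+ i)) =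
     E ^+ 2 * (u * w) ^+ i by rewrite /E !exprMn; ring.
  apply: ler_wpM2l; first by rewrite sqr_ge0.
  apply: lerXn2r => //; rewrite nnegrE ?expR_ge0 // mulr_ge0 ?expR_ge0 //.
  by rewrite /u !mulr_ge0 ?expR_ge0 ?invr_ge0.
rewrite mulr_sumr.
apply: (@le_trans _ _ (\sum_(i0 <= i < i1) E ^+ 2 * expR (-2) ^+ i)).
  by rewrite !big_nat; apply: ler_sum => i /andP[]; apply: key.
rewrite -mulr_sumr.
have e2 : expR (-2) <= 2^-1 :> R.
  have h : 2 <= expR 2 :> R by apply: le_trans (expR_ge1Dx _); clear; lra.
  by rewrite expRN lef_pV2 ?posrE ?expR_gt0.
apply: le_trans (ler_wpM2l (sqr_ge0 _) (sum_geo_le i0 i1 (expR_ge0 _) e2)) _.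
have hM2 : (E * expR (- (2 * n%:R * s))) ^+ 2 <= mass n p k ^+ 2.
  have x0 : 0 <= E * expR (- (2 * n%:R * s)) by rewrite mulr_ge0 ?expR_ge0.
  by apply: lerXn2r => //; rewrite nnegrE // (le_trans x0).
have eta0 : 0 <= eta by apply: le_trans he; rewrite mulr_ge0 ?expR_ge0.
apply: le_trans (ler_wpM2l eta0 hM2).
clearbody E; rewrite exprMn [leRHS]mulrCA; apply: ler_wpM2l; first by rewrite sqr_ge0.
apply: le_trans (ler_wpM2r (sqr_ge0 _) he).
rewrite -[leRHS]mulrA; apply: ler_wpM2l => //.
rewrite -[leLHS]expRM_natr -[X in _ <= _ * X]expRM_natr -expRD ler_expR; lra from hr.
Qed.

(** The tilt for a binomial variable of mean l^2 p that has to reach 3 l / 2: its square is 1/(l p),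
    the ratio of target to mean up to a constant. If l p > 1 the mean is already of that order, and
    the value is 1. The guard [0 < l] keeps it at least 1 at l = 0, where the inverse would be 0. *)
Definition tilt p l : R := if (0 < l)%N && (l%:R * p <= 1) then (Num.sqrt (l%:R * p))^-1 else 1.

Lemma tilt_ge1 p l : 0 < p -> 1 <= tilt p l.
Proof.
move=> p0; rewrite /tilt; case: ifP => // /andP[l0 lp].
have lR : (0 : R) < l%:R by rewrite ltr0n.
rewrite -[leLHS]invr1 lef_pV2 ?posrE ?sqrtr_gt0 ?mulr_gt0 //.
by rewrite -[leRHS]sqrtr1 ler_sqrt // mulr_ge0 // ltW.
Qed.

(** With z^2 = 1/(l p) the generating function is at most (1 + 1/l)^(l^2) <= e^l, and z^(-3 l) = (l
    p)^(3 l / 2). If l p > 1 the left side is 1 and the right side at least 1. *)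
Lemma tilt_le p l : 0 < p -> p < 1 -> (0 < l)%N ->
  (p * tilt p l ^+ 2 + (1 - p)) ^+ (l ^ 2) / tilt p l ^+ (3 * l) <=
  (expR 1 * Num.sqrt (l%:R * p) ^+ 3) ^+ l.
Proof.
move=> p0 p1 l0; have lR : (0 : R) < l%:R by rewrite ltr0n.
have lp0 : 0 < l%:R * p by rewrite mulr_gt0.
rewrite /tilt l0 /=; case: (lerP (l%:R * p) 1) => lp; last first.
  rewrite !expr1n divr1 mulr1 addrC subrK expr1n; apply: exprn_ege1.
  rewrite -[leLHS]mulr1; apply: ler_pM => //.
    by apply: le_trans (expR_ge1Dx _); rewrite lerDl.
  by apply: exprn_ege1; rewrite -[leLHS]sqrtr1 ler_sqrt // ltW.
set S := Num.sqrt _; have S0 : 0 < S by rewrite sqrtr_gt0.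
have S2 : S ^+ 2 = l%:R * p by rewrite sqr_sqrtr // ltW.
rewrite exprVn S2 exprVn invrK [S ^+ (3 * l)]exprM [leRHS]exprMn.
apply: ler_wpM2r; first by rewrite exprn_ge0 // exprn_ge0 // ltW.
have -> : p * (l%:R * p)^-1 = l%:R^-1 by field; rewrite !gt_eqF.
have h : l%:R^-1 + (1 - p) <= expR l%:R^-1.
  by apply: le_trans (expR_ge1Dx _); lra.
have h0 : 0 <= l%:R^-1 + (1 - p) by rewrite addr_ge0 ?invr_ge0 //; lra.
apply: (@le_trans _ _ (expR l%:R^-1 ^+ (l ^ 2))).
  by apply: lerXn2r; rewrite ?nnegrE ?expR_ge0.
rewrite -!expRM_natr ler_expR mul1r natrX expr2 mulrA mulVf ?mul1r // gt_eqF //.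
Qed.

Lemma sum_geo_rev (psi : R) i1 k : 0 <= psi -> psi <= 2^-1 ->
  \sum_(i1 <= i < k) psi ^+ (k - i) <= 2 * psi.
Proof.
move=> h0 h1; elim: k => [|k IH]; first by rewrite big_geq // mulr_ge0.
have [ik|ik] := leqP i1 k; last by rewrite big_geq // mulr_ge0.
rewrite big_nat_recr //= subSnn expr1.
have -> : \sum_(i1 <= i < k) psi ^+ (k.+1 - i) = psi * \sum_(i1 <= i < k) psi ^+ (k - i).
  rewrite mulr_sumr !big_nat; apply: eq_bigr => i /andP[_ ik'].
  by rewrite subSn ?exprS // ltnW.
have h2 := ler_wpM2l h0 IH.
have : psi * (2 * psi) <= psi * 1 by apply: ler_wpM2l => //; lra.
lra.
Qed.

(** With l = k - i the term is at most psi^l. Per exchanged vertex there are (e k/l)(e n/l) choices,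
    a factor (1-p)^k for independence, corrected through delta because l <= delta k, a factor e (l
    p)^(3/2) for the forced edges and 2 for [(1 - s)^-1]. The powers of l combine to l^(-1/2) <=
    1. *)
Lemma large_overlap n k p s eta delta (i1 : nat) :
  (0 < n)%N -> (1 < k)%N -> (k <= n)%N -> 0 < p -> p < 1 -> s <= 2^-1 ->
  0 <= delta -> 0 <= lnek n k ->
  expR (- 2 * lnek n k) <= (1 - p) ^+ k.-1 ->
  (1 - delta) * k%:R <= i1%:R -> eta <= 1 ->
  2 * expR 3 * k%:R * n%:R * (1 - p) ^+ k * Num.sqrt p ^+ 3 * expR (4 * delta * lnek n k) <=
    eta / 2 ->
  \sum_(i1 <= i < k) ('C(k, i) * 'C(n - k, k - i))%:R *
     ((1 - p) ^+ ('C(k, 2) - 'C(i, 2)) * (p * tilt p (k - i) ^+ 2 + (1 - p)) ^+ ((k - i) ^ 2) /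
     (tilt p (k - i) ^+ (3 * (k - i)) * (1 - s) ^+ (k - i))) <= eta.
Proof.
move=> n0 k1 kn p0 p1 s2 d0 Lam0 hq hi1 e1; set psi := (X in X <= _) => hpsi.
have k0 : (0 < k)%N by apply: ltn_trans k1.
have th0 := th_ge0 p0. have hth := th_le p1 hq.
set th := - ln (1 - p) in th0 hth.
have kR : (0 : R) < k%:R by rewrite ltr0n.
have nR : (0 : R) < n%:R by rewrite ltr0n.
have q0 : 0 < 1 - p by lra from p1.
have sp0 : 0 < Num.sqrt p by rewrite sqrtr_gt0.
have psi0 : 0 <= psi by rewrite /psi !mulr_ge0 ?expR_ge0 ?exprn_ge0 // ltW.
apply: (@le_trans _ _ (\sum_(i1 <= i < k) psi ^+ (k - i))); last first.
  by apply: le_trans (sum_geo_rev i1 k psi0 _) _; lra from e1 hpsi.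
rewrite !big_nat; apply: ler_sum => i /andP[i1i ik].
set l := (k - i)%N; have l0 : (0 < l)%N by rewrite subn_gt0.
have lR : (0 : R) < l%:R by rewrite ltr0n.
have lk : (l <= k)%N by rewrite leq_subr.
have il : i = (k - l)%N by rewrite /l subKn // ltnW.
have lE : l%:R = k%:R - i%:R :> R by rewrite natrB // ltnW.
have ld : l%:R <= delta * k%:R :> R.
  have : i1%:R <= i%:R :> R by rewrite ler_nat.
  rewrite lE; lra from hi1.
have c1 : 'C(k, i)%:R <= (expR 1 * k%:R / l%:R) ^+ l :> R.
  by rewrite -(bin_sub (ltnW ik)); apply: bin_le_exp.
have c2 : 'C(n - k, l)%:R <= (expR 1 * n%:R / l%:R) ^+ l :> R.
  apply: le_trans (_ : _ <= 'C(n, l)%:R) _; last exact: bin_le_exp.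
  by rewrite ler_nat leq_bin2l // leq_subr.
have c3 : (1 - p) ^+ ('C(k, 2) - 'C(i, 2)) <=
    ((1 - p) ^+ k * expR (4 * delta * lnek n k)) ^+ l.
  rewrite (qX p1) -/th natrB; last by rewrite leq_bin2l // ltnW.
  rewrite !bin2_natr (qX p1 k) -/th -expRD -expRM_natr ler_expR.
  have -> : i%:R = k%:R - l%:R :> R by rewrite lE; ring.
  have k1R : k.-1%:R = k%:R - 1 :> R by rewrite -[in RHS](prednK k0) -natr1 addrK.
  have k2R : 2 <= k%:R :> R by rewrite ler_nat.
  have l1R : 1 <= l%:R :> R by rewrite ler1n.
  rewrite k1R in hth.
  have h1 : th * (l%:R + 1) / 2 <= 4 * delta * lnek n k.
    have a1 : th * (l%:R + 1) <= th * (2 * l%:R) by apply: ler_wpM2l => //; lra from l1R.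
    have a2 : th * k%:R <= 4 * lnek n k.
      have : th * k%:R <= th * (2 * (k%:R - 1)) by apply: ler_wpM2l => //; lra from k2R.
      lra from hth.
    have a3 : th * l%:R <= th * (delta * k%:R) by apply: ler_wpM2l.
    have a4 := ler_wpM2l d0 a2.
    lra from a1 a3 a4.
  have h2 := ler_wpM2r (ltW lR) h1.
  rewrite le_eqVlt in h2.
  have e : - (th * (k%:R * (k%:R - 1) / 2 - (k%:R - l%:R) * (k%:R - l%:R - 1) / 2)) =
    - (th * k%:R) * l%:R + th * (l%:R + 1) / 2 * l%:R by field.
  by rewrite e mulrDl lerD2l le_eqVlt.
have c4 := tilt_le p0 p1 l0.
have c5 : ((1 - s) ^+ l)^-1 <= 2 ^+ l.
  rewrite -exprVn; apply: lerXn2r; rewrite ?nnegrE ?invr_ge0 //; first by lra from s2.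
  by rewrite -[leRHS]invrK lef_pV2 ?posrE ?invr_gt0 //; lra from s2.
set T := tilt p l in c4 *.
have T1 : 1 <= T by apply: tilt_ge1.
have T0 : 0 < T by apply: lt_le_trans T1.
set A := (1 - p) ^+ ('C(k, 2) - 'C(i, 2)) in c3 *.
set B := (p * T ^+ 2 + (1 - p)) ^+ (l ^ 2) in c4 *.
have A0 : 0 <= A by rewrite exprn_ge0 // ltW.
have B0 : 0 <= B.
  by apply: exprn_ge0; apply: addr_ge0; [apply: mulr_ge0; [exact: ltW|apply: exprn_ge0]|];
    exact: ltW.
have BT0 : 0 <= B / T ^+ (3 * l) by apply: divr_ge0 => //; apply: exprn_ge0; exact: ltW.
have S0 : 0 <= ((1 - s) ^+ l)^-1 by rewrite invr_ge0 exprn_ge0 //; lra from s2.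
rewrite natrM.
have -> : 'C(k, i)%:R * 'C(n - k, l)%:R * (A * B / (T ^+ (3 * l) * (1 - s) ^+ l)) =
  'C(k, i)%:R * 'C(n - k, l)%:R * A * (B / T ^+ (3 * l)) * ((1 - s) ^+ l)^-1.
  by rewrite invfM; ring.
apply: (@le_trans _ _ ((expR 1 * k%:R / l%:R) ^+ l * (expR 1 * n%:R / l%:R) ^+ l *
   ((1 - p) ^+ k * expR (4 * delta * lnek n k)) ^+ l *
     (expR 1 * Num.sqrt (l%:R * p) ^+ 3) ^+ l * 2 ^+ l)).
  do 2!(apply: ler_pM => //; first by do ?(apply: mulr_ge0 => //)).
  by do 2!(apply: ler_pM => //).
rewrite -!exprMn; apply: lerXn2r; rewrite ?nnegrE //.
  by rewrite !mulr_ge0 ?expR_ge0 ?exprn_ge0 ?invr_ge0 ?sqrtr_ge0 // ltW.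
rewrite sqrtrM // exprMn.
have l1 : 1 <= Num.sqrt l%:R :> R by rewrite -[leLHS]sqrtr1 ler_sqrt // ler1n.
have hl : Num.sqrt l%:R ^+ 3 / l%:R ^+ 2 <= 1 :> R.
  rewrite ler_pdivrMr ?exprn_gt0 // mul1r -[X in _ <= X ^+ 2]sqr_sqrtr // -exprM.
  by apply: ler_weXn2l.
have e3 : expR 3 = expR 1 * expR 1 * expR 1 :> R by rewrite -!expRD; congr expR; ring.
set E1 := expR 1 in e3 *.
have -> : E1 * k%:R / l%:R * (E1 * n%:R / l%:R) *
   ((1 - p) ^+ k * expR (4 * delta * lnek n k)) *
   (E1 * (Num.sqrt l%:R ^+ 3 * Num.sqrt p ^+ 3)) * 2 =
   psi * (Num.sqrt l%:R ^+ 3 / l%:R ^+ 2).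
  by rewrite /psi e3; field; rewrite gt_eqF.
by rewrite -[leRHS]mulr1; apply: ler_wpM2l.
Qed.

End Overlaps.

(** * The lower bound on the independence number under explicit smallness conditions *)

Section Assembly.
Variables (R : realType).
Implicit Types (n k i l : nat) (p s z eta : R).

Lemma nat_above (x : R) : 0 <= x -> exists m : nat, x <= m%:R /\ m%:R < x + 1.
Proof.
move=> x0; have /andP[h1 h2] := truncn_itv x0.
have [e|ne] := eqVneq x (Num.truncn x)%:R.
  by exists (Num.truncn x); rewrite -e lexx ltrDl.
exists (Num.truncn x).+1; split; first exact: ltW.
by rewrite -natr1 ltrD2r lt_neqAle h1 andbT eq_sym.
Qed.

Lemma expR1_ge2 : 2 <= expR 1 :> R.
Proof. by apply: le_trans (expR_ge1Dx _). Qed.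

Lemma expR1_le4 : expR 1 <= 4 :> R.
Proof.
have h : expR (2^-1) <= 2 :> R.
  rewrite -[leLHS]invrK -expRN -[leRHS]invrK lef_pV2 ?posrE ?expR_gt0 ?invr_gt0 //.
  by apply: le_trans (expR_ge1Dx _); lra.
have -> : expR 1 = expR (2^-1) * expR (2^-1) :> R by rewrite -expRD; congr expR; lra.
have -> : 4 = 2 * 2 :> R by ring.
by apply: ler_pM; rewrite ?expR_ge0.
Qed.

Lemma expRn_le4 m : expR m%:R <= 4 ^+ m :> R.
Proof. by rewrite -[m%:R]mulr1 expRM_natl lerXn2r ?nnegrE ?expR_ge0 ?expR1_le4. Qed.

Lemma expRn_ge2 m : 2 ^+ m <= expR m%:R :> R.
Proof. by rewrite -[m%:R]mulr1 expRM_natl lerXn2r ?nnegrE ?expR_ge0 ?expR1_ge2. Qed.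

Lemma sbad_le n p k (I : {set 'I_n}) v : 0 <= p -> p <= 1 -> #|I| = k ->
  sbad p I v <= (1 - p) ^+ k + p * (1 - p) ^+ k.-1 * k%:R.
Proof.
move=> p0 p1 Ik; rewrite /sbad Ik lerD2l mulrC; apply: ler_wpM2l.
  by rewrite mulr_ge0 // exprn_ge0 // subr_ge0.
by rewrite ler_nat -Ik subset_leq_card //; apply/fintype.subsetP => u; rewrite inE => /andP[].
Qed.


(** Most errors are K^3/N^2 times powers of L, and the hypothesis with [10 ^+ 10] dominates them.
    Its factor [expR (eps / 2 * L)] absorbs the correction of the large overlaps, and its right side
    is [eta ^+ 2] because that estimate is squared. *)
Lemma alpha_lower n p k eps eta :
  0 < eps -> eps <= 1 -> 0 < eta -> eta <= 4^-1 ->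
  (1 < k)%N -> (k <= n)%N -> 0 < p ->
  let N := n%:R : R in let K := k%:R : R in let L := ln N in
  let y := (1 - p) ^+ k in let c := p * (1 - p) ^+ k.-1 in
  2 <= L -> p * L ^+ 2 <= 1 -> y <= 2 * (K / N) ^+ 2 -> K * p <= 3 * L ->
  expR (- 2 * lnek R n k) <= (1 - p) ^+ k.-1 ->
  10 ^+ 10 * (L ^+ 3 * (K ^+ 3 / N ^+ 2) * expR (eps / 2 * L)) <= eta ^+ 2 ->
  ln K <= 3 / 4 * L -> 4 + ln L <= eps / 16 * L / 4 ->
  4 * (Num.sqrt L + 2) <= K -> expR 6 * L * K / N <= 4^-1 ->
  2 * expR (- Num.sqrt L) <= eta -> 200 <= eta * L -> 4 <= eta * expR (eps * L) ->
  expR (eps * L) <= 'C(n, k)%:R * (1 - p) ^+ 'C(k, 2) * expR (- (N * (y + c * K / 2))) ->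
  Ex p (fun G : graph n => (alpha G < k)%:R) <= 24 * eta.
Proof.
move=> e0 e1 h0 h1 k1 kn p0 N K L y c L2 pL yK Kp hq T1 T2 hL kbig kN5 hsq hL4 hL5 hF.
have k0 : (0 < k)%N by apply: ltn_trans k1.
have n0 : (0 < n)%N by apply: leq_trans kn.
have N0 : 0 < N by rewrite ltr0n.
have K0 : 0 < K by rewrite ltr0n.
have KN : K <= N by rewrite ler_nat.
have L0 : 0 < L by lra from L2.
have L24 : 4 <= L ^+ 2 by rewrite expr2; have := ler_pM (ler0n _ _) (ler0n _ _) L2 L2; clear; lra.
have p2 : p <= 4^-1.
  have := ler_wpM2l (ltW p0) L24; lra from pL.
have p1 : p < 1 by lra from p2.
have q0 : 0 < 1 - p by lra from p2.
have y0 : 0 < y by rewrite exprn_gt0.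
have c0 : 0 < c by rewrite mulr_gt0 // exprn_gt0.
have yc : y = (1 - p) * (1 - p) ^+ k.-1 by rewrite /y -exprS prednK.
have qk0 : 0 < (1 - p) ^+ k.-1 by rewrite exprn_gt0.
have c2 : c <= 2 * p * y.
  rewrite yc /c; have a1 : 0 <= p * (1 - p) ^+ k.-1 * (1 - 2 * p).
    by rewrite mulr_ge0 ?mulr_ge0 //; [exact: ltW|exact: ltW|lra from p2].
  lra from a1.
have [s sE] : exists s, s = y + c * K by exists (y + c * K).
have [t tE] : exists t, t = K ^+ 3 / N ^+ 2 by exists (K ^+ 3 / N ^+ 2).
have t0 : 0 < t by rewrite tE divr_gt0 ?exprn_gt0.
have t0' := ltW t0. have L0' := ltW L0. have p0' := ltW p0. have N0' := ltW N0. have K0' := ltW K0.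
have Kp0 : 0 < K * p by rewrite mulr_gt0.
have Kp0' := ltW Kp0. have y0' := ltW y0. have c0' := ltW c0. have h0' := ltW h0.
have L2t0 : 0 <= L ^+ 2 * t by apply: mulr_ge0 => //; apply: sqr_ge0.
have [V VE'] : exists V, V = L ^+ 3 * t by exists (L ^+ 3 * t).
have V0 : 0 < V by rewrite VE' mulr_gt0 ?exprn_gt0.
have L3 : 4 * L <= L ^+ 3 by rewrite [L ^+ 3]exprSr; apply: ler_wpM2r => //; exact: ltW.
have L23 : 2 * L ^+ 2 <= L ^+ 3 by rewrite [L ^+ 3]exprS; apply: ler_wpM2r => //; apply: sqr_ge0.
have VL1 : 4 * (L * t) <= V by rewrite VE' mulrA; apply: ler_wpM2r => //; exact: ltW.
have VL2 : 2 * (L ^+ 2 * t) <= V by rewrite VE' mulrA; apply: ler_wpM2r => //; exact: ltW.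
have eL1 : 1 <= expR (eps / 2 * L).
  by apply: le_trans (expR_ge1Dx _); rewrite lerDl; apply: mulr_ge0; lra from e0 L0.
have T1V : 10 ^+ 10 * (V * expR (eps / 2 * L)) <= eta ^+ 2 by rewrite VE' tE.
have V1 : 10 ^+ 10 * V <= eta ^+ 2.
  apply: le_trans T1V; apply: ler_wpM2l => //.
  by rewrite -[leLHS]mulr1; apply: ler_wpM2l => //; exact: ltW.
have eta2 : eta ^+ 2 <= eta / 4.
  by rewrite expr2; apply: ler_wpM2l => //; exact: ltW.
have V2 : 10 ^+ 10 * V <= eta / 4 by apply: le_trans eta2.
have KNN : (K / N) ^+ 2 = K ^+ 2 / N ^+ 2 by rewrite expr_div_n.
have sle : s <= 14 * L * (K / N) ^+ 2.
  rewrite sE.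
  have a1 : c * K <= 2 * p * y * K by apply: ler_wpM2r => //; exact: ltW.
  have a2 : y * (K * p) <= y * (3 * L) by apply: ler_wpM2l => //; exact: ltW.
  have a3 : y * L <= 2 * (K / N) ^+ 2 * L by apply: ler_wpM2r => //; exact: ltW.
  have a4 : y * 2 <= y * L by apply: ler_wpM2l.
  lra from a1 a2 a3 a4 y0'.
have s0 : 0 <= s by rewrite sE addr_ge0 ?mulr_ge0 // ltW.
have tKN : K * (K / N) ^+ 2 = t by rewrite KNN tE; field; rewrite gt_eqF.
have sK : s * K <= 14 * (L * t).
  have := ler_wpM2r (ltW K0) sle; rewrite -tKN; clear; lra.
have K1 : 1 <= K by rewrite ler1n.
have s2 : s <= 2^-1.
  have : s * 1 <= s * K by apply: ler_wpM2l.
  lra from sK VL1 V2 h1.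
have K4N3 : K ^+ 4 / N ^+ 3 <= t.
  have -> : K ^+ 4 / N ^+ 3 = t * (K / N) by rewrite tE; field; rewrite gt_eqF.
  rewrite -[leRHS]mulr1; apply: ler_wpM2l; first exact: ltW.
  by rewrite ler_pdivrMr // mul1r.
have Ns2 : 2 * N * s ^+ 2 <= 392 * (L ^+ 2 * t).
  have a1 : s ^+ 2 <= (14 * L * (K / N) ^+ 2) ^+ 2.
    by rewrite lerXn2r ?nnegrE // (le_trans s0).
  have a2 := ler_wpM2l (ltW N0) a1.
  have e2 : N * (14 * L * (K / N) ^+ 2) ^+ 2 = 196 * L ^+ 2 * (K ^+ 4 / N ^+ 3).
    by field; rewrite gt_eqF.
  have a3 : L ^+ 2 * (K ^+ 4 / N ^+ 3) <= L ^+ 2 * t by apply: ler_wpM2l; rewrite ?sqr_ge0.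
  lra from a2 e2 a3.
set E := 'C(n, k)%:R * (1 - p) ^+ 'C(k, 2) in hF *.
have E0 : 0 <= E by rewrite mulr_ge0 // exprn_ge0 // ltW.
have ss (I : {set 'I_n}) v : #|I| = k -> sbad p I v <= s.
  by move=> Ik; rewrite sE; apply: sbad_le => //; exact: ltW.
have hmass := mass_ge (ltW p0) p1 kn s2 ss; rewrite -/E -/N -/K -/y -/c in hmass.
have M1 : 1 <= eta * mass n p k.
  have a1 : expR (eps * L) * expR (- 1) <= mass n p k.
    apply: le_trans hmass; rewrite expRD mulrA; apply: ler_pM => //; rewrite ?expR_ge0 //.
    rewrite ler_expR; lra from Ns2 VL2 V2 h1.
  have a2 : 4^-1 <= expR (- 1) :> R.
    by rewrite expRN lef_pV2 ?posrE ?expR_gt0 // expR1_le4.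
  have a3 := ler_wpM2l (ltW h0) a1.
  have a4 : 4 * 4^-1 <= eta * expR (eps * L) * expR (- 1) by apply: ler_pM.
  rewrite mulfV // in a4; lra from a3 a4.
have M2 : E * expR (- (2 * N * s)) <= mass n p k.
  apply: le_trans hmass; apply: ler_wpM2l => //; rewrite ler_expR.
  have a1 : N * (y + c * K / 2) <= N * s.
    apply: ler_wpM2l; [exact: ltW|rewrite sE lerD2l].
    by have : 0 <= c * K by [apply: mulr_ge0]; clear; lra.
  have a2 : (N * s) * (2 * s) <= (N * s) * 1.
    by apply: ler_wpM2l; [apply: mulr_ge0|lra from s2].
  lra from a1 a2.
(* The first summand is what the medium range requires, and it also exceeds 2 n s. The second makes
   [2 * expR (- r)] small with r = sqrt L, yet is slow enough for p i0^2 to stay small when p L^2 <=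
   1. *)
have [i0 [i0l i0u]] := @nat_above (expR 6 * L * K ^+ 2 / N + Num.sqrt L) (ltac:(
   rewrite addr_ge0 ?sqrtr_ge0 // divr_ge0 // ?mulr_ge0 ?expR_ge0 ?sqr_ge0 // ltW //)).
have d1 : 0 <= 1 - eps / 16 by lra from e1 e0.
(* The choice delta = eps / 16 makes the square of the correction [expR (4 * delta * lnek n k)] of
   order n^(eps/2) at most. *)
have [i1 [i1l i1u]] := @nat_above ((1 - eps / 16) * K) (mulr_ge0 d1 (ltW K0)).
have e6 : expR 6 * L * K ^+ 2 / N <= K / 4.
  have -> : expR 6 * L * K ^+ 2 / N = expR 6 * L * K / N * K by field; rewrite gt_eqF.
  by rewrite mulrC; apply: ler_wpM2l => //; exact: ltW.
have sL0 : 0 < Num.sqrt L by rewrite sqrtr_gt0.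
have e6L : 0 <= expR 6 * L * K ^+ 2 / N.
  by rewrite divr_ge0 ?mulr_ge0 ?expR_ge0 ?sqr_ge0 // ltW.
have epsK : eps / 16 * K <= 16^-1 * K by apply: ler_wpM2r => //; lra from e1.
have epsK0 : 0 <= eps / 16 * K by apply: mulr_ge0 => //; lra from e0.
have i01 : (i0 <= i1)%N.
  by rewrite -(ler_nat R); lra from i0u i1l e6 kbig epsK K1.
have i1k : (i1 <= k)%N.
  by rewrite -ltnS -(ltr_nat R) -natr1 -/K; lra from i1u epsK0.
have i00 : (0 < i0)%N.
  by rewrite -(ltr0n R); lra from i0l e6L sL0.
have i0k : (i0 <= k)%N by apply: leq_trans i1k.
have pi0 : p * i0%:R ^+ 2 <= eta / 8.
  have a0 : i0%:R <= expR 6 * L * K ^+ 2 / N + (Num.sqrt L + 1).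
    by lra from i0u.
  have a1 : i0%:R ^+ 2 <= 2 * (expR 6 * L * K ^+ 2 / N) ^+ 2 + 2 * (Num.sqrt L + 1) ^+ 2.
    set u := _ / N in a0 *; set v := _ + 1 in a0 *.
    have : i0%:R ^+ 2 <= (u + v) ^+ 2 :> R by rewrite lerXn2r ?nnegrE // (le_trans _ a0).
    have := sqr_ge0 (u - v); clear; lra.
  have a2 : (Num.sqrt L + 1) ^+ 2 <= 2 * L + 2.
    have hs : Num.sqrt L ^+ 2 = L by rewrite sqr_sqrtr // ltW.
    by have := sqr_ge0 (Num.sqrt L - 1); clear -hs; lra.
  have a3 : p * L <= eta / 200.
    have b1 : p * L * 200 <= p * L * (eta * L).
      by apply: ler_wpM2l => //; apply: mulr_ge0; exact: ltW.
    have b2 : eta * (p * L ^+ 2) <= eta * 1 by apply: ler_wpM2l.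
    lra from b1 b2.
  have a4 : p * 2 <= p * L by apply: ler_wpM2l => //; exact: ltW.
  have a5 : p * (expR 6 * L * K ^+ 2 / N) ^+ 2 <= 4 ^+ 12 * (3 * V).
    have -> : p * (expR 6 * L * K ^+ 2 / N) ^+ 2 = expR 6 ^+ 2 * ((K * p) * (L ^+ 2 * t)).
      by rewrite tE; field; rewrite gt_eqF.
    apply: ler_pM; rewrite ?sqr_ge0 //.
    - by apply: mulr_ge0.
    - have -> : expR 6 ^+ 2 = expR 12 :> R by rewrite -expRM_natl; congr expR; ring.
      exact: expRn_le4 12.
    - apply: le_trans (ler_wpM2r L2t0 Kp) _.
      by rewrite VE' le_eqVlt; apply/orP; left; apply/eqP; clear; ring.
  have a6 := ler_wpM2l (ltW p0) a1.
  have a7 := ler_wpM2l (ltW p0) a2.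
  move: a3 a4 a5 a6 a7 V2 (ltW h0); clear; lra.
have pi01 : 2 * p * i0%:R <= 1.
  have b1 : p * i0%:R * 1 <= p * i0%:R * i0%:R.
    by apply: ler_wpM2l; [apply: mulr_ge0|rewrite ler1n].
  lra from b1 pi0 h1.
have S1 := @small_overlap R n p k s eta i0 (1 + 2 * K * p)^-1 n0 p0 (ltac:(clear -p2;
  lra)) s0 s2 h0 h1 erefl i0k.
have z1 : (1 + 2 * K * p)^-1 <= 1 by rewrite invf_le1; lra from Kp0.
have z0 : 0 < (1 + 2 * K * p)^-1 by rewrite invr_gt0; lra from Kp0.
have x1 l : 1 <= tilt p l by apply: tilt_ge1.
have lnLam : 0 <= lnek R n k by rewrite /lnek -/N -/L -/K; lra from T2 L0.
apply: (second_moment_combine (ltW p0) p1 s0 s2 ss i01 i1k z0 z1 x1 h0 h1 _ _ _ _ M1).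
- have b1 : c ^+ 2 <= (2 * p * y) ^+ 2 by rewrite lerXn2r ?nnegrE ?(ltW c0) // (le_trans (ltW c0)).
  have b2 : (K * p) ^+ 2 <= (3 * L) ^+ 2
    by rewrite lerXn2r ?nnegrE ?(ltW Kp0) // (le_trans (ltW Kp0)).
  have b3 : y ^+ 2 <= (2 * (K / N) ^+ 2) ^+ 2
    by rewrite lerXn2r ?nnegrE ?(ltW y0) // (le_trans (ltW y0)).
  have b4 : N ^+ 2 * K * c ^+ 2 <= N ^+ 2 * K * (2 * p * y) ^+ 2.
    by apply: ler_wpM2l => //; apply: mulr_ge0 => //; apply: sqr_ge0.
  have b5 : (N ^+ 2 * 4 / K) * ((K * p) ^+ 2 * y ^+ 2) <= (N ^+ 2 * 4 / K) *
    ((3 * L) ^+ 2 * (2 * (K / N) ^+ 2) ^+ 2).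
    apply: ler_wpM2l; first by apply: divr_ge0 => //; apply: mulr_ge0 => //; apply: sqr_ge0.
    by apply: ler_pM; rewrite ?sqr_ge0.
  have e5 : N ^+ 2 * K * (2 * p * y) ^+ 2 = (N ^+ 2 * 4 / K) * ((K * p) ^+ 2 * y ^+ 2).
    by field; rewrite gt_eqF.
  have e6' : (N ^+ 2 * 4 / K) * ((3 * L) ^+ 2 * (2 * (K / N) ^+ 2) ^+ 2) = 144 * (L ^+ 2 * t).
    by rewrite tE; field; rewrite !gt_eqF.
  rewrite -/c -/N -/K; lra from b4 b5 e5 e6' VL2 V2 h0.
- apply: S1 => //; last by lra from sK VL1 V2 h0.
  have b1 : expR (2 * p * i0%:R) <= 4 by apply: le_trans expR1_le4; rewrite ler_expR.
  have b2 : expR 2 <= 16 :> R by have := expRn_le4 2; clear; lra.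
  have b3 : (1 + 2 * K * p) ^+ 2 <= (7 * L) ^+ 2 by rewrite lerXn2r ?nnegrE //; lra from Kp Kp0 L2.
  have b4 : y ^+ 2 <= (2 * (K / N) ^+ 2) ^+ 2
    by rewrite lerXn2r ?nnegrE ?(ltW y0) // (le_trans (ltW y0)).
  have b5 : expR 2 * y ^+ 2 * expR (2 * p * i0%:R) * (1 + 2 * K * p) ^+ 2 <=
     16 * (2 * (K / N) ^+ 2) ^+ 2 * 4 * (7 * L) ^+ 2.
    apply: ler_pM; rewrite ?sqr_ge0 ?mulr_ge0 ?expR_ge0 ?sqr_ge0 //.
    apply: ler_pM; rewrite ?mulr_ge0 ?expR_ge0 ?sqr_ge0 //.
    by apply: ler_pM; rewrite ?expR_ge0 ?sqr_ge0.
  have b6 := ler_wpM2l (ltW N0) b5.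
  have e5 : N * (16 * (2 * (K / N) ^+ 2) ^+ 2 * 4 * (7 * L) ^+ 2) = 64 * 196 *
    (L ^+ 2 * (K ^+ 4 / N ^+ 3)).
    by field; rewrite gt_eqF.
  have b7 : L ^+ 2 * (K ^+ 4 / N ^+ 3) <= L ^+ 2 * t by apply: ler_wpM2l; rewrite ?sqr_ge0.
  rewrite -/y -/N -/K; lra from b6 e5 b7 VL2 V2 h0.
- apply: (@medium_overlap R n k p s eta (eps / 16) (Num.sqrt L) i0 i1) => //; try by lra from e0 e1.
  + move=> i ii1; have : i.+1%:R <= i1%:R :> R by rewrite ler_nat.
    by rewrite -natr1 -/K; lra from i1u.
  + by rewrite -/N -/L -/K; lra from i0l sL0.
  + rewrite -/N.
    have b1 : N * s <= 14 * (L * K ^+ 2 / N).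
      have := ler_wpM2l (ltW N0) sle.
      have -> : N * (14 * L * (K / N) ^+ 2) = 14 * (L * K ^+ 2 / N) by field; rewrite gt_eqF.
      by [].
    have b2 : 64 <= expR 6 :> R by have := expRn_ge2 6; clear; lra.
    have b3 : 64 * (L * K ^+ 2 / N) <= expR 6 * (L * K ^+ 2 / N).
      by apply: ler_wpM2r => //; apply: divr_ge0 => //; apply: mulr_ge0 => //; apply: sqr_ge0.
    have b0 : 0 <= L * K ^+ 2 / N.
      by apply: divr_ge0 => //; apply: mulr_ge0 => //; apply: sqr_ge0.
    lra from b0 b1 b3 i0l sL0.
- have mass1 : 1 <= mass n p k.
    have m0 : 0 <= mass n p k by have := lt_le_trans ltr01 M1; rewrite pmulr_rgt0 // => /ltW.
    have : eta * mass n p k <= 1 * mass n p k by apply: ler_wpM2r => //; lra from h1.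
    lra from M1.
  have eta1 : eta * 1 <= eta * mass n p k by apply: ler_wpM2l.
  rewrite mulr1 in eta1; apply: le_trans eta1.
  apply: (@large_overlap R n k p s eta (eps / 16) i1) => //; try by lra from e0 e1 h1.
  rewrite -/N -/K -/y.
  set sp := Num.sqrt p; have sp0 : 0 < sp by rewrite sqrtr_gt0.
  have sp2 : sp ^+ 2 = p by rewrite sqr_sqrtr // ltW.
  set W := expR (4 * (eps / 16) * lnek R n k); have W0 : 0 < W by apply: expR_gt0.
  have e3 : 0 < expR 3 :> R by apply: expR_gt0.
  have b1 : 2 * expR 3 * K * N * y * sp ^+ 3 * W <= 4 * expR 3 * (K ^+ 3 / N) * sp ^+ 3 * W.
    do 2!(apply: ler_wpM2r; first by rewrite ?exprn_ge0 // ltW).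
    have -> : 4 * expR 3 * (K ^+ 3 / N) = 2 * expR 3 * K * N * (2 * (K / N) ^+ 2).
      by field; rewrite gt_eqF.
    by apply: ler_wpM2l => //; rewrite !mulr_ge0 // ltW.
  apply: le_trans b1 _; set Z := _ * W.
  have Z0 : 0 <= Z.
    by rewrite /Z !mulr_ge0 ?invr_ge0 ?exprn_ge0 // ltW.
  (* Squaring removes the half-integer power of p: K^6 p^3 / N^2 = (K p)^3 K^3 / N^2, and K p is at
     most 3 L. *)
  rewrite -ler_sqr ?nnegrE //; last by lra from h0.
  have sp6 : sp ^+ 6 = p ^+ 3 by rewrite (exprM sp 2 3) sp2.
  have -> : Z ^+ 2 = 16 * expR 3 ^+ 2 * (K ^+ 6 / N ^+ 2) * sp ^+ 6 * W ^+ 2.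
    by rewrite /Z; field; rewrite gt_eqF.
  have -> : 16 * expR 3 ^+ 2 * (K ^+ 6 / N ^+ 2) * sp ^+ 6 * W ^+ 2 =
      16 * expR 3 ^+ 2 * (K * p) ^+ 3 * t * W ^+ 2.
    by rewrite sp6 tE; field; rewrite gt_eqF.
  have b2 : expR 3 ^+ 2 <= 4 ^+ 6 :> R.
    have -> : expR 3 ^+ 2 = expR 6 :> R by rewrite -expRM_natl; congr expR; ring.
    exact: expRn_le4 6.
  have b3 : (K * p) ^+ 3 <= (3 * L) ^+ 3
    by rewrite lerXn2r ?nnegrE ?(ltW Kp0) // (le_trans (ltW Kp0)).
  have b4 : W ^+ 2 <= 4 * expR (eps / 2 * L).
    apply: le_trans (_ : _ <= expR 1 * expR (eps / 2 * L)) _; last first.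
      by apply: ler_wpM2r; rewrite ?expR_ge0 ?expR1_le4.
    rewrite -expRD -expRM_natl ler_expR /lnek -/N -/L -/K.
    have lk : 0 <= ln K by rewrite ln_ge0.
    have : eps * (1 + L - ln K) <= eps * (1 + L) by apply: ler_wpM2l; lra from e0 lk.
    lra from e1.
  have b5 : 16 * expR 3 ^+ 2 * (K * p) ^+ 3 * t * W ^+ 2 <=
     16 * 4 ^+ 6 * (3 * L) ^+ 3 * t * (4 * expR (eps / 2 * L)).
    apply: ler_pM => //; first by rewrite !mulr_ge0 ?exprn_ge0 ?expR_ge0 // ltW.
      by rewrite sqr_ge0.
    apply: ler_wpM2r => //; apply: ler_pM => //;
      rewrite ?mulr_ge0 ?exprn_ge0 ?expR_ge0 ?(ltW Kp0) //.
    by apply: ler_wpM2l.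
  have VE : 0 <= V * expR (eps / 2 * L) by rewrite mulr_ge0 ?expR_ge0 // ltW.
  have e5 : 16 * 4 ^+ 6 * (3 * L) ^+ 3 * t * (4 * expR (eps / 2 * L)) =
     16 * 4 ^+ 6 * 27 * 4 * (V * expR (eps / 2 * L)) by rewrite VE'; ring.
  have -> : (eta / 2) ^+ 2 = eta ^+ 2 / 4 by field.
  lra from b5 e5 T1V VE.
Qed.

End Assembly.

(** * The integer k_x *)

Section Threshold.
Variables (R : realType).
Implicit Types (n k m i : nat) (p eps u : R).

Definition theta p : R := - ln (1 - p).

Lemma theta_bounds p : 0 < p -> p <= 2^-1 ->
  [/\ p <= theta p, theta p <= p + 2 * p ^+ 2 & theta p <= 2 * p].
Proof.
move=> p0 p2; have q0 : 0 < 1 - p by lra.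
have h1 : p <= theta p.
  rewrite /theta -lerN2 opprK -ler_expR lnK ?posrE //.
  by apply: le_trans (expR_ge1Dx _); lra.
have h2 : theta p <= p + 2 * p ^+ 2.
  rewrite /theta -lerN2 opprK -ler_expR lnK ?posrE //.
  by apply: expR_ge_sub => //; exact: ltW.
split => //; apply: le_trans h2 _.
have : 0 <= p * (1 - 2 * p) by apply: mulr_ge0; lra.
lra.
Qed.

Lemma qXE p k : p < 1 -> (1 - p) ^+ k = expR (- (theta p * k%:R)).
Proof. by move=> p1; rewrite (qX p1). Qed.

Lemma expected_indepE n p k : p < 1 -> (k <= n)%N ->
  expected_indep n p k = expR (ln 'C(n, k)%:R - theta p * (k%:R * (k%:R - 1) / 2)).
Proof.
move=> p1 kn; rewrite /expected_indep expRB lnK ?posrE ?ltr0n ?bin_gt0 //.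
by rewrite qXE // bin2_natr expRN.
Qed.

Lemma ln_bin_ge n k : (0 < k)%N -> (k <= n)%N ->
  k%:R * (ln n%:R - ln k%:R) <= ln 'C(n, k)%:R :> R.
Proof.
move=> k0 kn; have n0 : (0 < n)%N by apply: leq_trans kn.
have h := @bin_sub_le R n k k (leqnn k) kn.
rewrite subnn bin0 mulr1 in h.
have kR : (0 : R) < k%:R by rewrite ltr0n.
have nR : (0 : R) < n%:R by rewrite ltr0n.
have CR : (0 : R) < 'C(n, k)%:R by rewrite ltr0n bin_gt0.
have : ln (n%:R ^+ k) <= ln (k%:R ^+ k * 'C(n, k)%:R) :> R.
  by rewrite ler_ln ?posrE ?mulr_gt0 ?exprn_gt0.
rewrite lnM ?posrE ?exprn_gt0 // !lnXn // -![ln _ *+ _]mulr_natl; lra.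
Qed.

Lemma ln_bin_le n k : (0 < k)%N -> (k <= n)%N ->
  ln 'C(n, k)%:R <= k%:R * lnek R n k.
Proof.
move=> k0 kn; have n0 : (0 < n)%N by apply: leq_trans kn.
have kR : (0 : R) < k%:R by rewrite ltr0n.
have nR : (0 : R) < n%:R by rewrite ltr0n.
have h := @bin_le_exp R n k k0.
have CR : (0 : R) < 'C(n, k)%:R by rewrite ltr0n bin_gt0.
have : ln 'C(n, k)%:R <= ln ((expR 1 * n%:R / k%:R) ^+ k) :> R.
  by rewrite ler_ln ?posrE ?exprn_gt0 ?divr_gt0 ?mulr_gt0 ?expR_gt0.
rewrite lnXn ?divr_gt0 ?mulr_gt0 ?expR_gt0 // ln_div ?posrE ?mulr_gt0 ?expR_gt0 //.
by rewrite lnM ?posrE ?expR_gt0 // expRK mulr_natl.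
Qed.

(* The Stirling-type refinement of [ln_bin_ge]. *)
Lemma ln_binS_ge n m : (0 < m)%N -> (m < n)%N ->
  m.+1%:R * (ln (n%:R - m%:R) + 1 - ln m.+1%:R) - 1 - ln m.+1%:R <= ln 'C(n, m.+1)%:R :> R.
Proof.
move=> m0 mn.
have h i : (i <= m.+1)%N -> ((n - m) ^ i <= n ^_ i)%N.
  elim: i => [|i IH] im; first by rewrite expn0 ffactn0.
  rewrite ffactnSr expnSr leq_mul // ?IH ?(ltnW im) // leq_sub2l //.
have {}h := h m.+1 (leqnn _).
have d0 : (0 : R) < n%:R - m%:R by rewrite subr_gt0 ltr_nat.
have f0 : (0 : R) < (m.+1)`!%:R by rewrite ltr0n fact_gt0.
have CR : (0 : R) < 'C(n, m.+1)%:R by rewrite ltr0n bin_gt0.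
have m1 : (0 : R) < m.+1%:R by rewrite ltr0n.
have e0 : (0 : R) < expR 1 by apply: expR_gt0.
have h1 : (n%:R - m%:R) ^+ m.+1 <= 'C(n, m.+1)%:R * (m.+1)`!%:R :> R.
  by rewrite -natrB ?(ltnW mn) // -natrM -natrX ler_nat bin_ffact.
have h2 := @fact_le R m.+1 (ltn0Sn m).
have : ln ((n%:R - m%:R) ^+ m.+1) <= ln ('C(n, m.+1)%:R * (m.+1)`!%:R) :> R.
  by rewrite ler_ln ?posrE ?mulr_gt0 ?exprn_gt0.
have : ln (m.+1)`!%:R <= ln (expR 1 * m.+1%:R * (m.+1%:R / expR 1) ^+ m.+1) :> R.
  by rewrite ler_ln ?posrE ?mulr_gt0 ?exprn_gt0 ?divr_gt0.
rewrite lnM ?posrE ?mulr_gt0 ?exprn_gt0 ?divr_gt0 // lnM ?posrE //.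
rewrite [ln ((_ - _) ^+ _)]lnXn // [ln ((_ / _) ^+ _)]lnXn ?divr_gt0 //.
rewrite ln_div ?posrE // expRK [ln (_ * _)]lnM ?posrE // -![ln _ *+ _]mulr_natl; lra.
Qed.

(** Take logarithms, bound the binomial coefficient by (e n / k)^k, and divide by k / 2. *)
Lemma theta_indep n p k : 0 < p -> p <= 2^-1 -> (0 < k)%N -> (k <= n)%N ->
  1 <= expected_indep n p k -> theta p * (k%:R - 1) <= 2 * lnek R n k.
Proof.
move=> p0 p2 k0 kn; have p1 : p < 1 by lra.
rewrite expected_indepE // -{1}expR0 ler_expR => h.
have kR : (0 : R) < k%:R by rewrite ltr0n.
have h2 := ln_bin_le k0 kn.
have h3 : k%:R * (theta p * (k%:R - 1)) <= k%:R * (2 * lnek R n k) by lra.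
by rewrite ler_pM2l in h3.
Qed.

Lemma expected_indep_large n p k : 0 < p -> p <= 2^-1 -> (0 < k)%N -> (k <= n)%N ->
  expR (k%:R * (ln n%:R - ln k%:R - p * k%:R)) <= expected_indep n p k.
Proof.
move=> p0 p2 k0 kn; have p1 : p < 1 by lra.
have [_ _ th2] := theta_bounds p0 p2.
rewrite expected_indepE // ler_expR.
have h := ln_bin_ge k0 kn.
have kR : (0 : R) <= k%:R by [].
have k1 : 0 <= k%:R * (k%:R - 1) :> R by apply: mulr_ge0; rewrite // subr_ge0 ler1n.
have h2 := ler_wpM2r k1 th2.
have pk : 0 <= p * k%:R by apply: mulr_ge0 => //; exact: ltW.
lra.
Qed.

(* For a fixed n, with m standing for k_x and u bounding the relative errors. *)
Record regime (eps u : R) n p m : Prop := Regime {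
  rg_eps : 0 < eps /\ eps <= 100^-1;
  rg_u : 0 < u /\ u <= 40^-1;
  rg_n : (0 < n)%N;
  rg_L : 2 * 10 ^+ 3 <= ln n%:R :> R;
  rg_p : expR ((- (2 / 3) + eps) * ln n%:R) <= p /\ p * ln n%:R ^+ 2 <= 1;
  rg_m : expR (2 * eps * ln n%:R) < expected_indep n p m;
  rg_max : forall j, expR (2 * eps * ln n%:R) < expected_indep n p j -> (j <= m)%N;
  rg_ln : ln (3 * ln n%:R) + 2 <= u * ln n%:R / 3;
  rg_inv : 10 ^+ 3 <= u * ln n%:R;
  rg_small : 10 ^+ 4 * (ln n%:R ^+ 3 * expR (- (ln n%:R / 4))) <= u }.

Section Regime.
Variables (eps u : R) (n : nat) (p : R) (m : nat).
Hypothesis rg : regime eps u n p m.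
Local Tactic Notation "lra" "from" hyp_list(hs) := clear -rg hs; lra.
Local Notation N := (n%:R : R).
Local Notation M := (m%:R : R).
Local Notation L := (ln (n%:R : R)).

Lemma rg_p_bounds : 0 < p /\ p <= 4^-1.
Proof.
case: rg => _ _ _ hL [h1 h2] _ _ _ _ _.
have p0 : 0 < p by apply: lt_le_trans h1; apply: expR_gt0.
split=> //; have h3 : 2 * L <= L * L by apply: ler_wpM2r; lra.
have : p * 4 <= p * L ^+ 2 by apply: ler_wpM2l; [exact: ltW|lra].
lra.
Qed.

Lemma rg_lnL : 0 <= ln L /\ ln L <= ln (3 * L).
Proof.
case: rg => _ _ _ hL _ _ _ _ _ _; split; first by rewrite ln_ge0; lra.
by rewrite ler_ln ?posrE; lra.
Qed.

Lemma rg_N0 : 0 < N. Proof. by rewrite ltr0n; case: rg. Qed.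

Lemma rg_m_le : (m <= n)%N.
Proof.
rewrite leqNgt; apply/negP => nm; case: rg => _ _ _ _ _ + _ _ _ _.
by rewrite /expected_indep bin_small // mul0r ltNge expR_ge0.
Qed.

(** The test value j ~ L/(12 p) has a large expectation, so maximality gives j <= m. As p >=
    n^(-2/3), ln j is at most 2 L / 3 + ln L, which leaves at least L / 6 in the exponent of
    [expected_indep_large]. *)
Lemma rg_m_lower : L / 12 <= M * p.
Proof.
have [p0 p4] := rg_p_bounds; have [lL0 lL1] := rg_lnL; have N0 := rg_N0.
case: rg => [[e0 e1] [u0 u1] n0 hL [h1 h2] hm hmax hln _ _].
have x0 : 0 <= L / (12 * p) by rewrite divr_ge0 //; lra from p0 hL.
have [j [jl ju]] := nat_above x0.
have L1 : L / (12 * p) * p = L / 12 by field; rewrite gt_eqF.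
have jp : L / 12 <= j%:R * p by rewrite -L1; apply: ler_wpM2r => //; exact: ltW.
have jp2 : j%:R * p <= L / 12 + 1.
  have := ler_wpM2r (ltW p0) (ltW ju); rewrite mulrDl L1; lra from p4.
have j0 : (0 < j)%N by rewrite -(ltr0n R) -(pmulr_lgt0 _ p0); lra from hL jp.
have jR : (0 : R) < j%:R by rewrite ltr0n.
have lnp : (- (2 / 3) + eps) * L <= ln p by rewrite -[leLHS]expRK ler_ln ?posrE ?expR_gt0.
have lj : ln j%:R <= ln L + 2 / 3 * L.
  have : ln (j%:R * p) <= ln L by rewrite ler_ln ?posrE ?mulr_gt0 //; lra from hL jp2.
  have : 0 <= eps * L by apply: mulr_ge0; lra from e0 hL.
  rewrite lnM ?posrE //; lra from lnp.
have uL : u * L <= 40^-1 * L by apply: ler_wpM2r; lra from hL u1.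
have jn : (j <= n)%N.
  by rewrite -(ler_nat R) -ler_ln ?posrE //; lra from hln lL0 lL1 lj uL.
have jm : (j <= m)%N.
  apply: hmax; apply: lt_le_trans (expected_indep_large p0 _ j0 jn); last by lra from p4.
  rewrite ltr_expR.
  have : 1 * (L / 6) <= j%:R * (L - ln j%:R - p * j%:R).
    by apply: ler_pM; rewrite ?ler1n //; lra from hL hln jp2 lL0 lL1 lj uL.
  have : eps * L <= 100^-1 * L by apply: ler_wpM2r; lra from e1 hL.
  lra from hL.
by apply: le_trans jp _; apply: ler_wpM2r; [exact: ltW|rewrite ler_nat].
Qed.

Lemma rg_m_gt0 : (0 < m)%N.
Proof.
have [p0 _] := rg_p_bounds; have := rg_m_lower; case: rg => _ _ _ hL _ _ _ _ _ _ h.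
by rewrite -(ltr0n R) -(pmulr_lgt0 _ p0); lra.
Qed.

Lemma rg_m_large : L ^+ 3 / 12 <= M.
Proof.
have [p0 _] := rg_p_bounds; have := rg_m_lower; case: rg => _ _ _ hL [_ h2] _ _ _ _ _ h.
have M0 : 0 <= M by [].
have h3 := ler_wpM2l M0 h2.
have h4 : L ^+ 2 * (L / 12) <= L ^+ 2 * (M * p) by apply: ler_wpM2l; rewrite ?sqr_ge0.
lra.
Qed.

Lemma rg_theta_le : theta p * (M - 1) <= 2 * lnek R n m.
Proof.
have [p0 p4] := rg_p_bounds.
apply: theta_indep => //; [lra|exact: rg_m_gt0|exact: rg_m_le|].
case: rg => [[e0 _] _ _ hL _ /ltW hm _ _ _ _]; apply: le_trans hm.
by apply: le_trans (expR_ge1Dx _); rewrite lerDl mulr_ge0 //; lra.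
Qed.

Lemma rg_lnek : lnek R n m <= 1 + L.
Proof.
rewrite /lnek; have : 0 <= ln M by rewrite ln_ge0 // ler1n rg_m_gt0.
lra.
Qed.

Lemma rg_Mp : M * p <= 5 / 2 * L.
Proof.
have [p0 p4] := rg_p_bounds; have h := rg_theta_le; have h2 := rg_lnek.
have [h3 _ _] := @theta_bounds p p0 (ltac:(lra)).
have M1 : 1 <= M by rewrite ler1n rg_m_gt0.
have h4 : p * (M - 1) <= theta p * (M - 1) by apply: ler_wpM2r => //; lra.
case: rg => _ _ _ hL _ _ _ _ _ _.
lra.
Qed.

Lemma rg_ln_m : ln M <= ln (3 * L) + (2 / 3 - eps) * L.
Proof.
have [p0 _] := rg_p_bounds; have h := rg_Mp; have m0 := rg_m_gt0.
case: rg => _ _ n0 hL [h1 h2] _ _ _ _ _.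
have lnp : (- (2 / 3) + eps) * L <= ln p by rewrite -[leLHS]expRK ler_ln ?posrE ?expR_gt0.
have MR : 0 < M by rewrite ltr0n.
have : ln (M * p) <= ln (3 * L) by rewrite ler_ln ?posrE ?mulr_gt0 //; lra.
rewrite lnM ?posrE //; lra.
Qed.

Lemma rg_MN : 3 * 10 ^+ 3 * (L ^+ 2 * (M / N)) <= u.
Proof.
have h := rg_ln_m; have m0 := rg_m_gt0; have N0 := rg_N0.
case: rg => [[e0 e1] [u0 u1] n0 hL _ _ _ hln _ hs].
have MR : 0 < M by rewrite ltr0n.
have L0 : 0 < L by lra.
have h2 : M / N <= 3 * L * expR (- (L / 4)).
  have -> : M / N = expR (ln M - L) by rewrite expRB !lnK ?posrE.
  have -> : 3 * L * expR (- (L / 4)) = expR (ln (3 * L) - L / 4).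
    by rewrite expRD lnK // posrE; lra.
  rewrite ler_expR.
  have : 0 <= eps * L by apply: mulr_ge0; lra from e0 hL.
  lra.
have h3 : L ^+ 2 * (M / N) <= L ^+ 2 * (3 * L * expR (- (L / 4))).
  by apply: ler_wpM2l; rewrite ?sqr_ge0.
have h4 : 0 <= L ^+ 3 * expR (- (L / 4)).
  by apply: mulr_ge0; [apply: exprn_ge0; exact: ltW|exact: expR_ge0].
lra.
Qed.

(** Since m + 1 fails the threshold, the Stirling bound [ln_binS_ge] gives the reverse of
    [rg_theta_le] up to a small error. Together they say (1-p)^m ~ (m/(e n))^2, the source of the
    e^2 in the theorem. *)
Lemma rg_theta_ge : 2 * lnek R n m - u / 2 <= theta p * M.
Proof.
have [p0 p4] := rg_p_bounds; have m0 := rg_m_gt0; have N0 := rg_N0.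
have hMN := rg_MN; have mL := rg_m_large.
case: rg => [[e0 e1] [u0 u1] n0 hL _ _ hmax hln hinv _].
have MR : 0 < M by rewrite ltr0n.
have L0 : 0 < L by lra.
have X0 : 0 < M / N by apply: divr_gt0.
have X1 : M / N <= u / (3 * 10 ^+ 3).
  have : 1 * (M / N) <= L ^+ 2 * (M / N).
    apply: ler_wpM2r; first exact: ltW.
    by have : 1 * L <= L * L by [apply: ler_wpM2r; lra from hL]; lra from hL.
  lra.
have MX : M = M / N * N by field; rewrite gt_eqF.
have MN2 : M <= N / 2 by rewrite {1}MX; have := ler_wpM2r (ltW N0) X1;
  have := ler_wpM2r (ltW N0) u1; lra from N0.
have N1 : 1 <= N by rewrite ler1n.
have mn : (m.+1 <= n)%N.
  rewrite -(ltr_nat R); lra from MN2 N0.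
have := hmax m.+1; rewrite ltnn; case: ltP => [_ /(_ isT)//|hE _].
rewrite expected_indepE ?ler_expR in hE; [|lra from p4|by []].
have hC := ln_binS_ge m0 mn.
set K := m.+1%:R in hE hC *.
have KM : K = M + 1 by rewrite /K -natr1.
have K0 : 0 < K by rewrite KM; lra from MR.
have lnd : L - 2 * (M / N) <= ln (N - M).
  have -> : N - M = N * (1 - M / N) by field; rewrite gt_eqF.
  rewrite lnM ?posrE //; last by lra from X1 u1.
  rewrite lerD2l -ler_expR lnK ?posrE; last by lra from X1 u1.
  apply: le_trans (expR_ge_sub (ltW X0) _); last by lra from X1 u1.
  rewrite ler_expR; have : 0 <= M / N * (1 - 2 * (M / N)) by apply: mulr_ge0; lra from X0 X1 u1.
  lra from rg.
have lnK' : ln K <= ln M + M^-1.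
  have -> : K = M * (1 + M^-1) by rewrite KM; field; rewrite gt_eqF.
  have Mi : 0 < M^-1 by rewrite invr_gt0.
  rewrite lnM ?posrE ?addr_gt0 //.
  by rewrite lerD2l; apply: le_ln1Dx; apply: lt_trans Mi; rewrite ltrN10.
have lnKL : ln K <= L by rewrite ler_ln ?posrE // /K ler_nat.
have h1 : K * (ln (N - M) + 1 - ln K - theta p * M / 2) <= 1 + L + 2 * eps * L.
  move: hE; rewrite KM; rewrite KM in hC lnKL; lra from hC lnKL.
have h2 : K * (L - 2 * (M / N) + 1 - ln M - M^-1 - theta p * M / 2) <= 2 * L.
  have : K * (L - 2 * (M / N) + 1 - ln M - M^-1 - theta p * M / 2) <=
     K * (ln (N - M) + 1 - ln K - theta p * M / 2) by apply: ler_wpM2l;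
       [exact: ltW|lra from lnK' lnd].
  have : eps * L <= 100^-1 * L by apply: ler_wpM2r; lra from e1 hL.
  lra from hC hE hL lnKL.
have h3 : L - 2 * (M / N) + 1 - ln M - M^-1 - theta p * M / 2 <= 2 * L / M.
  rewrite leNgt; apply/negP => h3.
  have b0 : 0 < 2 * L / M by rewrite divr_gt0 //; lra from hL.
  have := ltr_pM (ltW MR) (ltW b0) (_ : M < K) h3.
  have -> : M * (2 * L / M) = 2 * L by field; rewrite gt_eqF.
  by move=> /(_ ltac:(lra from h2)); lra from h2.
have L3 : 4 * (L / M) <= u / 8.
  rewrite mulrA ler_pdivrMr //.
  have b1 : u * (L ^+ 3 / 12) <= u * M by apply: ler_wpM2l => //; exact: ltW.
  have b4 : L * 10 ^+ 3 <= L * (u * L) by apply: ler_wpM2l => //; lra from hL.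
  have b5 : L * (u * L) * 10 ^+ 3 <= L * (u * L) * L.
    have LuL0 : 0 <= L * (u * L) by rewrite !mulr_ge0 // ltW.
    by apply: ler_wpM2l => //; lra from hL.
  lra from b1 b4 b5 hL.
have Mi : M^-1 <= L / M by rewrite ler_pdivlMr // mulVf ?gt_eqF //; lra from hL.
rewrite /lnek; lra from L3 Mi X1 h3 u0.
Qed.

End Regime.
End Threshold.

(** * Consecutive expectations near k_x *)

Section Window.
Variables (R : realType).

(** About n (1-p)^m, the expected number of vertices without neighbour in a given m-set; it is the
    predicted value of k_x - k_z. *)
Definition drift n m : R := m%:R ^+ 2 / (expR 1 ^+ 2 * n%:R).
Definition penalty n (p : R) k : R :=
  n%:R * ((1 - p) ^+ k + p * (1 - p) ^+ k.-1 * k%:R / 2).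
(** Twice the predicted distance, so that k_z lies inside with room to spare; the 3 covers rounding
    and the values up to m + 2 when the drift is tiny. *)
Definition in_window n m k := `|k%:R - m%:R| <= 2 * drift n m + 3 :> R.

Section Regime.
Variables (eps u : R) (n : nat) (p : R) (m : nat).
Hypothesis rg : regime eps u n p m.
Local Tactic Notation "lra" "from" hyp_list(hs) := clear -rg hs; lra.
Local Notation N := (n%:R : R).
Local Notation M := (m%:R : R).
Local Notation L := (ln (n%:R : R)).
Local Notation Q := (drift n m).
Local Notation LN := (ln (n%:R * p)).

Lemma drift_gt0 : 0 < Q.
Proof.
by rewrite divr_gt0 ?mulr_gt0 ?exprn_gt0 ?expR_gt0 ?ltr0n ?(rg_m_gt0 rg) // (rg_n rg).
Qed.

Lemma e2_ge4 : 4 <= expR 1 ^+ 2 :> R.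
Proof.
have h := @expR1_ge2 R; rewrite expr2.
have -> : 4 = 2 * 2 :> R by ring.
by apply: ler_pM.
Qed.

Lemma drift_le : 4 * Q <= M * (M / N).
Proof.
have N0 := rg_N0 rg.
have -> : M * (M / N) = expR 1 ^+ 2 * Q.
  by rewrite /drift; field; rewrite gt_eqF // gt_eqF ?expR_gt0.
by apply: ler_wpM2r; [exact: ltW drift_gt0|exact: e2_ge4].
Qed.

Lemma p_small : 1000 * p <= u.
Proof.
have [p0 p4] := rg_p_bounds rg.
case: rg => [[e0 e1] [u0 u1] n0 hL [h1 h2] _ hmax hln hinv _].
have L0 : 0 < L by lra.
have b1 : p * L ^+ 2 * u <= 1 * u by apply: ler_wpM2r => //; exact: ltW.
have b2 : p * L * 10 ^+ 3 <= p * L * (u * L) by apply: ler_wpM2l => //; rewrite mulr_ge0 // ltW.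
have b3 : p * 1 <= p * L by apply: ler_wpM2l; lra from p0 hL.
lra.
Qed.

Lemma MN_small : L * (M / N) <= u / 10 ^+ 3 /\ M / N <= u / 10 ^+ 3.
Proof.
have h := rg_MN rg; have N0 := rg_N0 rg.
case: rg => [[e0 e1] [u0 u1] n0 hL _ _ hmax hln hinv _].
have X0 : 0 <= M / N by rewrite divr_ge0 // ltW.
have b1 : 1 * (L * (M / N)) <= L * (L * (M / N)).
  by apply: ler_wpM2r; [rewrite mulr_ge0 //; lra from hL|lra from hL].
have b2 : 1 * (M / N) <= L * (M / N) by apply: ler_wpM2r; lra from X0 hL.
lra.
Qed.

Lemma three_small : 10 ^+ 3 <= u * M.
Proof.
have h := rg_m_large rg.
case: rg => [[e0 e1] [u0 u1] n0 hL _ _ hmax hln hinv _].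
have b1 : u * (L ^+ 3 / 12) <= u * M by apply: ler_wpM2l => //; exact: ltW.
have b2 : 10 ^+ 3 * L <= u * L * L by apply: ler_wpM2r; lra.
have b3 : 2 * 10 ^+ 3 * L <= L * L by apply: ler_wpM2r; lra from hL.
have b4 : u * L * L * 1 <= u * L * L * L.
  by apply: ler_wpM2l; [rewrite !mulr_ge0 //; lra from hL u0|lra from hL u0].
have b5 : (u * L * L) * 12 <= (u * L * L) * L.
  by apply: ler_wpM2l; [rewrite !mulr_ge0 //; lra from hL u0|lra from hL u0].
lra.
Qed.

Lemma win_k k : in_window n m k -> (1 - u) * M <= k%:R <= (1 + u) * M.
Proof.
move=> hw; have h1 := drift_le; have [_ h2] := MN_small; have h3 := three_small.
have [u0 u1] := rg_u rg.
have M0 : 0 <= M by [].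
have h4 := ler_wpM2l M0 h2.
have uM : 0 <= u * M by rewrite mulr_ge0 // ltW.
move: hw; rewrite /in_window ler_norml => /andP[a b].
apply/andP; split; lra.
Qed.

(** Across the window [theta p * k] moves by O(p (Q + 1)), and p Q <= p M (M/N) is small. Hence
    (1-p)^k is nearly constant there. *)
Lemma win_theta k : in_window n m k ->
  2 * lnek R n m - u <= theta p * k%:R <= 2 * lnek R n m + u.
Proof.
move=> hw; have [p0 p4] := rg_p_bounds rg.
have [th1 _ th2] := @theta_bounds R p p0 (ltac:(lra)).
have [u0 u1] := rg_u rg.
have h1 := drift_le; have [h2 h3] := MN_small; have ps := p_small.
have lo := rg_theta_ge rg; have hi := rg_theta_le rg; have Mp := rg_Mp rg.
have Q0 := drift_gt0.
have X0 : 0 <= M / N by rewrite divr_ge0 // ltW // (rg_N0 rg).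
have d1 : theta p * `|k%:R - M| <= 2 * p * (2 * Q + 3).
  by apply: ler_pM => //; lra from p0 th1.
have d2 : p * Q <= 1 * (u / 10 ^+ 3).
  have b1 : p * (4 * Q) <= p * (M * (M / N)) by apply: ler_wpM2l => //; exact: ltW.
  have b2 : M * p * (M / N) <= 5 / 2 * L * (M / N) by apply: ler_wpM2r.
  lra from b1 b2 h2 u0.
have d3 : theta p * (k%:R - M) <= theta p * `|k%:R - M|.
  by apply: ler_wpM2l; [lra from p0 th1|exact: ler_norm].
have d4 : - (theta p * `|k%:R - M|) <= theta p * (k%:R - M).
  by rewrite -mulrN; apply: ler_wpM2l; [lra from p0 th1|rewrite lerNl -normrN; exact: ler_norm].
apply/andP; split; lra from p0 d1 d2 d3 d4 hi lo ps th2.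
Qed.

Lemma driftE : N * expR (- (2 * lnek R n m)) = Q.
Proof.
have N0 := rg_N0 rg; have M0 : 0 < M by rewrite ltr0n (rg_m_gt0 rg).
have -> : - (2 * lnek R n m) = ln M + ln M - L - L - 1 - 1 by rewrite /lnek; ring.
rewrite !expRB expRD !lnK ?posrE // /drift.
by field; rewrite gt_eqF // gt_eqF ?expR_gt0.
Qed.

Lemma win_y k : in_window n m k ->
  Q * expR (- u) <= N * (1 - p) ^+ k <= Q * expR u.
Proof.
move=> hw; have /andP[h1 h2] := win_theta hw; have [p0 p4] := rg_p_bounds rg.
have N0 := rg_N0 rg.
rewrite -driftE -!mulrA -!expRD qXE; last by lra.
apply/andP; split; (apply: ler_wpM2l; [exact: ltW|rewrite ler_expR; lra]).
Qed.

Lemma LN_bounds : L / 3 <= LN /\ LN <= L.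
Proof.
have [p0 p4] := rg_p_bounds rg; have N0 := rg_N0 rg.
case: rg => [[e0 e1] [u0 u1] n0 hL [h1 h2] _ _ _ _ _].
have lnp : (- (2 / 3) + eps) * L <= ln p by rewrite -[leLHS]expRK ler_ln ?posrE ?expR_gt0.
have : 0 <= eps * L by apply: mulr_ge0; lra.
have : ln p <= 0 by apply: ln_le0; lra.
rewrite lnM ?posrE // => a b; split; lra from a b lnp.
Qed.

(** Up to small errors theta M = 2 (1 + ln(np) - ln(M p)), and ln(M p) is at most ln(3 L),
    negligible against ln(np) >= L / 3. *)
Lemma Mp_LN : (1 - u) * LN <= M * p / 2 /\ M * p / 2 <= LN + 2.
Proof.
have [p0 p4] := rg_p_bounds rg; have N0 := rg_N0 rg.
have [th1 th3 th2] := @theta_bounds R p p0 (ltac:(lra)).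
have ps := p_small; have Mp := rg_Mp rg; have Mp1 := rg_m_lower rg.
have lo := rg_theta_ge rg; have hi := rg_theta_le rg; have [l1 l2] := LN_bounds.
have M0 : 0 < M by rewrite ltr0n (rg_m_gt0 rg).
case: rg => [[e0 e1] [u0 u1] n0 hL [h1 h2] _ _ hln _ _].
have L0 : 0 < L by lra from hL.
have Lm : lnek R n m = 1 + LN - ln (M * p) by rewrite /lnek !lnM ?posrE //; ring.
rewrite Lm in lo hi.
have a1 : 0 <= ln (M * p) by rewrite ln_ge0; lra from p0 Mp1 hL.
have a2 : ln (M * p) <= ln (3 * L) by rewrite ler_ln ?posrE ?mulr_gt0 //; lra from Mp Mp1.
have a3 : p * M <= theta p * M by apply: ler_wpM2r => //; exact: ltW.
have a4 : theta p * M <= (p + 2 * p ^+ 2) * M by apply: ler_wpM2r => //; exact: ltW.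
have a5 : p * (M * p) <= p * (5 / 2 * L) by apply: ler_wpM2l => //; exact: ltW.
have a6 : p * L * 10 <= p * L * L.
  by apply: ler_wpM2l; [rewrite mulr_ge0 // ltW|lra from hL].
have a7 : u * (L / 3) <= u * LN by apply: ler_wpM2l => //; exact: ltW.
split; lra from a1 a2 a3 a4 a5 a6 a7 h2 hi hln lo p4 th2 u1.
Qed.

Lemma cube1D_le (x : R) : 0 <= x -> x <= 40^-1 ->
  (1 + x) * (1 + x) * (1 + x) <= 1 + 4 * x /\ (1 + 2 * x) * (1 + 5 * x) <= 1 + 8 * x.
Proof.
move=> x0 x1; have h2 : x * x <= 40^-1 * x by apply: ler_wpM2r.
have h3 : x * x * x <= 40^-1 * x * 1 by apply: ler_pM => //; [apply: mulr_ge0|lra].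
split; lra.
Qed.

(** [penalty] is n (1-p)^k times 1 + k p / (2 (1-p)). The first factor is close to Q by [win_y], the
    second to ln(np) by [Mp_LN], the lone 1 being absorbed in the relative error. *)
Lemma win_penalty k : in_window n m k ->
  (1 - 20 * u) * (Q * LN) <= penalty n p k <= (1 + 20 * u) * (Q * LN).
Proof.
move=> hw; have /andP[y1 y2] := win_y hw; have /andP[k1 k2] := win_k hw.
have [p0 p4] := rg_p_bounds rg; have N0 := rg_N0 rg.
have [m1 m2] := Mp_LN; have [l1 l2] := LN_bounds; have ps := p_small.
have M0 : 0 < M by rewrite ltr0n (rg_m_gt0 rg).
have [u0 u1] := rg_u rg; have u0' := ltW u0.
have hinv : 10 ^+ 3 <= u * L by case: rg.
have hL : 2 * 10 ^+ 3 <= L by case: rg.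
have K0 : (0 < k)%N by rewrite -(ltr0n R); apply: lt_le_trans k1; rewrite mulr_gt0 //; lra from u1.
have q0 : 0 < 1 - p by lra from p4.
have -> : penalty n p k = N * (1 - p) ^+ k * (1 + k%:R * p / (2 * (1 - p))).
  rewrite /penalty -[in (1 - p) ^+ k](prednK K0) exprS; field; rewrite gt_eqF //.
set Y := N * (1 - p) ^+ k in y1 y2 *.
have Q0 := drift_gt0.
have e1 : expR u <= 1 + 2 * u by apply: expR_le1D2x; lra from p0 ps u1.
have e2 : 1 - u <= expR (- u) by apply: expR_ge1Dx.
have a7 : u * (L / 3) <= u * LN by apply: ler_wpM2l.
have Y1 : Y <= Q * (1 + 2 * u) by apply: le_trans y2 _; apply: ler_wpM2l => //; exact: ltW.
have Y2 : Q * (1 - u) <= Y by apply: le_trans y1; apply: ler_wpM2l => //; exact: ltW.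
have LN0 : 0 < LN by lra from hL l1.
have kp2 : k%:R * p <= (1 + u) * M * p by apply: ler_wpM2r => //; exact: ltW.
have kp1 : (1 - u) * M * p <= k%:R * p by apply: ler_wpM2r => //; exact: ltW.
have kp0 : 0 <= k%:R * p by rewrite mulr_ge0 // ltW.
have q1 : k%:R * p / (2 * (1 - p)) <= k%:R * p / 2 * (1 + u).
  have -> : k%:R * p / (2 * (1 - p)) = k%:R * p / 2 * (1 - p)^-1 by field; rewrite gt_eqF.
  apply: ler_wpM2l; first by lra from kp0.
  rewrite -[leLHS]mul1r ler_pdivrMr //.
  have : p * u <= p * 1 by apply: ler_wpM2l; lra from p0 u1.
  lra from p0 ps.
have q2 : k%:R * p / 2 <= k%:R * p / (2 * (1 - p)).
  apply: ler_wpM2l => //; rewrite lef_pV2 ?posrE //; lra from p0 p4.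
set B := 1 + k%:R * p / (2 * (1 - p)).
have [c3 c5] := cube1D_le u0' u1.
have B1 : B <= (1 + 5 * u) * LN.
  have v1 : (1 + u) * (M * p / 2) <= (1 + u) * ((1 + u) * LN) by apply: ler_wpM2l;
    lra from p0 a7 hinv m2 ps.
  have v2 : k%:R * p / 2 * (1 + u) <= (1 + u) * ((1 + u) * LN) * (1 + u) by apply: ler_wpM2r;
    lra from p0 kp2 ps v1.
  have v3 : (1 + u) * (1 + u) * (1 + u) * LN <= (1 + 4 * u) * LN by apply: ler_wpM2r => //;
    exact: ltW.
  rewrite /B; lra from a7 hinv q1 v2 v3.
have B2 : (1 - 2 * u) * LN <= B.
  have v1 : (1 - u) * ((1 - u) * LN) <= (1 - u) * (M * p / 2) by apply: ler_wpM2l; lra from m1 u1.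
  have v2 : 0 <= u * u * LN by rewrite !mulr_ge0 // ltW.
  rewrite /B; lra from kp1 q2 v1 v2.
have B0 : 0 <= B by rewrite /B addr_ge0 // divr_ge0 //; lra from p4.
have QL : 0 <= Q * LN by rewrite mulr_ge0 // ltW.
apply/andP; split.
  apply: (@le_trans _ _ (Q * (1 - u) * ((1 - 2 * u) * LN))).
    have v1 : 0 <= u * u * (Q * LN) by rewrite !mulr_ge0 // ltW.
    have v2 : 0 <= u * (Q * LN) by rewrite mulr_ge0.
    lra from v1 v2.
  by apply: ler_pM => //; rewrite mulr_ge0 //; lra from Q0 l1 l2 u1.
apply: (@le_trans _ _ (Q * (1 + 2 * u) * ((1 + 5 * u) * LN))).
  by apply: ler_pM => //; apply: le_trans Y2; rewrite mulr_ge0 //; lra from Q0 u1.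
have v1 := ler_wpM2r QL c5.
have v2 : 0 <= u * (Q * LN) by rewrite mulr_ge0.
lra from v1 v2.
Qed.

Lemma win_le_n k : in_window n m k -> (k.+2 <= n)%N /\ k%:R <= N / 2.
Proof.
move=> /win_k/andP[k1 k2]; have N0 := rg_N0 rg; have [_ h] := MN_small.
have [u0 u1] := rg_u rg; have h3 := three_small.
have MX : M = M / N * N by field; rewrite gt_eqF.
have b1 : M <= u / 10 ^+ 3 * N by rewrite {1}MX; apply: ler_wpM2r => //; exact: ltW.
have b2 : u * N <= 40^-1 * N by apply: ler_wpM2r => //; exact: ltW.
have b3 : u * M <= 40^-1 * M by apply: ler_wpM2r.
have kN : k%:R <= N / 2 by lra.
by split=> //; rewrite -(ler_nat R) -addn2 natrD; lra.
Qed.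

Lemma expected_indepS k : (k <= n)%N ->
  expected_indep n p k.+1 = expected_indep n p k * ((N - k%:R) / k.+1%:R * (1 - p) ^+ k).
Proof.
move=> kn.
have k1 : k.+1%:R != 0 :> R by rewrite pnatr_eq0.
have e : k.+1%:R * 'C(n, k.+1)%:R = (N - k%:R) * 'C(n, k)%:R :> R.
  by rewrite -natrB // -!natrM mul_bin_left.
have e' : 'C(n, k.+1)%:R = 'C(n, k)%:R * ((N - k%:R) / k.+1%:R) :> R.
  by apply: (mulfI k1); rewrite e; field.
rewrite /expected_indep e' binS bin1 exprD; ring.
Qed.

Lemma expected_indep_gt0 k : (k <= n)%N -> 0 < expected_indep n p k.
Proof.
have [p0 p4] := rg_p_bounds rg => kn.
by rewrite /expected_indep mulr_gt0 ?ltr0n ?bin_gt0 // exprn_gt0 //; lra.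
Qed.

(** The ratio is about (n/k) (1-p)^k, that is Q/M = M p / (e^2 n p). Here M p is large enough to
    offset the constants in the lower bound, and at most 5 L / 2, which is below (np)^u, in the
    upper one. *)
Lemma win_ratio k : in_window n m k -> 
  expected_indep n p k * expR (- LN) <= expected_indep n p k.+1 <=
  expected_indep n p k * expR (- ((1 - u) * LN)).
Proof.
move=> hw; have [kn2 kN] := win_le_n hw.
have /andP[y1 y2] := win_y hw; have /andP[k1 k2] := win_k hw.
have kn : (k <= n)%N by apply: leq_trans kn2; rewrite ltnW.
rewrite expected_indepS //.
have E0 := ltW (expected_indep_gt0 kn).
have [p0 p4] := rg_p_bounds rg; have N0 := rg_N0 rg.
have M0 : 0 < M by rewrite ltr0n (rg_m_gt0 rg).
have [u0 u1] := rg_u rg; have u0' := ltW u0.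
have Q0 := drift_gt0; have Mp := rg_Mp rg; have Mp1 := rg_m_lower rg.
have [l1 l2] := LN_bounds.
have hln : ln (3 * L) + 2 <= u * L / 3 by case: rg.
have hL : 2 * 10 ^+ 3 <= L by case: rg.
have L0 : 0 < L by lra from hL.
have Np0 : 0 < N * p by rewrite mulr_gt0.
have K0 : (0 : R) < k%:R by apply: lt_le_trans k1; rewrite mulr_gt0 //; lra from u1.
have SK0 : (0 : R) < k.+1%:R by rewrite ltr0n.
have h3 := three_small.
have uM : u * M <= 40^-1 * M by apply: ler_wpM2r => //; exact: ltW.
have SK : k.+1%:R <= 2 * M by rewrite -natr1; lra from h3 k2 uM.
have eu : expR u <= 2 by have := expR_le1D2x u0' (ltac:(lra from u1)); lra from u1.
have eu' : 2^-1 <= expR (- u) by have := expR_ge1Dx (- u); lra from u1.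
have qk0 : 0 < (1 - p) ^+ k by rewrite exprn_gt0 //; lra from p4.
have QM : Q = M / N * M / expR 1 ^+ 2.
  by rewrite /drift; field; rewrite gt_eqF ?expR_gt0 // gt_eqF.
have e4 := e2_ge4; have e16 : expR 1 ^+ 2 <= 16 :> R.
  have h := @expR1_le4 R; rewrite expr2; have -> : 16 = 4 * 4 :> R by ring.
  by apply: ler_pM; rewrite ?expR_ge0.
have X0 : 0 < M / N by rewrite divr_gt0.
apply/andP; split; apply: ler_wpM2l => //.
- rewrite expRN lnK ?posrE //.
  have b1 : 2^-1 * (2 * M)^-1 * (Q / 2) <= (N - k%:R) / N * k.+1%:R^-1 * (N * (1 - p) ^+ k).
    apply: ler_pM.
    + by rewrite mulr_ge0 // invr_ge0; lra.
    + by rewrite divr_ge0 // ltW.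
    + have M20 : 0 < 2 * M by lra from M0.
      apply: ler_pM; [by rewrite invr_ge0|by rewrite invr_ge0 ltW| |].
        by rewrite ler_pdivlMr //; lra from kN.
      by rewrite lef_pV2 ?posrE.
    + by apply: le_trans y1; apply: ler_wpM2l => //; exact: ltW.
  have -> : (N - k%:R) / k.+1%:R * (1 - p) ^+ k = (N - k%:R) / N * k.+1%:R^-1 * (N * (1 - p) ^+ k).
    by field; rewrite !gt_eqF.
  apply: le_trans b1.
  have -> : 2^-1 * (2 * M)^-1 * (Q / 2) = M / N / (8 * expR 1 ^+ 2).
    by rewrite QM; field; rewrite gt_eqF ?expR_gt0 // !gt_eqF.
  rewrite ler_pdivlMr ?mulr_gt0 ?exprn_gt0 ?expR_gt0 //.
  have -> : M / N = M * p * (N * p)^-1 by field; rewrite !gt_eqF.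
  rewrite mulrC; apply: ler_wpM2r; first by rewrite invr_ge0 ltW.
  lra from Mp1 e16 hL.
have b1 : (N - k%:R) / k.+1%:R * (1 - p) ^+ k <= N / k%:R * (1 - p) ^+ k.
  apply: ler_wpM2r; first exact: ltW.
  apply: ler_pM; [lra from K0 N0 kN|by rewrite invr_ge0 ltW|lra from K0 N0 kN|].
  by rewrite lef_pV2 ?posrE // ler_nat.
apply: le_trans b1 _.
have -> : N / k%:R * (1 - p) ^+ k = k%:R^-1 * (N * (1 - p) ^+ k) by field; rewrite gt_eqF.
have b2 : k%:R^-1 * (N * (1 - p) ^+ k) <= (M / 2)^-1 * (Q * 2).
  apply: ler_pM; [by rewrite invr_ge0 ltW|by rewrite mulr_ge0 // ltW| |].
    by rewrite lef_pV2 ?posrE //; lra from M0 k1 k2 uM.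
  by apply: le_trans y2 _; apply: ler_wpM2l => //; exact: ltW.
apply: le_trans b2 _.
have -> : (M / 2)^-1 * (Q * 2) = M / N * (4 / expR 1 ^+ 2).
  by rewrite QM; field; rewrite gt_eqF ?expR_gt0 // !gt_eqF.
have b3 : M / N * (4 / expR 1 ^+ 2) <= M / N * 1.
  by apply: ler_wpM2l; [exact: ltW|rewrite ler_pdivrMr ?exprn_gt0 ?expR_gt0 // mul1r].
apply: le_trans b3 _; rewrite mulr1.
apply: (@le_trans _ _ (3 * L / (N * p))).
  have -> : M / N = M * p / (N * p) by field; rewrite !gt_eqF.
  by apply: ler_wpM2r; [rewrite invr_ge0 ltW|lra from Mp Mp1].
have L30 : 0 < 3 * L by lra from hL.
have -> : 3 * L / (N * p) = expR (ln (3 * L) - LN) by rewrite expRB !lnK ?posrE.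
rewrite ler_expR.
have : u * (L / 3) <= u * LN by apply: ler_wpM2l.
lra from hln.
Qed.

(** Each power of 1 - p loses one factor, while the growth of the coefficient k only helps. *)
Lemma penaltyS k : (0 < k)%N -> penalty n p k - p * penalty n p k <= penalty n p k.+1.
Proof.
move=> k0; have [p0 p4] := rg_p_bounds rg; have N0 := rg_N0 rg.
have kE : k%:R = k.-1%:R + 1 :> R by rewrite natr1 prednK.
rewrite /penalty [k.+1.-1]/= [(1 - p) ^+ k.+1]exprS -[k.+1%:R]natr1.
have -> : (1 - p) ^+ k = (1 - p) * (1 - p) ^+ k.-1 by rewrite -exprS prednK.
set y := (1 - p) ^+ k.-1; have y0 : 0 <= y by rewrite exprn_ge0 //; lra.
rewrite -subr_ge0; have -> : N * ((1 - p) * ((1 - p) * y) + p * ((1 - p) * y) * (k%:R + 1) / 2) -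
   (N * ((1 - p) * y + p * y * k%:R / 2) - p * (N * ((1 - p) * y + p * y * k%:R / 2))) =
   N * (p * ((1 - p) * y)) / 2 by field.
by rewrite divr_ge0 ?mulr_ge0 //; lra.
Qed.

End Regime.
End Window.

(** * The integer k_z *)

Section Threshold.
Variables (R : realType).

Definition weight n (p : R) k : R := expected_indep n p k * expR (- penalty n p k).

(** The value would be 0 if no k reached the threshold; [kz_of_good] shows that some k does. *)
Definition kz_of (eps : R) n (p : R) m : nat :=
  (\max_(k < m.+1 | (expR (eps * ln n%:R) <= weight n p k)%R) k)%N.

Lemma kz_of_le eps n p m : (kz_of eps n p m <= m)%N.
Proof. by apply/bigmax_leqP => k _; rewrite -ltnS. Qed.

Lemma leq_kz_of eps n p m k : (k <= m)%N -> expR (eps * ln n%:R) <= weight n p k ->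
  (k <= kz_of eps n p m)%N.
Proof.
rewrite -ltnS => km h.
exact: (@leq_bigmax_cond _ (fun k : 'I_m.+1 => expR (eps * ln n%:R) <= weight n p k)
   (fun k => k : nat) (Ordinal km)).
Qed.

Lemma kz_of_weight eps n p m k : (k <= m)%N -> expR (eps * ln n%:R) <= weight n p k ->
  expR (eps * ln n%:R) <= weight n p (kz_of eps n p m).
Proof.
rewrite -ltnS => km h.
have [|i Pi] := @eq_bigmax_cond _ (fun k : 'I_m.+1 => expR (eps * ln n%:R) <= weight n p k)
   (fun k => k : nat).
  by apply/card_gt0P; exists (Ordinal km).
by rewrite /kz_of => ->.
Qed.

Section Regime.
Variables (eps u : R) (n : nat) (p : R) (m : nat).
Hypothesis rg : regime eps u n p m.
Local Tactic Notation "lra" "from" hyp_list(hs) := clear -rg hs; lra.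
Local Notation N := (n%:R : R).
Local Notation M := (m%:R : R).
Local Notation L := (ln (n%:R : R)).
Local Notation Q := (drift R n m).
Local Notation LN := (ln (n%:R * p)).
Local Notation z := (kz_of eps n p m).

Lemma in_windowP k : M - (2 * Q + 3) <= k%:R -> (k <= m + 2)%N -> in_window R n m k.
Proof.
move=> h1 h2; rewrite /in_window ler_norml; have Q0 := drift_gt0 rg.
have : k%:R <= M + 2 :> R by rewrite -natrD ler_nat.
by move=> h3; apply/andP; split; lra.
Qed.

Lemma in_window_le a k : in_window R n m a -> (a <= k)%N -> (k <= m + 2)%N -> in_window R n m k.
Proof.
rewrite {1}/in_window ler_norml => /andP[h _] ak km; apply: in_windowP => //.
have : a%:R <= k%:R :> R by rewrite ler_nat.
lra.
Qed.

Lemma expected_indep_chain a j : in_window R n m a -> (a + j <= m + 2)%N ->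
  expected_indep n p a * expR (- (j%:R * LN)) <= expected_indep n p (a + j) <=
  expected_indep n p a * expR (- (j%:R * ((1 - u) * LN))).
Proof.
move=> hw; elim: j => [|j IH] jm.
  by rewrite addn0 !mul0r !oppr0 !expR0 !mulr1 !lexx.
have jm' : (a + j <= m + 2)%N by apply: leq_trans jm; rewrite addnS.
have /andP[h1 h2] := IH jm'.
have /andP[r1 r2] := win_ratio rg (in_window_le hw (leq_addr j a) jm').
have e x : expR (- (j.+1%:R * x)) = expR (- (j%:R * x)) * expR (- x) :> R.
  by rewrite -expRD -natr1; congr expR; ring.
rewrite addnS !e; apply/andP; split.
  by rewrite [leLHS]mulrA; apply: le_trans r1; apply: ler_wpM2r; rewrite ?expR_ge0.
by rewrite [leRHS]mulrA; apply: le_trans r2 _; apply: ler_wpM2r; rewrite ?expR_ge0.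
Qed.

Lemma QLN_ge0 : 0 <= Q * LN.
Proof.
have [l1 _] := LN_bounds rg; have hL : 2 * 10 ^+ 3 <= L by case: rg.
by apply: mulr_ge0; [exact: ltW (drift_gt0 rg)|lra].
Qed.

Lemma QL_ge0 : 0 <= Q * L.
Proof.
have hL : 2 * 10 ^+ 3 <= L by case: rg.
by apply: mulr_ge0; [exact: ltW (drift_gt0 rg)|lra].
Qed.

(** Descending D ~ 2 Q steps from m multiplies the expectation by at least (np)^(2 (1-u) Q), which
    outweighs the exponential, about (np)^(-Q) throughout the window. So m - D already meets the
    threshold, and k_z lies between m - D and m. *)
Lemma kz_of_good : in_window R n m z /\ expR (eps * L) <= weight n p z.
Proof.
have Q0 := drift_gt0 rg.
have [D [D1 D2]] := @nat_above R (2 * Q) (ltac:(lra)).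
have [u0 u1] := rg_u rg; have [e0 _] := rg_eps rg.
have hs := drift_le rg; have [_ hMN] := MN_small rg; have h3 := three_small rg.
have M0 : 0 <= M by []. have uM : u * M <= 40^-1 * M by apply: ler_wpM2r.
have hM : M * (M / n%:R) <= M * (u / 10 ^+ 3) by apply: ler_wpM2l.
have Dm : (D <= m)%N by rewrite -(ler_nat R); lra.
have wD : in_window R n m (m - D).
  apply: in_windowP; first by rewrite natrB //; lra.
  by apply: leq_trans (leq_subr _ _) _; rewrite leq_addr.
have /andP[_ c2] := @expected_indep_chain (m - D) D wD (ltac:(by rewrite subnK // leq_addr)).
rewrite subnK // in c2.
have [l1 _] := LN_bounds rg; have hL : 2 * 10 ^+ 3 <= L by case: rg.
have LN0 : 0 <= LN by lra.
have hm : expR (2 * eps * L) < expected_indep n p m by case: rg.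
have /andP[_ pe] := win_penalty rg wD.
have hF : expR (eps * L) <= weight n p (m - D).
  have b1 : expected_indep n p m * expR (D%:R * ((1 - u) * LN)) <= expected_indep n p (m - D).
    by move: c2; rewrite expRN ler_pdivlMr ?expR_gt0.
  have b2 : penalty n p (m - D) <= D%:R * ((1 - u) * LN).
    apply: le_trans pe _.
    have d1 : 2 * Q * ((1 - u) * LN) <= D%:R * ((1 - u) * LN).
      by apply: ler_wpM2r => //; rewrite mulr_ge0 //; lra from u1.
    have d2 := QLN_ge0.
    have d3 : u * (Q * LN) <= 40^-1 * (Q * LN) by apply: ler_wpM2r.
    lra from d1 d2 d3.
  have b3 : expected_indep n p m <= weight n p (m - D).
    have := ler_wpM2r (expR_ge0 (- penalty n p (m - D))) b1.
    apply: le_trans; rewrite -[leRHS]mulrA -expRD.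
    rewrite -[leLHS]mulr1; apply: ler_wpM2l; first by apply: le_trans (ltW hm); apply: expR_ge0.
    by rewrite -[leLHS]expR0 ler_expR; lra from b2.
  apply: le_trans b3; apply: le_trans (ltW hm); rewrite ler_expR.
  have : 0 <= eps * L by rewrite mulr_ge0 //; lra from e0 hL.
  lra from rg.
split; last exact: kz_of_weight (leq_subr D m) hF.
apply: in_window_le wD _ _; first exact: leq_kz_of (leq_subr D m) hF.
by apply: leq_trans (kz_of_le _ _ _ _) _; rewrite leq_addr.
Qed.

Lemma kz_of_next : (z < m)%N -> weight n p z.+1 < expR (eps * L).
Proof.
move=> zm; rewrite ltNge; apply/negP => /(leq_kz_of zm).
by rewrite ltnn.
Qed.

Lemma kz_of_in k : (z <= k)%N -> (k <= m + 2)%N -> in_window R n m k.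
Proof. exact: in_window_le kz_of_good.1. Qed.

Lemma expected_indep_m1 : expected_indep n p m.+1 <= expR (2 * eps * L).
Proof.
have hmax : forall j, expR (2 * eps * L) < expected_indep n p j -> (j <= m)%N by case: rg.
by rewrite leNgt; apply/negP => /hmax; rewrite ltnn.
Qed.

(** k_z + 1 misses n^eps although the expectation at m exceeds n^(2 eps): what is gained over the m
    - k_z - 1 steps in between cannot exceed the penalty. The logarithms are compared in units of
    ln(np). *)
Lemma gap_upper : ((m%:R - z%:R) - 1) * (1 - u) <= (1 + 20 * u) * Q.
Proof.
have Q0 := drift_gt0 rg; have [u0 u1] := rg_u rg; have [e0 _] := rg_eps rg.
have uQ : 0 <= u * Q by rewrite mulr_ge0 // ltW.
have [l1 _] := LN_bounds rg; have hL : 2 * 10 ^+ 3 <= L by case: rg.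
have LN0 : 0 < LN by lra.
have := kz_of_le eps n p m; rewrite leq_eqVlt => /orP[/eqP e|zm].
  by rewrite e; lra.
have hn := kz_of_next zm.
have w1 : in_window R n m z.+1 by apply: kz_of_in => //; apply: leq_trans zm _; rewrite leq_addr.
have hm : expR (2 * eps * L) < expected_indep n p m by case: rg.
have /andP[_ c] := @expected_indep_chain z.+1 (m - z.+1) w1 (ltac:(by rewrite subnKC // leq_addr)).
rewrite subnKC // natrB // -natr1 in c.
have /andP[_ pe] := win_penalty rg w1.
set j := m%:R - _ in c.
have b1 : expR (2 * eps * L) < expected_indep n p z.+1 * expR (- (j * ((1 - u) * LN)))
  by apply: lt_le_trans c.
have b2 : expected_indep n p z.+1 < expR (eps * L) * expR (penalty n p z.+1).
  have := hn; rewrite /weight expRN => h.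
  by rewrite -ltr_pdivrMr ?expR_gt0.
have b3 : expR (2 * eps * L) < expR (eps * L) * expR (penalty n p z.+1) *
  expR (- (j * ((1 - u) * LN))).
  by apply: lt_trans b1 _; rewrite ltr_pM2r // expR_gt0.
rewrite -!expRD ltr_expR in b3.
have eL : 0 <= eps * L by rewrite mulr_ge0 //; lra from e0 hL.
rewrite -(ler_pM2r LN0); rewrite /j in b3; lra from b3 eL pe.
Qed.

(** The comparison is with m + 1, whose expectation is at most n^(2 eps): the m + 1 - k_z steps,
    together with a factor n^eps, must pay for the penalty at k_z. The term 3 eps comes from L <= 3
    ln(np). *)
Lemma gap_lower : (1 - 20 * u) * Q <= (m%:R - z%:R) + 1 + 3 * eps.
Proof.
have Q0 := drift_gt0 rg; have [u0 u1] := rg_u rg; have [e0 _] := rg_eps rg.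
have [l1 l2] := LN_bounds rg; have hL : 2 * 10 ^+ 3 <= L by case: rg.
have LN0 : 0 < LN by lra.
have [w hF] := kz_of_good.
have zm := kz_of_le eps n p m.
have /andP[c _] := @expected_indep_chain z (m.+1 - z) w
  (ltac:(by rewrite subnKC ?leqW // addn2 ltnW)).
rewrite subnKC ?leqW // natrB ?leqW // -natr1 in c.
have /andP[pe _] := win_penalty rg w.
have b1 : expR (eps * L) * expR (penalty n p z) <= expected_indep n p z.
  by move: hF; rewrite /weight expRN ler_pdivlMr ?expR_gt0.
have b2 := le_trans c expected_indep_m1.
set j := _ - z%:R in b2.
have b3 : expR (eps * L) * expR (penalty n p z) * expR (- (j * LN)) <= expR (2 * eps * L).
  by apply: le_trans b2; apply: ler_wpM2r; rewrite ?expR_ge0.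
rewrite -!expRD ler_expR in b3.
have eL : eps * L <= eps * (3 * LN) by apply: ler_wpM2l; lra from e0 l1.
rewrite -(ler_pM2r LN0); rewrite /j in b3; lra from b3 eL pe.
Qed.

Lemma kz_of_eq : (1 + 20 * u) * (Q * LN) <= eps * L -> z = m.
Proof.
move=> h; apply/eqP; rewrite eqn_leq kz_of_le /=; apply: leq_kz_of => //.
have wm : in_window R n m m.
  apply: in_windowP; last by rewrite leq_addr.
  by have := drift_gt0 rg; lra.
have /andP[_ pe] := win_penalty rg wm.
have hm : expR (2 * eps * L) < expected_indep n p m by case: rg.
rewrite /weight; apply: (@le_trans _ _ (expR (2 * eps * L) * expR (- penalty n p m))).
  by rewrite -expRD ler_expR; lra.
by apply: ler_wpM2r; rewrite ?expR_ge0 // ltW.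
Qed.

Hypothesis cube_small :
  10 ^+ 10 * (L ^+ 3 * (M ^+ 3 / N ^+ 2) * expR (eps / 2 * L)) <= u ^+ 2.
Local Tactic Notation "lra" "from" hyp_list(hs) := clear -rg cube_small hs; lra.

Lemma cube_small' : 10 ^+ 8 * (L ^+ 3 * (M ^+ 3 / N ^+ 2)) <= 1.
Proof.
have [u0 u1] := rg_u rg; have [e0 _] := rg_eps rg.
have N0 := rg_N0 rg; have hL : 2 * 10 ^+ 3 <= L by case: rg.
have V0 : 0 <= L ^+ 3 * (M ^+ 3 / N ^+ 2).
  by apply: mulr_ge0; [apply: exprn_ge0; lra|apply: divr_ge0; apply: exprn_ge0 => //; exact: ltW].
have h := cube_small.
have e1 : L ^+ 3 * (M ^+ 3 / N ^+ 2) * 1 <= L ^+ 3 * (M ^+ 3 / N ^+ 2) * expR (eps / 2 * L).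
  apply: ler_wpM2l => //; apply: le_trans (expR_ge1Dx _); rewrite lerDl mulr_ge0 //; lra.
have u2 : u * u <= 1 * 1 by apply: ler_pM; lra from u0 u1.
lra.
Qed.

(** Two corrections separate [mass_le] from [weight]: n - k in place of n costs k/n times the
    penalty, and c^2 k n^2 is the error of the swap sum. Both are of order k^3/n^2 up to logarithms
    and at most 1/4, and e^(1/2) <= 2. *)
Lemma win_mass k : in_window R n m k -> mass n p k <= 2 * weight n p k.
Proof.
move=> hw; have [p0 p4] := rg_p_bounds rg; have N0 := rg_N0 rg.
have [kn2 kN] := win_le_n rg hw.
have kn : (k <= n)%N by apply: leq_trans kn2; rewrite ltnW.
have /andP[y1 y2] := win_y rg hw; have /andP[k1 k2] := win_k rg hw.
have [u0 u1] := rg_u rg; have u0' := ltW u0; have cs := cube_small'.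
have hs := drift_le rg; have [_ hMN] := MN_small rg; have Mp := rg_Mp rg.
have hL : 2 * 10 ^+ 3 <= L by case: rg.
have M0 : 0 < M by rewrite ltr0n (rg_m_gt0 rg).
have K0 : (0 < k)%N by rewrite -(ltr0n R); apply: lt_le_trans k1; rewrite mulr_gt0 //; lra from u1.
have q0 : 0 < 1 - p by lra from p4.
have eu : expR u <= 2 by have := expR_le1D2x u0' (ltac:(lra from u1)); lra from u1.
have Q0 := drift_gt0 rg.
have yQ : N * (1 - p) ^+ k <= 2 * Q.
  by apply: le_trans y2 _; rewrite mulrC; apply: ler_wpM2r => //; exact: ltW.
set c := p * (1 - p) ^+ k.-1.
have qk : (1 - p) ^+ k = (1 - p) * (1 - p) ^+ k.-1 by rewrite -exprS prednK.
have qk0 : 0 < (1 - p) ^+ k.-1 by rewrite exprn_gt0.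
have c0 : 0 <= c by rewrite mulr_ge0 // ltW.
have cN : c * N <= p * (M * (M / N)).
  have a1 : N * (1 - p) ^+ k.-1 * (1 - p) <= 2 * Q by rewrite -mulrA [_ * (1 - p)]mulrC -qk.
  have Y0 : 0 <= N * (1 - p) ^+ k.-1 by rewrite mulr_ge0 // ltW.
  have a3 : N * (1 - p) ^+ k.-1 * (1 / 2) <= N * (1 - p) ^+ k.-1 * (1 - p)
    by apply: ler_wpM2l => //; lra from p4.
  have a2 : N * (1 - p) ^+ k.-1 <= M * (M / N) by lra from a1 a3 hs.
  by rewrite /c -mulrA [_ * N]mulrC; apply: ler_wpM2l => //; exact: ltW.
have X0 : 0 <= M / N by rewrite divr_ge0 // ltW.
set t := M ^+ 3 / N ^+ 2 in cs *.
have t0 : 0 <= t by rewrite divr_ge0 ?exprn_ge0 // ltW.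
have Lt : L * t * (L * L) = L ^+ 3 * t by ring.
have Lt0 : 0 <= L * t by rewrite mulr_ge0 //; lra from hL.
have L2 : 100 * L <= L * L by apply: ler_wpM2r; lra from hL.
have L4 : 100 * (L * t) <= L * L * t.
  by rewrite mulrA; apply: ler_wpM2r.
have L5 : L * L * t * 100 <= L * L * t * L by apply: ler_wpM2l; [do 2!(apply: mulr_ge0 => //);
  lra from hL|lra from hL].
have L6 : 10 ^+ 8 * (L * L * t) <= 1 by rewrite -Lt in cs; lra from L5 cs.
have kM : k%:R <= 2 * M by have : u * M <= 1 * M by [apply: ler_wpM2r; lra from M0 k2 u1];
  lra from M0 k2 u1.
have cN1 : c * N <= 1.
  have a1 : p * (M * (M / N)) <= 5 / 2 * L * (M / N) by rewrite mulrA; apply: ler_wpM2r => //;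
    rewrite mulrC.
  have [a2 _] := MN_small rg; lra from a1 a2 cN u1.
have sk : (1 - p) ^+ k + c * k%:R <= 1.
  have a1 : (1 - p) ^+ k <= 1 / 4.
    rewrite -(ler_pM2l N0); apply: le_trans yQ _.
    have : M * (M / N) <= N / 2 * (u / 10 ^+ 3).
      by apply: ler_pM => //; have := win_k rg hw;
        have := win_le_n rg (in_windowP (k := m) (ltac:(lra from Q0)) (leq_addr _ _)) => -[_].
    have : N * u <= N * 1 by apply: ler_wpM2l; [exact: ltW|lra from u1].
    lra from N0 hs.
  have a2 : c * k%:R <= 1 / 2.
    have : c * k%:R <= c * (N / 2) by apply: ler_wpM2l.
    lra from cN1.
  lra from a1 a2.
have hmass := @mass_le R n p k (ltW p0) (ltac:(lra from p4)) cN1 (fun I v Ik => le_trans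
  (sbad_le v (ltW p0) (ltac:(lra from p4)) Ik) sk).
apply: le_trans hmass _.
rewrite /weight /expected_indep [leRHS]mulrCA; apply: ler_wpM2l;
  first by rewrite mulr_ge0 // exprn_ge0 // ltW.
have e12 : expR (1 / 2) <= 2 :> R
  by have := @expR_le1D2x R (1 / 2) (ltac:(lra from rg)) (ltac:(lra from rg)); lra from rg.
apply: le_trans (ler_wpM2r (expR_ge0 _) e12).
rewrite -expRD ler_expR -/c.
have -> : (N - k%:R) * ((1 - p) ^+ k + c * k%:R / 2) = penalty n p k - k%:R / N * penalty n p k.
  by rewrite /penalty -/c; field; rewrite gt_eqF.
have /andP[_ pe] := win_penalty rg hw; have [l1 l2] := LN_bounds rg.
have b1 : k%:R / N * penalty n p k <= 1 / 4.
  have d1 : u * (Q * LN) <= 40^-1 * (Q * LN) by apply: ler_wpM2r => //; exact: QLN_ge0.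
  have d2 : Q * LN <= Q * L by apply: ler_wpM2l => //; exact: ltW.
  have d3 : penalty n p k <= 2 * Q * L by have := QL_ge0; lra from d1 d2 pe.
  have d4 : 4 * Q * L <= M * (M / N) * L by apply: ler_wpM2r => //; lra from hL.
  have pe0 : 0 <= penalty n p k.
    have /andP[pe' _] := win_penalty rg hw; apply: le_trans pe'.
    by apply: mulr_ge0; [lra from u1|exact: QLN_ge0].
  have kNM : k%:R / N <= 2 * M / N by apply: ler_wpM2r => //; rewrite invr_ge0 ltW.
  have kN0 : 0 <= k%:R / N by apply: divr_ge0 => //; exact: ltW.
  have d5 : k%:R / N * penalty n p k <= 2 * M / N * (M * (M / N) * L).
    by apply: ler_pM => //; lra from d1 d2 d4 pe pe0.
  have d6 : 2 * M / N * (M * (M / N) * L) = 2 * (L * t) by rewrite /t; field; rewrite gt_eqF.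
  lra from L4 L5 cs d5 d6.
have b2 : c ^+ 2 * k%:R * N ^+ 2 <= 1 / 4.
  have cN2 : c * N <= 5 / 2 * L * (M / N).
    by apply: le_trans cN _; rewrite mulrA [p * _]mulrC; apply: ler_wpM2r.
  have cN0 : 0 <= c * N by apply: mulr_ge0 => //; exact: ltW.
  have d1 : (c * N) ^+ 2 <= (5 / 2 * L * (M / N)) ^+ 2.
    by apply: lerXn2r => //; rewrite nnegrE // (le_trans cN0).
  have d2 : (c * N) ^+ 2 * k%:R <= (5 / 2 * L * (M / N)) ^+ 2 * (2 * M).
    by apply: ler_pM => //; rewrite sqr_ge0.
  have d3 : (5 / 2 * L * (M / N)) ^+ 2 * (2 * M) = 25 / 2 * (L * L * t) by rewrite /t; field;
    rewrite gt_eqF.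
  have d4 : c ^+ 2 * k%:R * N ^+ 2 = (c * N) ^+ 2 * k%:R by ring.
  lra from L5 cs d2 d3.
lra from b1 b2.
Qed.

(** As np >= n^(1/3), the expectation falls by nearly n^(1/3) or more, while the penalty decreases
    by at most p times itself, which is bounded by 1. *)
Lemma weightS k : in_window R n m k -> weight n p k.+1 <= weight n p k * expR (- (L / 4)).
Proof.
move=> hw; have /andP[_ r2] := win_ratio rg hw.
have [p0 p4] := rg_p_bounds rg.
have [kn2 kN] := win_le_n rg hw.
have kn : (k <= n)%N by apply: leq_trans kn2; rewrite ltnW.
have /andP[k1 k2] := win_k rg hw; have [u0 u1] := rg_u rg.
have M0 : 0 < M by rewrite ltr0n (rg_m_gt0 rg).
have K0 : (0 < k)%N by rewrite -(ltr0n R); apply: lt_le_trans k1; rewrite mulr_gt0 //; lra.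
have E0 := expected_indep_gt0 rg kn.
have ps := penaltyS rg K0; have /andP[_ pe] := win_penalty rg hw; have [l1 l2] := LN_bounds rg.
have hL : 2 * 10 ^+ 3 <= L by case: rg.
have Q0 := drift_gt0 rg; have hs := drift_le rg; have Mp := rg_Mp rg.
have X0 : 0 <= M / N by rewrite divr_ge0 // ltW // (rg_N0 rg).
rewrite /weight; apply: (@le_trans _ _ (expected_indep n p k * expR (- ((1 - u) * LN)) *
  expR (- penalty n p k.+1))).
  by apply: ler_wpM2r; rewrite ?expR_ge0.
rewrite -[leLHS]mulrA -[leRHS]mulrA -!expRD; apply: ler_wpM2l; first exact: ltW.
rewrite ler_expR.
have b1 : p * penalty n p k <= 1.
  have d1 : u * (Q * LN) <= 40^-1 * (Q * LN) by apply: ler_wpM2r => //; exact: QLN_ge0.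
  have d2 : Q * LN <= Q * L by apply: ler_wpM2l => //; exact: ltW.
  have d3 : 4 * Q * L <= M * (M / N) * L by apply: ler_wpM2r => //; lra from l1 l2.
  have d4 : penalty n p k <= M * (M / N) * L by have := QL_ge0; lra from d1 d2 d3 pe.
  have d5 : p * penalty n p k <= p * (M * (M / N) * L) by apply: ler_wpM2l => //; exact: ltW.
  have d6 : M * p * (L * (M / N)) <= 5 / 2 * L * (L * (M / N)).
    by apply: ler_wpM2r => //; rewrite mulr_ge0 //; lra from l1 l2.
  have := rg_MN rg; lra from d5 d6 u1.
have : u * LN <= 40^-1 * LN by apply: ler_wpM2r => //; lra from l1 l2.
lra from b1 hL l1 ps.
Qed.

Lemma weight_chain a j : in_window R n m a -> (a + j <= m + 2)%N ->
  weight n p (a + j) <= weight n p a * expR (- (L / 4)) ^+ j.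
Proof.
move=> hw; elim: j => [|j IH] jm; first by rewrite addn0 expr0 mulr1.
have jm' : (a + j <= m + 2)%N by apply: leq_trans jm; rewrite addnS.
rewrite addnS exprSr mulrA; apply: le_trans (weightS (in_window_le hw (leq_addr j a) jm')) _.
by apply: ler_wpM2r; [exact: expR_ge0|exact: IH].
Qed.

(** For k from k_z + 2 to m + 1 good sets are counted: their estimate starts below n^eps at k_z + 1
    and then decreases geometrically. From m + 2 on the plain first moment suffices, as the
    expectation at m + 1 is at most n^(2 eps). If k_z = m only this tail remains. *)
Lemma alpha_ge_le : Ex p (fun G : graph n => (z + 2 <= alpha G)%N%:R) <= 5 * expR (- (L / 5)).
Proof.
have [p0 p4] := rg_p_bounds rg; have p1 : p <= 1 by lra.
have zm := kz_of_le eps n p m.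
have hL : 2 * 10 ^+ 3 <= L by case: rg.
have [e0 e1] := rg_eps rg; have [u0 u1] := rg_u rg; have [l1 l2] := LN_bounds rg.
have eL : eps * L <= 100^-1 * L by apply: ler_wpM2r; lra.
have tail : Ex p (fun G : graph n => (m + 2 <= alpha G)%N%:R) <= expR (- (L / 5)).
  have wm : in_window R n m m.+1 by apply: kz_of_in; [exact: leqW|rewrite addn2 ltnW].
  have /andP[_ r2] := win_ratio rg wm.
  apply: le_trans (Ex_alpha_ge n (ltW p0) (ltac:(lra from p4)) (m + 2)) _.
  rewrite -/(expected_indep n p (m + 2)) addn2; apply: le_trans r2 _.
  apply: le_trans (ler_wpM2r (expR_ge0 _) expected_indep_m1) _.
  rewrite -expRD ler_expR.
  have : u * LN <= 40^-1 * LN by apply: ler_wpM2r => //; lra.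
  lra.
have h0 : 0 <= expR (- (L / 5)) by apply: expR_ge0.
have h1 : expR (- (L / 4)) * expR (eps * L) <= expR (- (L / 5)).
  by rewrite -expRD ler_expR; lra.
have r2 : expR (- (L / 4)) <= 2^-1 :> R.
  by rewrite expRN lef_pV2 ?posrE ?expR_gt0 //; apply: le_trans (expR_ge1Dx _); lra from hL.
move: zm; rewrite leq_eqVlt => /orP[/eqP e|zm].
  by rewrite e; lra from h0 tail.
have w1 : in_window R n m z.+1 by apply: kz_of_in => //; apply: leq_trans zm _; rewrite leq_addr.
have key : Ex p (fun G : graph n => (z + 2 <= alpha G)%N%:R) <=
    \sum_(z + 2 <= k < m + 2) Ex p (fun G : graph n => (alpha G == k)%:R) +
    Ex p (fun G : graph n => (m + 2 <= alpha G)%N%:R).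
  rewrite big_geq_mkord -Ex_sum -ExD; apply: ler_Ex => //; first exact: ltW.
  move=> G; case: (leqP (m + 2) (alpha G)) => [h|h].
    rewrite [in leRHS]addrC -[leLHS]addr0; apply: lerD; first by rewrite ler_nat leq_b1.
    by apply: sumr_ge0.
  rewrite addr0; case: leqP => [zG|_]; last by apply: sumr_ge0.
  by rewrite (bigD1 (Ordinal h)) //= eqxx lerDl sumr_ge0.
apply: le_trans key _.
have bnd : \sum_(z + 2 <= k < m + 2) Ex p (fun G : graph n => (alpha G == k)%:R) <=
   \sum_(z + 2 <= k < m + 2) (2 * expR (eps * L)) * expR (- (L / 4)) ^+ (k - z.+1).
  rewrite !big_nat; apply: ler_sum => k /andP[zk km].
  have zk' : (z.+1 <= k)%N by apply: leq_trans zk; rewrite addn2.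
  have wk : in_window R n m k by apply: kz_of_in; [exact: ltnW|exact: ltnW].
  apply: le_trans (Ex_alpha_eq n (ltW p0) (ltac:(lra from p4)) k) _.
  apply: le_trans (win_mass wk) _.
  have := @weight_chain z.+1 (k - z.+1) w1 (ltac:(by rewrite subnKC // ltnW)).
  rewrite subnKC // => h; rewrite -mulrA; apply: ler_wpM2l => //.
  apply: le_trans h _; apply: ler_wpM2r; first by rewrite exprn_ge0 ?expR_ge0.
  exact: ltW (kz_of_next zm).
have e2 : \sum_(z + 2 <= k < m + 2) (2 * expR (eps * L)) * expR (- (L / 4)) ^+ (k - z.+1) <=
   2 * expR (eps * L) * (2 * expR (- (L / 4)) ^+ 1).
  rewrite -mulr_sumr; apply: ler_wpM2l; first by rewrite mulr_ge0 ?expR_ge0.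
  have -> : (z + 2 = 1 + z.+1)%N by rewrite add1n addn2.
  rewrite big_addn; under eq_bigr => i _ do rewrite addnK.
  by apply: sum_geo_le; rewrite ?expR_ge0.
rewrite expr1 in e2; lra from bnd e2 h1 tail.
Qed.

Hypotheses (ln_ln_small : 4 + ln L <= eps / 16 * L / 4)
  (exp_sqrt_small : 2 * expR (- Num.sqrt L) <= u) (pow_large : 4 <= u * expR (eps * L)).
Local Tactic Notation "lra" "from" hyp_list(hs) :=
  clear -rg cube_small ln_ln_small exp_sqrt_small pow_large hs; lra.

Lemma alpha_lt_le : Ex p (fun G : graph n => (alpha G < z)%N%:R) <= 24 * u.
Proof.
have [] := kz_of_good; have := kz_of_le eps n p m.
move: (kz_of eps n p m) => z0 zm hw hF.
have [p0 p4] := rg_p_bounds rg; have N0 := rg_N0 rg.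
have hL : 2 * 10 ^+ 3 <= L by case: rg.
have [e0 e1] := rg_eps rg; have [u0 u1] := rg_u rg; have u0' := ltW u0.
have [kn2 kN] := win_le_n rg hw.
have kn : (z0 <= n)%N by apply: leq_trans kn2; rewrite ltnW.
have /andP[y1 y2] := win_y rg hw; have /andP[k1 k2] := win_k rg hw.
have M0 : 0 < M by rewrite ltr0n (rg_m_gt0 rg).
have K0 : (0 < z0)%N by rewrite -(ltr0n R); apply: lt_le_trans k1; rewrite mulr_gt0 //; lra from u1.
have KR : (0 : R) < z0%:R by rewrite ltr0n.
have h3 := three_small rg; have uM : u * M <= 40^-1 * M by apply: ler_wpM2r => //; exact: ltW.
have K1 : (1 < z0)%N by rewrite -(ltr_nat R); lra from h3 k1 uM.
have zM : z0%:R <= M :> R by rewrite ler_nat.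
have eu : expR u <= 2 by have := expR_le1D2x u0' (ltac:(lra from u1)); lra from u1.
have Q0 := drift_gt0 rg.
have L0 : 0 < L by lra from hL.
have lnz : ln z0%:R <= ln M :> R by rewrite ler_ln ?posrE.
have eL0 : 0 <= eps * L by rewrite mulr_ge0 // ltW.
have uL : u * L <= 40^-1 * L by apply: ler_wpM2r; lra from hL u1.
have pen0 : 0 <= penalty n p z0.
  have /andP[pe _] := win_penalty rg hw; apply: le_trans pe; rewrite mulr_ge0 ?QLN_ge0 //;
    lra from u1.
apply: (@alpha_lower R n p z0 eps u) => //; try lra from e1 hL u1.
- by case: rg => _ _ _ _ [_ ?].
- rewrite -(ler_pM2l N0); apply: le_trans y2 _.
  have a1 : Q * expR u <= Q * 2 by apply: ler_wpM2l => //; exact: ltW.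
  have a2 := drift_le rg.
  have a3 : M ^+ 2 <= (2 * z0%:R) ^+ 2 by rewrite lerXn2r ?nnegrE //; lra from k1 k2 uM.
  have a4 : M ^+ 2 / N <= (2 * z0%:R) ^+ 2 / N by apply: ler_wpM2r => //; rewrite invr_ge0 ltW.
  have -> : N * (2 * (z0%:R / N) ^+ 2) = (2 * z0%:R) ^+ 2 / N / 2 by field; rewrite gt_eqF.
  have e2 : M * (M / N) = M ^+ 2 / N by rewrite mulrA.
  lra from a1 a2 a4.
- have a1 : z0%:R * p <= M * p by apply: ler_wpM2r => //; exact: ltW.
  have := rg_Mp rg; lra from a1 hL.
- have h1 : 1 <= expected_indep n p z0.
    have a1 : weight n p z0 <= expected_indep n p z0.
      rewrite /weight -[leRHS]mulr1; apply: ler_wpM2l; first exact: ltW (expected_indep_gt0 rg kn).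
      by rewrite -[leRHS]expR0 ler_expR; lra from pen0.
    apply: le_trans (le_trans hF a1); apply: le_trans (expR_ge1Dx _); lra from eL0.
  have := theta_indep p0 (ltac:(lra from p4)) K0 kn h1.
  rewrite qXE ?ler_expR; last by lra from p4.
  have -> : z0.-1%:R = z0%:R - 1 :> R by rewrite -[in RHS](prednK K0) -natr1 addrK.
  lra from rg.
- apply: le_trans cube_small; apply: ler_wpM2l; first by rewrite exprn_ge0.
  apply: ler_wpM2r; first exact: expR_ge0.
  apply: ler_wpM2l; first by rewrite exprn_ge0 // ltW.
  apply: ler_wpM2r; first by rewrite invr_ge0 exprn_ge0 // ltW.
  by rewrite lerXn2r ?nnegrE // ltW.
- have := rg_ln_m rg; have : ln (3 * L) + 2 <= u * L / 3 by case: rg.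
  lra from eL0 hL lnz uL.
- have a1 := rg_m_large rg.
  have sL : Num.sqrt L <= L.
    rewrite -[leRHS]ger0_norm ?(ltW L0) // -sqrtr_sqr ler_sqrt ?sqr_ge0 //.
    have : 1 * L <= L * L by apply: ler_wpM2r; lra from hL.
    lra from rg.
  have a2 : 200 * L <= L * L by apply: ler_wpM2r; lra from hL.
  have a3 : 1 * (L * L) <= L * (L * L) by apply: ler_wpM2r; [rewrite mulr_ge0 // ltW|lra from hL].
  lra from a1 a2 a3 hL k1 sL uM.
- have [a1 _] := MN_small rg.
  have a2 : L * (z0%:R / N) <= L * (M / N).
    apply: ler_wpM2l; first exact: ltW.
    by apply: ler_wpM2r => //; rewrite invr_ge0 ltW.
  have a3 : expR 6 * (L * (z0%:R / N)) <= 4 ^+ 6 * (L * (z0%:R / N)).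
    apply: ler_wpM2r; last exact: expRn_le4 6.
    by rewrite mulr_ge0 ?divr_ge0 // ltW.
  have -> : expR 6 * L * z0%:R / N = expR 6 * (L * (z0%:R / N)) by rewrite !mulrA.
  lra from a1 a2 a3 u1.
- have : 10 ^+ 3 <= u * L by case: rg.
  lra from rg.
Qed.

End Regime.
End Threshold.

(** * Asymptotics *)

Local Open Scope classical_set_scope.
Local Open Scope ring_scope.

Section Eventually.
Variable R : realType.
Implicit Types (x a u eps : R).

(** Eventual statements in the real variable ln n, transferred to n by [ev_ln_near]. *)
Definition ev (P : R -> Prop) := exists B, forall x, B <= x -> P x.

Lemma evI (P1 P2 : R -> Prop) : ev P1 -> ev P2 -> ev (fun x => P1 x /\ P2 x).
Proof.
move=> [B1 h1] [B2 h2]; exists (Num.max B1 B2) => x; rewrite ge_max => /andP[b1 b2].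
by split; [apply: h1|apply: h2].
Qed.

Lemma ev_imp (P1 P2 : R -> Prop) : (forall x, P1 x -> P2 x) -> ev P1 -> ev P2.
Proof. by move=> h [B hB]; exists B => x /hB /h. Qed.

Lemma ev_ge c : ev (fun x => c <= x).
Proof. by exists c. Qed.

(** The term of degree k + 1 in the exponential series already beats x^k. *)
Lemma ev_pow_exp (C a : R) k : 0 < C -> 0 < a ->
  ev (fun x => C * (x ^+ k * expR (- (a * x))) <= 1).
Proof.
move=> C0 a0; pose F : R := k.+1`!%:R.
have F0 : 0 < F by rewrite ltr0n fact_gt0.
exists (C * F / a ^+ k.+1 + 1) => x xB.
have ak : 0 < a ^+ k.+1 by rewrite exprn_gt0.
have x0 : 0 < x by apply: lt_le_trans xB; rewrite addr_gt0 // divr_gt0 // mulr_gt0.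
have ax0 : 0 < a * x by rewrite mulr_gt0.
have h : (a * x) ^+ k.+1 / F <= expR (a * x).
  by have := expR_ge1Dxn k (ltW ax0); rewrite -/F; lra.
rewrite expRN mulrA ler_pdivrMr ?expR_gt0 // mul1r.
apply: le_trans h; rewrite ler_pdivlMr // exprMn [x ^+ k.+1]exprSr mulrA.
have -> : C * x ^+ k * F = (C * F) * x ^+ k by ring.
rewrite [leRHS]mulrAC; apply: ler_wpM2r; first by rewrite exprn_ge0 // ltW.
have xB' : C * F / a ^+ k.+1 <= x by lra.
by move: xB'; rewrite ler_pdivrMr // [x * _]mulrC.
Qed.

(** Gathers what is required of x = ln n alone, independently of p and of k_x. *)
Record large_log (eps u x : R) : Prop := LargeLog {
  ll_L : 2 * 10 ^+ 3 <= x;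
  ll_inv : 10 ^+ 3 <= u * x;
  ll_ln : ln (3 * x) + 2 <= u * x / 3;
  ll_small : 10 ^+ 4 * (x ^+ 3 * expR (- (x / 4))) <= u;
  ll_cube : 10 ^+ 12 * (x ^+ 6 * expR (- (2 * eps * x))) <= u ^+ 2;
  ll_lnln : 4 + ln x <= eps / 16 * x / 4;
  ll_sqrt : 2 * expR (- Num.sqrt x) <= u;
  ll_pow : 4 <= u * expR (eps * x);
  ll_tail : 5 * expR (- (x / 5)) <= 6 * u }.

Lemma large_log_ev eps u : 0 < eps -> 0 < u -> ev (large_log eps u).
Proof.
move=> e0 u0.
have c1 := ev_ge (2 * 10 ^+ 3).
have c2 := ev_ge (10 ^+ 3 / u).
have c3 := @ev_pow_exp (3 * expR 2) (u / 3) 1 (ltac:(by rewrite mulr_gt0 ?expR_gt0)) (ltac:(lra)).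
have c4 := @ev_pow_exp (10 ^+ 4 / u) (1 / 4) 3 (ltac:(by rewrite divr_gt0 ?exprn_gt0)) (ltac:(lra)).
have c5 := @ev_pow_exp (10 ^+ 12 / u ^+ 2) (2 *
  eps) 6 (ltac:(by rewrite divr_gt0 ?exprn_gt0)) (ltac:(lra)).
have c6 := @ev_pow_exp (expR 4) (eps / 64) 1 (expR_gt0 _) (ltac:(lra)).
have [B7 c7] := @ev_pow_exp (2 / u) 1 0 (ltac:(by rewrite divr_gt0)) (ltac:(lra)).
have c8 := @ev_pow_exp (4 / u) eps 0 (ltac:(by rewrite divr_gt0)) e0.
have c9 := @ev_pow_exp (5 / u) (1 / 5) 0 (ltac:(by rewrite divr_gt0)) (ltac:(lra)).
have c7' := ev_ge (B7 ^+ 2).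
have := evI c1 (evI c2 (evI c3 (evI c4 (evI c5 (evI c6 (evI c7' (evI c8 c9))))))).
apply: ev_imp => x [x1 [x2 [x3 [x4 [x5 [x6 [x7 [x8 x9]]]]]]]].
have x0 : 0 < x by lra.
split.
- by [].
- by move: x2; rewrite ler_pdivrMr // mulrC.
- have : ln (3 * x * expR 2) <= ln (expR (u / 3 * x)).
    rewrite ler_ln ?posrE ?mulr_gt0 ?expR_gt0 //.
    by move: x3; rewrite expRN expr1 mulrA ler_pdivrMr ?expR_gt0 // mul1r mulrAC.
  rewrite expRK [ln (_ * expR 2)]lnM ?posrE ?mulr_gt0 ?expR_gt0 // expRK; lra.
- move: x4; rewrite mulrAC ler_pdivrMr // mul1r; congr (_ * (_ * expR _) <= _); lra.
- move: x5; rewrite mulrAC ler_pdivrMr ?exprn_gt0 // mul1r //.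
- have : ln (x * expR 4) <= ln (expR (eps / 64 * x)).
    rewrite ler_ln ?posrE ?mulr_gt0 ?expR_gt0 //.
    by move: x6; rewrite expRN expr1 mulrA ler_pdivrMr ?expR_gt0 // mul1r mulrC.
  rewrite expRK [ln (_ * expR 4)]lnM ?posrE ?expR_gt0 // expRK; lra.
- have h : B7 <= Num.sqrt x.
    apply: le_trans (ler_norm _) _; rewrite -sqrtr_sqr ler_sqrt //; exact: ltW.
  have := c7 _ h; rewrite expr0 !mul1r mulrAC ler_pdivrMr // mul1r //.
- move: x8; rewrite expr0 mul1r expRN mulrAC ler_pdivrMr // mul1r ler_pdivrMr ?expR_gt0 //.
- move: x9; rewrite expr0 mul1r mulrAC ler_pdivrMr // mul1r => h.
  by rewrite [x / 5]mulrC; lra.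
Qed.

Lemma ev_ln_near (P : R -> Prop) : ev P -> \forall n \near \oo, P (ln n%:R).
Proof.
move=> [B hB]; have := @nbhs_infty_gtr R (expR B); apply: filterS => n h.
apply: hB; rewrite -[leLHS]expRK ler_ln ?posrE ?expR_gt0 //; first exact: ltW.
by apply: lt_trans h; apply: expR_gt0.
Qed.

End Eventually.

Section Regimes.
Variable R : realType.
Variables (eps : R) (p : nat -> R) (kx : nat -> nat).
Hypotheses (eps0 : 0 < eps) (eps1 : eps <= 100^-1).
Hypothesis hp : \forall n \near \oo,
  n%:R `^ (- (2 / 3) + eps) < p n /\ p n < 1 / ln n%:R ^+ 2.
Hypothesis hk : \forall n \near \oo,
  is_largest (fun k => n%:R `^ (2 * eps) < expected_indep n (p n) k) (kx n).

Lemma near_regime u : 0 < u -> u <= 40^-1 ->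
  \forall n \near \oo, large_log eps u (ln n%:R) /\ regime eps u n (p n) (kx n).
Proof.
move=> u0 u1; have hL := ev_ln_near (large_log_ev eps0 u0).
have n0 := nbhs_infty_ge 1%N.
near=> n.
have n1 : (0 < n)%N by near: n.
have ll : large_log eps u (ln n%:R) by near: n.
have [p1 p2] : n%:R `^ (- (2 / 3) + eps) < p n /\ p n < 1 / ln n%:R ^+ 2 by near: n.
have [k1 k2] : is_largest (fun k => n%:R `^ (2 * eps) < expected_indep n (p n) k) (kx n) by near: n.
have nE a : (n%:R : R) `^ a = expR (a * ln n%:R).
  by rewrite /powR pnatr_eq0 eqn0Ngt n1.
split=> //; case: ll => l1 l2 l3 l4 _ _ _ _ _.
split=> //.
- split; first by rewrite -nE ltW.
  have L0 : 0 < ln n%:R :> R by lra.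
  by apply: ltW; rewrite -ltr_pdivlMr ?exprn_gt0.
- by rewrite -nE.
- by move=> j; rewrite -nE => /k2.
Unshelve. all: by end_near. Qed.

End Regimes.

(** * Two-point concentration for a fixed n *)

Section FixedGraph.
Variables (R : realType) (eps u : R) (n : nat) (p : R) (m : nat).
Hypotheses (ll : large_log eps u (ln n%:R)) (rg : regime eps u n p m).
Local Notation L := (ln (n%:R : R)).
Local Notation z := (kz_of eps n p m).

(** By [rg_ln_m], M <= 3 L n^(2/3 - eps), hence M^3/N^2 <= 27 L^3 n^(-3 eps). After the factor
    n^(eps/2) at least a saving n^(-2 eps) remains, which beats the powers of L. *)
Lemma cube_of_large_log :
  10 ^+ 10 * (L ^+ 3 * (m%:R ^+ 3 / n%:R ^+ 2) * expR (eps / 2 * L)) <= u ^+ 2.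
Proof.
have hm := rg_ln_m rg; have N0 := rg_N0 rg.
have M0 : (0 : R) < m%:R by rewrite ltr0n (rg_m_gt0 rg).
case: ll => l1 _ _ _ l5 _ _ _ _; have [e0 _] := rg_eps rg.
have L0 : 0 < L by lra.
have h : m%:R ^+ 3 / n%:R ^+ 2 <= 27 * L ^+ 3 * expR (- (3 * eps * L)).
  have -> : m%:R ^+ 3 / n%:R ^+ 2 = expR (3 * ln m%:R - 2 * L) :> R.
    by rewrite expRB !expRM_natl !lnK ?posrE.
  have -> : 27 * L ^+ 3 * expR (- (3 * eps * L)) = expR (3 * ln (3 * L) - 3 * eps * L).
    rewrite expRD expRM_natl lnK ?posrE ?mulr_gt0 //; congr (_ * _); ring.
  rewrite ler_expR; lra.
have L3 : 0 <= L ^+ 3 by rewrite exprn_ge0 // ltW.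
have h2 := ler_wpM2r (expR_ge0 (eps / 2 * L)) (ler_wpM2l L3 h).
have e : L ^+ 3 * (27 * L ^+ 3 * expR (- (3 * eps * L))) * expR (eps / 2 * L) =
   27 * (L ^+ 6 * (expR (- (3 * eps * L)) * expR (eps / 2 * L))) by ring.
rewrite e -expRD in h2.
have h3 : L ^+ 6 * expR (- (3 * eps * L) + eps / 2 * L) <= L ^+ 6 * expR (- (2 * eps * L)).
  apply: ler_wpM2l; first by rewrite exprn_ge0 // ltW.
  by rewrite ler_expR; have : 0 <= eps * L by [rewrite mulr_ge0 // ltW]; lra.
have h4 : 0 <= L ^+ 6 * expR (- (2 * eps * L)).
  by rewrite mulr_ge0 ?expR_ge0 // exprn_ge0 // ltW.
lra.
Qed.

Lemma gnp_prE (A : pred (graph n)) : gnp_pr p A = Ex p (fun G => (A G)%:R).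
Proof.
rewrite /gnp_pr /Ex big_mkcond /=; apply: eq_bigr => G _.
by case: (A G); rewrite ?mulr1 ?mulr0.
Qed.

Lemma concentrated : `|1 - gnp_pr p (fun G : graph n =>
  ((alpha G)%:Z == z%:Z) || ((alpha G)%:Z == z%:Z + 1))| <= 30 * u.
Proof.
have [p0 p4] := rg_p_bounds rg; have p0' := ltW p0; have p1 : p <= 1 by lra.
case: (ll) => _ _ _ _ _ l6 l7 l8 l9.
have h1 := alpha_lt_le rg cube_of_large_log l6 l7 l8.
have h2 := alpha_ge_le rg cube_of_large_log.
rewrite gnp_prE -[X in X - _](Ex1 (edge n) p) -ExB.
move: (kz_of eps n p m) h1 h2 => z0 h1 h2.
rewrite ger0_norm; last first.
  apply: Ex_ge0 => // G; rewrite subr_ge0.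
  by case: (_ || _).
apply: (@le_trans _ _ (Ex p (fun G : graph n => (alpha G < z0)%N%:R) +
   Ex p (fun G : graph n => (z0 + 2 <= alpha G)%N%:R))); last by lra.
rewrite -ExD; apply: ler_Ex => // G.
have -> : ((alpha G)%:Z == z0%:Z + 1) = (alpha G == z0.+1) by rewrite -addn1 -PoszD.
rewrite eqz_nat; case: ltnP => [h|h].
  by case: (_ || _); rewrite ?subrr ?subr0 //= ?addr_ge0 // lerDl.
case: (leqP (z0 + 2) (alpha G)) => [h'|h'].
  by case: (_ || _); rewrite ?subrr ?subr0 //= ?addr_ge0 // lerDr.
have -> : (alpha G == z0) || (alpha G == z0.+1).
  by move: h h'; rewrite addn2 ltnS [(_ <= z0.+1)%N]leq_eqVlt ltnS => h /orP[->|h'];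
     rewrite ?orbT // eqn_leq h h'.
by rewrite subrr addr0.
Qed.

End FixedGraph.

(** * The distance from k_x to k_z for a fixed n *)

Section FixedGap.
Variables (R : realType) (eps u : R) (n : nat) (p : R) (m : nat).
Hypotheses (ll : large_log eps u (ln n%:R)) (rg : regime eps u n p m).
Local Tactic Notation "lra" "from" hyp_list(hs) := clear -ll rg hs; lra.
Local Notation N := (n%:R : R).
Local Notation M := (m%:R : R).
Local Notation L := (ln (n%:R : R)).
Local Notation Q := (drift R n m).
Local Notation LN := (ln (n%:R * p)).
Local Notation z := (kz_of eps n p m).
Local Notation d := (m%:R - (kz_of eps n p m)%:R : R).

Lemma log_over_sqrt_sq : log_over_sqrt R n ^+ 2 = L ^+ 2 / N.
Proof.
have N0 := rg_N0 rg; rewrite /log_over_sqrt exprMn; congr (_ * _).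
rewrite -powR_mulrn ?powR_ge0 // -powRrM mulNr mulVf ?pnatr_eq0 //.
by rewrite powRN powRr1 // ltW.
Qed.

(** As M p is of order ln n, this shows that the size of Q is decided by comparing p with ln n /
    sqrt n. *)
Lemma drift_scaled : Q * (expR 1 ^+ 2 * (p ^+ 2 * N)) = (M * p) ^+ 2.
Proof.
have N0 := rg_N0 rg; rewrite /drift; field.
by rewrite gt_eqF // gt_eqF ?expR_gt0.
Qed.

(** The little-o condition is taken at the constant [eps]: then Q <= (25/16) eps^2, so the penalty
    stays below eps L, the slack between the thresholds of k_x and k_z. *)
Lemma kz_of_eq_dense : eps <= 100^-1 -> u = 40^-1 ->
  `|log_over_sqrt R n| <= eps * `|p| -> z = m.
Proof.
move=> e1 u40 h; have [p0 _] := rg_p_bounds rg; have N0 := rg_N0 rg.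
have [e0 _] := rg_eps rg; have Q0 := drift_gt0 rg.
have Mp := rg_Mp rg; have M0 : 0 < M by rewrite ltr0n (rg_m_gt0 rg).
have hL : 2 * 10 ^+ 3 <= L by case: rg.
have [l1 l2] := LN_bounds rg.
have h2 : L ^+ 2 <= eps ^+ 2 * (p ^+ 2 * N).
  rewrite mulrA -ler_pdivrMr // -log_over_sqrt_sq -exprMn -[leLHS]real_normK ?num_real //.
  rewrite (gtr0_norm p0) in h.
  by rewrite ler_sqr ?nnegrE ?mulr_ge0 ?normr_ge0 // ltW.
have h3 : (M * p) ^+ 2 <= (5 / 2 * L) ^+ 2.
  by rewrite ler_sqr ?nnegrE // ?mulr_ge0 ?(ltW M0) ?(ltW p0) //; lra.
have pN0 : 0 < p ^+ 2 * N by rewrite mulr_gt0 // exprn_gt0.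
have h4 : Q * (4 * (p ^+ 2 * N)) <= (M * p) ^+ 2.
  rewrite -drift_scaled; apply: ler_wpM2l; first exact: ltW.
  by apply: ler_wpM2r; [exact: ltW|exact: e2_ge4].
have h5 : Q <= 25 / 16 * eps ^+ 2.
  rewrite -(ler_pM2r pN0).
  have e : (5 / 2 * L) ^+ 2 = 25 / 4 * L ^+ 2 by rewrite exprMn; congr (_ * _); lra.
  rewrite e in h3.
  lra from h2 h3 h4.
apply: (kz_of_eq rg); rewrite u40.
have h6 : Q * LN <= 25 / 16 * eps ^+ 2 * L.
  apply: ler_pM => //; [exact: ltW|lra from hL l1].
have h7 : eps * (eps * L) <= 100^-1 * (eps * L).
  by apply: ler_wpM2r => //; rewrite mulr_ge0 ?(ltW e0) //; lra from hL.
have : 0 <= eps * L by rewrite mulr_ge0 ?(ltW e0) //; lra from hL.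
rewrite expr2 in h6; lra from h6 h7.
Qed.

Lemma gap_near_drift : `|d - Q| <= 22 * u * Q + 2.
Proof.
have Q0 := drift_gt0 rg; have [u0 u1] := rg_u rg; have [e0 e1] := rg_eps rg.
have up := gap_upper rg; have lo := gap_lower rg.
move: (kz_of eps n p m) up lo => z0 up lo.
have uQ : 0 < u * Q by rewrite mulr_gt0.
have uuQ : u * (u * Q) <= 40^-1 * (u * Q) by apply: ler_wpM2r; [exact: ltW|].
rewrite ler_norml; apply/andP; split; first by lra.
have c0 : 0 < 1 - u by lra.
suff : (m%:R - z0%:R - 1) * (1 - u) <= ((1 + 22 * u) * Q) * (1 - u).
  by rewrite ler_pM2r //; lra.
apply: le_trans up _; lra.
Qed.

(** The constant 96 is chosen so that e Q >= 4: from M p >= L / 12 and [expR 1 ^+ 2 <= 16] one gets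
    L^2 <= 2304 Q p^2 N, and 96^2 = 4 * 2304. The additive 2 of [gap_near_drift] is then at most e Q
    / 2, and so is 22 u Q. *)
Lemma gap_asymp e : 0 < e -> 44 * u <= e ->
  `|p| <= Num.sqrt e / 96 * `|log_over_sqrt R n| -> `|1 - d / Q| <= e.
Proof.
move=> e0 ue h; have [p0 _] := rg_p_bounds rg; have N0 := rg_N0 rg.
have Q0 := drift_gt0 rg.
have lo := rg_m_lower rg; have M0 : 0 < M by rewrite ltr0n (rg_m_gt0 rg).
have hL : 2 * 10 ^+ 3 <= L by case: rg.
have L0 : 0 < L by lra.
have h2 : p ^+ 2 * N <= e / 9216 * L ^+ 2.
  rewrite -ler_pdivlMr // -[leRHS]mulrA -log_over_sqrt_sq.
  have -> : e / 9216 = (Num.sqrt e / 96) ^+ 2.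
    by rewrite exprMn sqr_sqrtr ?(ltW e0) //; congr (_ * _); lra from rg.
  rewrite -exprMn -[leLHS]real_normK ?num_real // -[leRHS]real_normK ?num_real //.
  rewrite ler_sqr ?nnegrE ?normr_ge0 // normrM; apply: le_trans h _.
  by apply: ler_wpM2r => //; apply: ler_norm.
have h3 : L ^+ 2 <= 144 * (M * p) ^+ 2.
  have -> : 144 * (M * p) ^+ 2 = (12 * (M * p)) ^+ 2 by ring.
  by rewrite ler_sqr ?nnegrE ?mulr_ge0 ?(ltW p0) ?(ltW M0) ?(ltW L0) //; lra from lo.
have e16 : expR 1 ^+ 2 <= 16 :> R.
  have -> : 16 = 4 ^+ 2 :> R by lra from rg.
  by rewrite ler_sqr ?nnegrE ?expR_ge0 //; apply: expR1_le4.
have pN0 : 0 < p ^+ 2 * N by rewrite mulr_gt0 // exprn_gt0.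
have h4 : (M * p) ^+ 2 <= Q * (16 * (p ^+ 2 * N)).
  rewrite -drift_scaled; apply: ler_wpM2l; first exact: ltW.
  by apply: ler_wpM2r; [exact: ltW|].
have LL : 0 < L ^+ 2 by rewrite exprn_gt0.
have h5 : 4 <= e * Q.
  rewrite -(ler_pM2r LL).
  have : Q * (p ^+ 2 * N) <= Q * (e / 9216 * L ^+ 2) by apply: ler_wpM2l; [exact: ltW|].
  lra from h3 h4.
have -> : 1 - d / Q = - ((d - Q) / Q) by field; rewrite gt_eqF.
rewrite normrN normrM [`|Q^-1|]gtr0_norm ?invr_gt0 // ler_pdivrMr //.
apply: le_trans gap_near_drift _.
have : 44 * u * Q <= e * Q by apply: ler_wpM2r; [exact: ltW|].
lra from h5.
Qed.

(** The quotient is the square of M p / (2 ln(np)), which [Mp_LN] places close to 1. *)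
Lemma drift_asymp :
  `|1 - Q / (4 * LN ^+ 2 / (expR 1 ^+ 2 * p ^+ 2 * N))| <= 3 * u.
Proof.
have [p0 _] := rg_p_bounds rg; have N0 := rg_N0 rg; have [u0 u1] := rg_u rg.
have [l1 l2] := LN_bounds rg; have [a b] := Mp_LN rg.
case: ll => hL hu _ _ _ _ _ _ _.
have LN0 : 0 < LN by lra.
have [s sE] : exists s, s = M * p / (2 * LN) by exists (M * p / (2 * LN)).
have -> : Q / (4 * LN ^+ 2 / (expR 1 ^+ 2 * p ^+ 2 * N)) = s ^+ 2.
  by rewrite /drift sE; field; rewrite !gt_eqF // expR_gt0.
have s1 : 1 - u <= s by rewrite sE ler_pdivlMr ?mulr_gt0 //; lra.
have s2 : s <= 1 + u.
  rewrite sE ler_pdivrMr ?mulr_gt0 //.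
  have : u * (L / 3) <= u * LN by apply: ler_wpM2l; [exact: ltW|].
  lra.
have t1 : (1 - u) ^+ 2 <= s ^+ 2 by rewrite ler_sqr ?nnegrE //; lra from s1 u1.
have t2 : s ^+ 2 <= (1 + u) ^+ 2 by rewrite ler_sqr ?nnegrE //; lra from s1 u0 u1.
have uu : u * u <= 40^-1 * u by apply: ler_wpM2r; [exact: ltW|].
have uu0 : 0 <= u * u by rewrite mulr_ge0 ?(ltW u0).
rewrite ler_norml; apply/andP.
have e1 : (1 - u) ^+ 2 = 1 - 2 * u + u * u by ring.
have e2 : (1 + u) ^+ 2 = 1 + 2 * u + u * u by ring.
rewrite e1 in t1; rewrite e2 in t2; split; lra from t1 t2 u0 uu uu0.
Qed.

(** Here 2 ln(np) = L + 2 ln C + 2 ln L, so M p / L is close to 1 and Q to q. [gap_upper] and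
    [gap_lower] confine d to roughly (q - 1, q + 1); the stated interval absorbs the errors, on the
    upper side at most 40 u q <= 2/5. *)
Lemma gap_window (C : R) : eps <= 100^-1 -> 0 < C -> p = C * log_over_sqrt R n ->
  `|2 * ln C| + 4 <= u * L / 3 ->
  let q := 1 / (expR 1 ^+ 2 * C ^+ 2) in 100 * (u * q) <= 1 ->
  q - 5 / 2 < d /\ d < q + 3 / 2.
Proof.
move=> e1 C0 pE hC q uq; have [p0 _] := rg_p_bounds rg; have N0 := rg_N0 rg.
have [u0 u1] := rg_u rg; have [a b] := Mp_LN rg.
case: ll => hL hu hl _ _ _ _ _ _.
have L0 : 0 < L by lra.
have LL : 0 < L ^+ 2 by rewrite exprn_gt0.
have E2 : 0 < expR 1 ^+ 2 :> R by rewrite exprn_gt0 // expR_gt0.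
have C2 : 0 < C ^+ 2 by rewrite exprn_gt0.
have q0 : 0 < q by rewrite divr_gt0 ?mulr_gt0.
have p2 : p ^+ 2 * N = C ^+ 2 * L ^+ 2.
  by rewrite pE exprMn log_over_sqrt_sq; field; rewrite gt_eqF.
have LNE : 2 * LN = L + 2 * ln C + 2 * ln L.
  have h t : 0 < t -> ln (t ^+ 2) = 2 * ln t by move=> t0; rewrite lnXn // mulr_natl.
  rewrite -h ?mulr_gt0 //.
  have -> : (N * p) ^+ 2 = C ^+ 2 * L ^+ 2 * N by rewrite -p2; ring.
  rewrite (@lnM _ (C ^+ 2 * L ^+ 2) N) ?posrE ?mulr_gt0 //.
  rewrite (@lnM _ (C ^+ 2) (L ^+ 2)) ?posrE // !h //; lra from rg.
have lnL : 0 <= ln L /\ ln L <= ln (3 * L).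
  by split; [apply: ln_ge0; lra from hL|rewrite ler_ln ?posrE ?mulr_gt0 //; lra from hL].
have [t tE] : exists t, t = M * p / L by exists (M * p / L).
have QE : Q = t ^+ 2 * q.
  apply: (@mulIf _ (expR 1 ^+ 2 * (p ^+ 2 * N))).
    by rewrite gt_eqF // mulr_gt0 // mulr_gt0 // exprn_gt0.
  rewrite drift_scaled p2 tE /q; field.
  by rewrite !gt_eqF // expR_gt0.
have lnC1 := ler_norm (2 * ln C); have lnC2 := ler_norm (- (2 * ln C)).
rewrite normrN in lnC2.
have t1 : 1 - 2 * u <= t.
  rewrite tE ler_pdivlMr //.
  have : (1 - u) * ((1 - u) * L) <= (1 - u) * (2 * LN) by apply: ler_wpM2l;
    lra from LNE hC hu lnC2 lnL u1.
  have : 0 <= u * (u * L) by rewrite mulr_ge0 ?mulr_ge0 ?(ltW u0) ?(ltW L0).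
  lra from a.
have t2 : t <= 1 + u by rewrite tE ler_pdivrMr //; lra from LNE b hC hl lnC1 lnL.
have uu : u * u <= 40^-1 * u by apply: ler_wpM2r; [exact: ltW|].
have T1 : 1 - 4 * u <= t ^+ 2.
  apply: (@le_trans _ _ ((1 - 2 * u) ^+ 2)); last by rewrite ler_sqr ?nnegrE //; lra from t1 u1.
  have : 0 <= u * u by rewrite mulr_ge0 ?(ltW u0).
  have -> : (1 - 2 * u) ^+ 2 = 1 - 4 * u + 4 * (u * u) by ring.
  lra from rg.
have T2 : t ^+ 2 <= 1 + 3 * u.
  apply: (@le_trans _ _ ((1 + u) ^+ 2)); first by rewrite ler_sqr ?nnegrE //; lra from t1 u0 u1.
  have -> : (1 + u) ^+ 2 = 1 + 2 * u + u * u by ring.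
  lra from u0 uu.
have up := gap_upper rg; have lo := gap_lower rg.
move: (kz_of eps n p m) up lo => z0 up lo.
have Q1 : (1 - 4 * u) * q <= Q by rewrite QE ler_wpM2r // ltW.
have Q2 : Q <= (1 + 3 * u) * q by rewrite QE ler_wpM2r // ltW.
have uq0 : 0 < u * q by rewrite mulr_gt0.
have uuq : u * (u * q) <= 40^-1 * (u * q) by apply: ler_wpM2r; [exact: ltW|].
have uuq0 : 0 <= u * (u * q) by rewrite mulr_ge0 ?(ltW u0) ?(ltW uq0).
split.
  have h : (1 - 20 * u) * ((1 - 4 * u) * q) <= (1 - 20 * u) * Q by apply: ler_wpM2l; lra from Q1 u1.
  lra from e1 h lo uq uuq0.
have h : (1 + 20 * u) * Q <= (1 + 20 * u) * ((1 + 3 * u) * q) by apply: ler_wpM2l; lra from Q2 u0.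
have c0 : 0 < 1 - u by lra from u1.
suff : (m%:R - z0%:R - 1) * (1 - u) <= ((1 + 40 * u) * q) * (1 - u).
  by rewrite ler_pM2r //; lra from uq.
apply: le_trans up _; apply: le_trans h _; lra from Q1 Q2 uuq.
Qed.

End FixedGap.

Theorem theorem3 (R : realType) :
  exists eps0 : R, 0 < eps0 /\
  forall eps : R, 0 < eps -> eps <= eps0 ->
  forall p : nat -> R,
    (\forall n \near \oo,
        n%:R `^ (- (2 / 3) + eps) < p n /\ p n < 1 / ln n%:R ^+ 2) ->
  forall kx : nat -> nat,
    (\forall n \near \oo,
        is_largest (fun k => n%:R `^ (2 * eps) < expected_indep n (p n) k)
          (kx n)) ->
  exists kz : nat -> int,
    let d : nat -> R := fun n => ((kx n)%:Z - kz n)%:~R in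
    [/\ whp p (fun n G => ((alpha G)%:Z == kz n) || ((alpha G)%:Z == kz n + 1)),
        little_omega p (@log_over_sqrt R) ->
          \forall n \near \oo, (kx n)%:Z - kz n = 0,
        forall C : R, 0 < C ->
          (\forall n \near \oo, p n = C * log_over_sqrt R n) ->
          \forall n \near \oo,
            1 / (expR 1 ^+ 2 * C ^+ 2) - 5 / 2 < d n /\
            d n < 1 / (expR 1 ^+ 2 * C ^+ 2) + 3 / 2
      & p =o_\oo (@log_over_sqrt R) ->
          asymp_equiv d (fun n => (kx n)%:R ^+ 2 / (expR 1 ^+ 2 * n%:R)) /\
          asymp_equiv (fun n => (kx n)%:R ^+ 2 / (expR 1 ^+ 2 * n%:R))
            (fun n => 4 * ln (n%:R * p n) ^+ 2
                      / (expR 1 ^+ 2 * p n ^+ 2 * n%:R))].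
Proof.
(* This constant keeps n^(2 eps) well below the factor n^(1/4) lost at each step, and 3 eps within
   the slack of the window in the critical case. *)
exists 100^-1; split=> // eps e0 e1 p hp kx hk.
have near_rg := near_regime e0 e1 hp hk.
exists (fun n => (kz_of eps n (p n) (kx n))%:Z) => /=.
have dE n : ((kx n)%:Z - (kz_of eps n (p n) (kx n))%:Z)%:~R =
    (kx n)%:R - (kz_of eps n (p n) (kx n))%:R :> R.
  by rewrite intrB !pmulrn.
split.
- apply/cvgrPdist_le => e e_gt0.
  have u0 : 0 < Num.min 40^-1 (e / 30) :> R by rewrite lt_min invr_gt0 ltr0n divr_gt0.
  have u1 : Num.min 40^-1 (e / 30) <= 40^-1 by rewrite ge_min lexx.
  have u2 : Num.min 40^-1 (e / 30) <= e / 30 by rewrite ge_min lexx orbT.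
  apply: filterS (near_rg _ u0 u1) => n [ll rg].
  by apply: le_trans (concentrated ll rg) _; lra.
- move=> /eqoP ho; have u0 : 0 < 40^-1 :> R by [].
  near=> n.
  have [ll rg] : large_log eps 40^-1 (ln n%:R) /\ regime eps 40^-1 n (p n) (kx n).
    by near: n; exact: near_rg.
  rewrite (kz_of_eq_dense rg e1 erefl) ?subrr //.
  by near: n; exact: ho.
- move=> C C0 hC; set q := 1 / _.
  have q0 : 0 < q by rewrite divr_gt0 ?mulr_gt0 ?exprn_gt0 ?expR_gt0.
  have u0 : 0 < (40 + 100 * q)^-1 by rewrite invr_gt0; lra.
  have u1 : (40 + 100 * q)^-1 <= 40^-1 by rewrite lef_pV2 ?posrE; lra.
  have nC := ev_ln_near (ev_ge ((`|2 * ln C| + 4) * 3 / (40 + 100 * q)^-1)).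
  have uq r : 0 < r -> 100 * ((40 + 100 * r)^-1 * r) <= 1 :> R.
    by move=> r0; rewrite mulrCA [leLHS]mulrC ler_pdivrMr ?mul1r; lra.
  near=> n.
  have [ll rg] : large_log eps (40 + 100 * q)^-1 (ln n%:R) /\
      regime eps (40 + 100 * q)^-1 n (p n) (kx n).
    by near: n; exact: near_rg.
  rewrite dE; apply: (gap_window ll rg e1 C0).
  + by near: n.
  + rewrite ler_pdivlMr // [leRHS]mulrC -ler_pdivrMr //.
    by near: n; exact: nC.
  + exact: uq.
- move=> /eqoP ho; split; apply/cvgrPdist_le => e e_gt0.
  + have u0 : 0 < Num.min 40^-1 (e / 44) :> R by rewrite lt_min invr_gt0 ltr0n divr_gt0.
    have u1 : Num.min 40^-1 (e / 44) <= 40^-1 by rewrite ge_min lexx.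
    have u2 : Num.min 40^-1 (e / 44) <= e / 44 by rewrite ge_min lexx orbT.
    have a0 : 0 < Num.sqrt e / 96 by rewrite divr_gt0 ?sqrtr_gt0.
    near=> n.
    have [ll rg] : large_log eps (Num.min 40^-1 (e / 44)) (ln n%:R) /\
        regime eps (Num.min 40^-1 (e / 44)) n (p n) (kx n).
      by near: n; exact: near_rg.
    rewrite dE; apply: (gap_asymp rg) => //; first lra.
    by near: n; exact: ho.
  + have u0 : 0 < Num.min 40^-1 (e / 3) :> R by rewrite lt_min invr_gt0 ltr0n divr_gt0.
    have u1 : Num.min 40^-1 (e / 3) <= 40^-1 by rewrite ge_min lexx.
    have u2 : Num.min 40^-1 (e / 3) <= e / 3 by rewrite ge_min lexx orbT.
    apply: filterS (near_rg _ u0 u1) => n [ll rg].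
    by apply: le_trans (drift_asymp ll rg) _; lra.
Unshelve. all: by end_near. Qed.
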